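(* The decision problem Informational Persuasion, defined below, is NP-complete: it belongs to NP, and it is NP-hard (under polynomial-time many-one reductions). Informational Persuasion. Input: a finite sample space $\Omega$ with $\sigma$-algebra $2^\Omega$ and a probability measure $\pi$ on it, given by a rational probability $\pi(\omega)\ge 0$ for each $\omega\in\Omega$ with $\sum_{\omega\in\Omega}\pi(\omega)=1$; a focal event $E\subseteq\Omega$; a finite collection of facts $\mathcal{F}=\{F_1,\dots,F_N\}$ with each $F_i\subseteq\Omega$; and a rational threshold $p\in(0,1]$. Question: does there exist a subcollection $\mathcal{R}\subseteq\mathcal{F}$ with $\pi\big(\bigcap_{R\in\mathcal{R}}R\big)>0$ such that $$\pi(E\mid\mathcal{R}) \;=\; \frac{\pi\big(E\cap\bigcap_{R\in\mathcal{R}}R\big)}{\pi\big(\bigcap_{R\in\mathcal{R}}R\big)}\;\ge\; p\,?$$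
   Context: Interpretation: a sender holds private facts (events) $F_1,\dots,F_N$ and chooses a subset $\mathcal{R}$ of them to report to a receiver; the receiver's posterior belief in the focal event $E$ after the report is the conditional probability $\pi(E\mid\mathcal{R})$ of $E$ given the intersection of the reported facts. The intersection over the empty subcollection is $\Omega$. The input size is the length of a standard binary encoding of $\Omega$ (as a list of points), the rational values $\pi(\omega)$, the sets $E,F_1,\dots,F_N$ (as lists of points), and $p$. *)

(* Defs.v *)
From HB Require Import structures.
From mathcomp Require Import all_boot all_order all_algebra.
Set Implicit Arguments.
Unset Strict Implicit.
Unset Printing Implicit Defensive.
Import Order.TTheory GRing.Theory Num.Theory.

Definition language := seq bool -> Prop.

(* Deterministic single-tape Turing machines, bi-infinite tape, tape        *)
(* alphabet {blank, 0, 1} encoded as option bool (None = blank).            *)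
(* delta q a = None means the machine halts in state q.                     *)

Inductive move := MoveL | MoveR | Stay.

Record TM := mkTM {
  tm_state : finType;
  tm_start : tm_state;
  tm_delta : tm_state -> option bool -> option (tm_state * option bool * move);
  tm_accept : tm_state -> bool
}.

(* configuration: state, tape left of the head (nearest cell first),
   scanned symbol, tape right of the head (nearest first); all other cells
   are blank. *)
Record config (M : TM) := Config {
  cf_state : tm_state M;
  cf_left : seq (option bool);
  cf_cur : option bool;
  cf_right : seq (option bool)
}.

Definition step (M : TM) (c : config M) : option (config M) :=
  match tm_delta (cf_state c) (cf_cur c) with
  | None => None
  | Some (q', w, mv) =>
      Some match mv with
        | Stay => Config q' (cf_left c) w (cf_right c)
        | MoveR => Config q' (w :: cf_left c) (head None (cf_right c)) (behead (cf_right c))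
        | MoveL => Config q' (behead (cf_left c)) (head None (cf_left c)) (w :: cf_right c)
        end
  end.

Definition halted (M : TM) (c : config M) : Prop := step c = None.

Fixpoint exec (M : TM) (t : nat) (c : config M) : config M :=
  match t with
  | 0 => c
  | t'.+1 => match step c with None => c | Some c' => exec t' c' end
  end.

Definition init (M : TM) (x : seq bool) : config M :=
  Config (tm_start M) [::] (head None (map Some x)) (behead (map Some x)).

Fixpoint read_word (s : seq (option bool)) : seq bool :=
  match s with
  | Some b :: s' => b :: read_word s'
  | _ => [::]
  end.

Definition output (M : TM) (c : config M) : seq bool :=
  read_word (cf_cur c :: cf_right c).

Definition decides_in_ptime (M : TM) (L : language) : Prop :=
  exists c k : nat, forall x : seq bool,
    let cf := exec (c * (size x).+1 ^ k) (init M x) in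
    halted cf /\ (@tm_accept M (cf_state cf) <-> L x).

Definition in_P (L : language) : Prop := exists M : TM, decides_in_ptime M L.

Definition ptime_computable (f : seq bool -> seq bool) : Prop :=
  exists (M : TM) (c k : nat), forall x : seq bool,
    let cf := exec (c * (size x).+1 ^ k) (init M x) in
    halted cf /\ output cf = f x.

Definition pair_enc (x w : seq bool) : seq bool :=
  flatten [seq [:: b; b] | b <- x] ++ [:: false; true] ++ w.

Definition in_NP (L : language) : Prop :=
  exists V : language, in_P V /\
    exists c k : nat, forall x : seq bool,
      L x <-> exists w : seq bool, size w <= c * (size x).+1 ^ k /\ V (pair_enc x w).

Definition poly_reduces (L1 L2 : language) : Prop :=
  exists f, ptime_computable f /\ forall x, L1 x <-> L2 (f x).

Definition NP_hard (L : language) : Prop :=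
  forall L' : language, in_NP L' -> poly_reduces L' L.

Definition NP_complete (L : language) : Prop := in_NP L /\ NP_hard L.

Local Open Scope ring_scope.

(* An instance.  The sample space is Omega = {0, ..., size ip_pi - 1}
   (listed implicitly by the list of point probabilities); ip_pi`_w is pi(w);
   E and each fact F_i are lists of points; p is the threshold. *)
Record ip_instance := IPInstance {
  ip_pi : seq rat;
  ip_E : seq nat;
  ip_F : seq (seq nat);
  ip_p : rat
}.

Definition ip_valid (I : ip_instance) : Prop :=
  [/\ all (fun q => 0 <= q) (ip_pi I),
      \sum_(q <- ip_pi I) q = 1,
      all (fun w => (w < size (ip_pi I))%N) (ip_E I),
      all (all (fun w => (w < size (ip_pi I))%N)) (ip_F I)
    & 0 < ip_p I <= 1].

Definition ip_prob (I : ip_instance) (A : pred nat) : rat :=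
  \sum_(w < size (ip_pi I) | A w) (ip_pi I)`_w.

Definition ip_inter (R : seq (seq nat)) : pred nat :=
  fun w => all (fun F => w \in F) R.

Definition ip_yes (I : ip_instance) : Prop :=
  exists m : bitseq,
    let R := mask m (ip_F I) in
    0 < ip_prob I (ip_inter R) /\
    ip_p I <= ip_prob I (fun w => (w \in ip_E I) && ip_inter R w)
              / ip_prob I (ip_inter R).

Inductive token := Tk0 | Tk1 | TkComma | TkOpen | TkClose.

Definition token_bits (t : token) : seq bool :=
  match t with
  | Tk0 => [:: false; false; false]
  | Tk1 => [:: false; false; true]
  | TkComma => [:: false; true; false]
  | TkOpen => [:: false; true; true]
  | TkClose => [:: true; false; false]
  end.

Fixpoint bin_aux (fuel n : nat) : seq bool :=
  match fuel with
  | 0 => [::]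
  | f.+1 => if n is 0 then [::] else odd n :: bin_aux f n./2
  end.
Definition bin (n : nat) : seq bool := bin_aux n n.

Definition enc_bits (s : seq bool) : seq token :=
  [seq (if b then Tk1 else Tk0) | b <- s].

Definition enc_nat (n : nat) : seq token :=
  TkOpen :: enc_bits (bin n) ++ [:: TkClose].

Definition enc_int (z : int) : seq token :=
  TkOpen :: enc_bits [:: (z < 0)%R] ++ TkComma :: enc_nat `|z|%N ++ [:: TkClose].

Definition enc_rat (q : rat) : seq token :=
  TkOpen :: enc_int (numq q) ++ TkComma :: enc_int (denq q) ++ [:: TkClose].

Definition enc_list (T : Type) (f : T -> seq token) (s : seq T) : seq token :=
  TkOpen :: flatten [seq f x ++ [:: TkComma] | x <- s] ++ [:: TkClose].

Definition enc_instance (I : ip_instance) : seq token :=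
  TkOpen :: enc_list enc_nat (iota 0 (size (ip_pi I)))   (* Omega as list of points *)
         ++ enc_list enc_rat (ip_pi I)
         ++ enc_list enc_nat (ip_E I)
         ++ enc_list (enc_list enc_nat) (ip_F I)
         ++ enc_rat (ip_p I) ++ [:: TkClose].

Definition encode_instance (I : ip_instance) : seq bool :=
  flatten (map token_bits (enc_instance I)).

Definition InformationalPersuasion : language :=
  fun x => exists I : ip_instance,
    ip_valid I /\ x = encode_instance I /\ ip_yes I.

(* Main.v *)
(* Membership in NP: a certificate lists the instance in an easily parsed form, together with the
   mask of the reported facts and, for each fraction n/d, numbers u, v with d v = n u + 1, which show
   that n/d is in lowest terms. The verifier prints the listed instance, compares the result with its
   input, and checks the required inequality by computing with unnormalised fractions.

   Hardness: the run of a verifier on an unknown witness is a table of cells with values in a finite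
   alphabet, and its correctness is a set of positive clauses, each saying that cell c has value a for some
   (c, a) in a given list. The facts are the pairs (c, a). The points of E are one point per fact, missing from
   that fact only. Outside E there is one point that belongs to all facts and two points for each
   clause, which are missing from the facts in the clause; each cell also gets the clause saying
   that it has some value. The measure is uniform. With n cells and s >= 2 values let G = n (s - 1) and take
   the threshold G / (G + 1). If the points of some clause survive the report, the conditional
   probability is at most n s / (n s + 3) < G / (G + 1); if none survive, then every cell has a value
   reported, and the threshold says that at most n facts are reported, hence exactly one per cell.

   Polynomial time is established for programs on four stacks that hold trees in prefix code, and
   these programs are simulated on the single tape of a Turing machine. *)

(* Reporting a fact only deletes points, and a point goes exactly when one of the facts missing it
   is reported. So reports express positive clauses only, and excluding a value must be spelled as a
   disjunction of the other values. Such clauses mean what they should only if no cell has two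
   values; the price of one point of E per reported fact enforces this.

   The point outside E that belongs to all facts keeps the denominator positive and turns the
   threshold G / (G + 1) into the count G b <= g, for g surviving points inside E and b outside. The
   points of clauses come in pairs so that one missed clause gives b >= 3, and 3 G > n s holds from
   s = 2 on.

   The encoding of an instance contains fractions in lowest terms. Bezout numbers let the verifier
   check this without computing a gcd, and printing instead of reading the input avoids a parser for
   the token grammar. In the other direction the encoding has to be injective, since membership in
   the language only asks for some instance with the given code. *)
Require Import Defs.
From HB Require Import structures.
From mathcomp Require Import all_boot all_order all_algebra.
From mathcomp Require Import zify ring lra.
Set Implicit Arguments.
Unset Strict Implicit.
Unset Printing Implicit Defensive.
Import Order.TTheory GRing.Theory Num.Theory.

(** * Turing machines on functional tapes *)

Section FunTape.
Local Open Scope ring_scope.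
Variable M : TM.

Definition tape := int -> option bool.
Definition upd (T : tape) (p : int) v : tape := fun x => if x == p then v else T x.
Definition shift (mv : move) : int :=
  match mv with MoveL => -1 | MoveR => 1 | Stay => 0 end.
Definition fcfg := (tm_state M * int * tape)%type.

(* Intermediate tapes are only specified pointwise, so that no extensionality is needed. *)
Inductive run : nat -> fcfg -> fcfg -> Prop :=
| run0 c : run 0 c c
| runS n q p T q' p' w mv T' c2 :
    tm_delta q (T p) = Some (q', w, mv) -> p' = p + shift mv -> T' =1 upd T p w ->
    run n (q', p', T') c2 -> run n.+1 (q, p, T) c2.

Lemma run_cat n1 n2 c1 c2 c3 : run n1 c1 c2 -> run n2 c2 c3 -> run (n1 + n2)%N c1 c3.
Proof.
move=> h; elim: h c3 n2 => {n1 c1 c2} [c|n q p T q' p' w mv T' c2 e1 e2 e3 _ IH] c3 n2 h //.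
by rewrite addSn; apply: runS e1 e2 e3 _; apply: IH.
Qed.

(** The default [None] of [nth] extends both finite lists by blanks, so that they describe two
    infinite half-tapes. *)
Definition tape_rel (cf : config M) (c : fcfg) : Prop :=
  let: (q, p, T) := c in
  [/\ cf_state cf = q,
      forall j : nat, nth None (cf_cur cf :: cf_right cf) j = T (p + j%:Z)
    & forall j : nat, nth None (cf_left cf) j = T (p - 1 - j%:Z)].

Lemma tape_rel_step cf q p T q' w mv T' : tape_rel cf (q, p, T) ->
  tm_delta q (T p) = Some (q', w, mv) -> T' =1 upd T p w ->
  exists2 cf', step cf = Some cf' & tape_rel cf' (q', p + shift mv, T').
Proof.
move=> [/= eq_q hr hl] + eT.
have hcur : cf_cur cf = T p by have /= := hr 0%N; rewrite addr0.
rewrite /step eq_q hcur => ->.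
have hr' (j : nat) : nth None (cf_right cf) j = T (p + 1 + j%:Z).
  by have /= := hr j.+1; rewrite (_ : p + j.+1%:Z = p + 1 + j%:Z) //; lia.
exists (match mv with
        | Stay => @Config M q' (cf_left cf) w (cf_right cf)
        | MoveR => Config q' (w :: cf_left cf) (head None (cf_right cf)) (behead (cf_right cf))
        | MoveL => Config q' (behead (cf_left cf)) (head None (cf_left cf)) (w :: cf_right cf)
        end); first by case: mv.
have updN x : x != p -> upd T p w x = T x by rewrite /upd => /negPf->.
have updp x : x = p -> upd T p w x = w by move=> ->; rewrite /upd eqxx.
case: mv; split=> //= -[|j] /=; rewrite eT.
- by rewrite -nth0 hl updN; [congr T|]; lia.
- case: j => [|j] /=; rewrite ?eT; first by rewrite updp //; lia.
  by rewrite hr' updN; [congr T|]; lia.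
- by rewrite nth_behead hl updN; [congr T|]; lia.
- by rewrite nth_behead hl updN; [congr T|]; lia.
- by rewrite -nth0 hr' updN; [congr T|]; lia.
- by rewrite nth_behead hr' updN; [congr T|]; lia.
- by rewrite updp //; lia.
- by rewrite hl updN; [congr T|]; lia.
- by rewrite updp //; lia.
- by rewrite hr' updN; [congr T|]; lia.
- by rewrite hl updN; [congr T|]; lia.
- by rewrite hl updN; [congr T|]; lia.
Qed.

(** [exec] stays put after halting, so every time bound at least the length of the run gives the
    same final configuration. *)
Lemma tape_rel_run n c q p T cf t : run n c (q, p, T) -> tape_rel cf c ->
  tm_delta q (T p) = None -> (n <= t)%N ->
  halted (exec t cf) /\ tape_rel (exec t cf) (q, p, T).
Proof.
move eqc' : (q, p, T) => c' h.
elim: h t cf eqc' => {n c c'} [c|n q0 p0 T0 q1 p1 w mv T1 c2 st -> eT _ IH] t cf eqc' rel nst le_nt.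
  have hst : step cf = None.
    rewrite -eqc' in rel; case: rel => [/= eq_q hr _].
    have e0 : cf_cur cf = T p by have /= := hr 0%N; rewrite addr0.
    by rewrite /step eq_q e0 nst.
  by have -> : exec t cf = cf by case: t le_nt => //= t _; rewrite hst.
case: t le_nt => // t le_nt.
have [cf' st' rel'] := tape_rel_step rel st eT.
by rewrite /= st'; apply: IH.
Qed.

(** The input is placed from cell 1 on, so that the blank cell 0 can serve as the origin of the
    simulated stacks. *)
Lemma tape_rel_init (x : seq bool) :
  tape_rel (init M x) (tm_start M, 1, fun p => if 1 <= p then onth x `|p - 1|%N else None).
Proof.
split=> // j; last by rewrite nth_nil; case: ifP => //; lia.
have -> : (1 <= 1 + j%:Z) by lia.
have -> : absz (1 + j%:Z - 1)%R = j by lia.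
rewrite onthE.
by case: x => [|b x]; case: j => //= j; rewrite nth_nil.
Qed.

Lemma read_word_onth s y : (forall j, nth None s j = onth y j) -> read_word s = y.
Proof.
elim: y s => [|b y IH] s h; first by have := h 0; case: s {h} => //= a s ->.
have h0 := h 0; case: s h h0 => //= a s h ->.
by rewrite IH // => j; apply: (h j.+1).
Qed.

End FunTape.

(** * Stack machines and their simulation *)

Inductive reg := Io | R1 | R2 | R3 | R4.
Definition col (r : reg) : nat :=
  match r with Io => 0 | R1 => 1 | R2 => 2 | R3 => 3 | R4 => 4 end.

Record store := Store {
  st_io : seq bool; st_1 : seq bool; st_2 : seq bool; st_3 : seq bool; st_4 : seq bool }.

Definition get (s : store) (r : reg) : seq bool :=
  match r with Io => st_io s | R1 => st_1 s | R2 => st_2 s | R3 => st_3 s | R4 => st_4 s end.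

Definition set (s : store) (r : reg) (v : seq bool) : store :=
  let: Store v0 v1 v2 v3 v4 := s in
  match r with
  | Io => Store v v1 v2 v3 v4 | R1 => Store v0 v v2 v3 v4 | R2 => Store v0 v1 v v3 v4
  | R3 => Store v0 v1 v2 v v4 | R4 => Store v0 v1 v2 v3 v
  end.

Lemma get_set s r v r' : get (set s r v) r' = if col r == col r' then v else get s r'.
Proof. by case: s => *; case: r; case: r'. Qed.

Inductive instr (L : Type) :=
| IPush (r : reg) (b : bool) (l : L)
| IPop (r : reg) (k : option bool -> L).

Inductive phase := Boot | Fin | Halt | Disp | PushM | PushC | PopM | PopC
  | RetM | BackM | BackC | InW | InR | RetR | OutW.
Definition phase_code (ph : phase) : 'I_15 := inord
  match ph with
  | Boot => 0 | Fin => 1 | Halt => 2 | Disp => 3 | PushM => 4 | PushC => 5 | PopM => 6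
  | PopC => 7 | RetM => 8 | BackM => 9 | BackC => 10 | InW => 11 | InR => 12 | RetR => 13
  | OutW => 14 end.
Definition phase_decode (n : 'I_15) : phase :=
  nth Boot [:: Boot; Fin; Halt; Disp; PushM; PushC; PopM; PopC
  ; RetM; BackM; BackC; InW; InR; RetR; OutW] n.
Lemma phase_codeK : cancel phase_code phase_decode.
Proof. by case; rewrite /phase_code /phase_decode inordK. Qed.
HB.instance Definition _ := Finite.copy phase (can_type phase_codeK).

(* Tape layout between two simulated steps: the head is on cell 0, which stays blank. The stack Io
   occupies the cells 1, 2, ... with its top at the far end. The entry of depth j of R_i is in cell
   -(5 j + i), for i from 1 to 4; the cells -5 (j + 1) hold a mark once they have been visited, so that
   the head recognises cell 0 on its way back. A push or a pop shifts the whole stack by one block,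
   the entry in transit being kept in the state. The phases ending in M and C walk to the next
   mark and to the next cell of the stack. *)
Section Simulation.
Variables (L : finType) (start : L) (code : L -> option (instr L)).

Definition colof l := match code l with
  | Some (IPush r _ _) => col r | Some (IPop r _) => col r | None => 0 end.
Definition next l (c : option bool) := match code l with
  | Some (IPush _ _ l') => l' | Some (IPop _ k) => k c | None => l end.

(** Phase, current instruction, symbol in transit, and the number of cells to walk before the phase
    acts. Four is enough, since blocks have five cells and the acting step itself moves by one. *)
Definition qstate := (phase * L * option bool * 'I_5)%type.
Definition St ph l c n : qstate := (ph, l, c, inord n).

Definition delta0 ph l c (a : option bool) : option (qstate * option bool * move) :=
  let cl := colof l in
  match ph with
  | Boot => Some (St Disp l None 0, a, MoveL)
  | Fin => Some (St Halt l a 0, a, Stay)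
  | Halt => None
  | Disp => match code l with
    | None => Some (St Fin l None 0, a, MoveR)
    | Some (IPush Io b _) => Some (St OutW l (Some b) 0, a, MoveR)
    | Some (IPop Io _) => Some (St InW l None 0, a, MoveR)
    | Some (IPush _ b _) => Some (St PushC l (Some b) cl.-1, a, MoveL)
    | Some (IPop _ _) => Some (St PopC l None cl.-1, a, MoveL)
    end
  | PushM => Some (St PushC l c cl.-1, Some true, MoveL)
  | PushC => if a is Some _ then Some (St PushM l a (4 - cl), c, MoveL)
             else Some (St RetM l None cl.-1, c, MoveR)
  | PopM => Some (St PopC l None cl.-1, Some true, MoveL)
  | PopC => if a is Some _ then Some (St PopM l None (4 - cl), a, MoveL)
            else Some (St BackM l None cl.-1, None, MoveR)
  | RetM => if a is Some _ then Some (St RetM l c 4, a, MoveR)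
            else Some (St Disp (next l c) None 0, None, Stay)
  | BackM => if a is Some _ then Some (St BackC l c (4 - cl), a, MoveR)
             else Some (St Disp (next l c) None 0, None, Stay)
  | BackC => Some (St BackM l a cl.-1, c, MoveR)
  | InW => if a is Some _ then Some (St InW l None 0, a, MoveR)
           else Some (St InR l None 0, a, MoveL)
  | InR => if a is Some _ then Some (St RetR l a 0, None, MoveL)
           else Some (St Disp (next l None) None 0, None, Stay)
  | OutW => if a is Some _ then Some (St OutW l c 0, a, MoveR)
            else Some (St RetR l c 0, c, MoveL)
  | RetR => if a is Some _ then Some (St RetR l c 0, a, MoveL)
            else Some (St Disp (next l c) None 0, None, Stay)
  end.

Definition dir ph := match ph with RetM | BackM | BackC => MoveR | _ => MoveL end.

Definition delta (q : qstate) (a : option bool) : option (qstate * option bool * move) :=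
  let: (ph, l, c, n) := q in
  if nat_of_ord n is n'.+1 then Some (St ph l c n', a, dir ph) else delta0 ph l c a.

#[local] Arguments delta : simpl never.

(** The phase [Fin] has stored the first output symbol in the state, so acceptance means that the
    output begins with [true]. *)
Definition simTM : TM :=
  @mkTM qstate (St Boot start None 0) delta
    (fun q => let: (ph, _, c, _) := q in (ph == Halt) && (c == Some true)).

Lemma deltaE0 ph l c a : delta (St ph l c 0) a = delta0 ph l c a.
Proof. by rewrite /delta /St inordK. Qed.

Lemma deltaES ph l c n a : n < 4 -> delta (St ph l c n.+1) a = Some (St ph l c n, a, dir ph).
Proof. by move=> lt_n; rewrite /delta /St inordK. Qed.

Local Open Scope ring_scope.
Notation run := (@run simTM).

Lemma run1 q p T q' p' w mv T' : delta q (T p) = Some (q', w, mv) -> p' = p + shift mv ->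
  T' =1 upd T p w -> run 1 (q, p, T) (q', p', T').
Proof. by move=> h1 h2 h3; apply: (@runS simTM) h1 h2 h3 (run0 _). Qed.

Lemma upd_same (T : tape) p : T =1 upd T p (T p).
Proof. by move=> x; rewrite /upd; case: eqP => [->|]. Qed.

Lemma updE (T : tape) p v x : upd T p v x = if x == p then v else T x.
Proof. by []. Qed.

Lemma run_walk ph l c n p p' T : (n <= 4)%N -> p' = p + shift (dir ph) * n%:Z ->
  run n (St ph l c n, p, T) (St ph l c 0, p', T).
Proof.
elim: n p p' => [|n IH] p p' le_n ->; first by rewrite mulr0 addr0; apply: run0.
apply: (@runS simTM) (deltaES ph l c (T p) le_n) erefl (upd_same T p) _.
by apply: IH => //; lia.
Qed.

Definition cell (i j : nat) : int := - (5 * j + i)%N%:Z.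

Section LeftStack.
Variables (l : L) (i : nat).
Hypotheses (eq_col : colof l = i) (i_gt0 : (0 < i)%N) (i_le4 : (i <= 4)%N).

Definition outside j (x : int) := (forall m, x != cell i (j + m)) /\ (forall m, x != cell 5 (j + m)).

Lemma run_ret (T : tape) c j : T 0 = None ->
  (forall m, (m < j)%N -> T (cell 5 m) = Some true) ->
  run (5 * j).+1 (St RetM l c 0, cell 0 j, T) (St Disp (next l c) None 0, 0, T).
Proof.
move=> T0; elim: j => [|j IH] Tm.
  rewrite (_ : cell 0 0 = 0) //.
  by apply: run1; rewrite /= ?deltaE0 /= ?T0 // -T0; apply: upd_same.
have ej : cell 0 j.+1 = cell 5 j by rewrite /cell; lia.
rewrite (_ : (5 * j.+1).+1 = 5 + (5 * j).+1)%N; last by lia.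
apply: run_cat (IH _); last by move=> m lt_m; apply: Tm; lia.
rewrite -[5%N]/(1 + 4)%N.
apply: run_cat; first apply: (run1 _ erefl (upd_same T _)); first by rewrite deltaE0 /= ej Tm.
by apply: run_walk; rewrite // /cell /=; lia.
Qed.

(** Each block exchanges its entry with the symbol in transit, which moves the stack one block away
    from cell 0. The index [j] of the block already reached is general, for the induction on the
    remaining entries [u]. *)
Lemma run_push u b j (T : tape) : (forall m, T (cell i (j + m)) = onth u m) ->
  exists T' n, [/\ run n (St PushC l (Some b) 0, cell i j, T)
                      (St RetM l None i.-1, cell i (j + size u) + 1, T'),
    forall m, T' (cell i (j + m)) = onth (b :: u) m,
    forall m, (m < size u)%N -> T' (cell 5 (j + m)) = Some true,
    forall x, outside j x -> T' x = T x & (n <= 5 * size u + 1)%N].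
Proof.
elim: u b j T => [|b' u IH] b j T hT.
  have h0 : T (cell i j) = None by have := hT 0%N; rewrite addn0.
  exists (upd T (cell i j) (Some b)), 1%N; split=> //.
  - by apply: run1; rewrite /= ?deltaE0 /= ?h0 ?eq_col ?addn0.
  - case=> [|m]; first by rewrite addn0 /upd eqxx.
    rewrite updE hT ifF; last by apply/eqP; rewrite /cell; lia.
    by rewrite /= !onth0n.
  - by move=> x [h _]; have := h 0%N; rewrite addn0 updE => /negPf->.
have h0 : T (cell i j) = Some b' by have := hT 0%N; rewrite addn0.
pose T1 := upd T (cell i j) (Some b).
pose T2 := upd T1 (cell 5 j) (Some true).
have [T' [n [h1 h2 h3 h4 h5]]] : exists T' n, [/\ run n (St PushC l (Some b') 0, cell i j.+1, T2)
                      (St RetM l None i.-1, cell i (j.+1 + size u) + 1, T'),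
    forall m, T' (cell i (j.+1 + m)) = onth (b' :: u) m,
    forall m, (m < size u)%N -> T' (cell 5 (j.+1 + m)) = Some true,
    forall x, outside j.+1 x -> T' x = T2 x & (n <= 5 * size u + 1)%N].
  apply: IH => m; rewrite /T2 /T1 !updE !ifF; try by apply/eqP; rewrite /cell; lia.
  by have := hT m.+1; rewrite addnS.
exists T', (1 + ((4 - i) + (1 + ((i.-1) + n))))%N; split.
- apply: run_cat; first apply: (run1 _ _ (fun x => erefl)); first by rewrite /= deltaE0 /= h0 eq_col.
    by [].
  apply: run_cat; first by apply: run_walk; [lia|].
  apply: run_cat; first apply: (@run1 _ _ _ _ (cell 5 j - 1) _ MoveL T2); first by rewrite /= deltaE0 /= eq_col.
  + by rewrite /cell /=; lia.
  + by move=> x; rewrite /T2 !updE /=; congr (if x == _ then _ else _); rewrite /cell; lia.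
  apply: run_cat; first by apply: (@run_walk _ _ _ _ _ (cell i j.+1)); [lia| rewrite /cell /=; lia].
  by rewrite /= addnS -addSn.
- case=> [|m]; last by rewrite addnS -addSn h2.
  rewrite addn0 h4; last by split=> m; rewrite /cell; lia.
  rewrite /T2 /T1 !updE eqxx ifF //; apply/eqP; rewrite /cell; lia.
- case=> [_|m lt_m]; last by rewrite addnS -addSn h3.
  rewrite addn0 h4; last by split=> m; rewrite /cell; lia.
  by rewrite /T2 updE eqxx.
- move=> x [o1 o2]; rewrite h4; last first.
    by split=> m; [have := o1 m.+1|have := o2 m.+1]; rewrite addSnnS.
  by have := o1 0%N; have := o2 0%N; rewrite addn0 /T2 /T1 !updE => /negPf-> /negPf->.
- by rewrite /=; lia.
Qed.

(** A pop takes two passes: this one walks to the end of the stack and only writes marks; the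
    entries move on the way back. *)
Lemma run_popout u j (T : tape) : (forall m, T (cell i (j + m)) = onth u m) ->
  exists T' n, [/\ run n (St PopC l None 0, cell i j, T)
                      (St BackM l None i.-1, cell i (j + size u) + 1, T'),
    forall m, (m < size u)%N -> T' (cell 5 (j + m)) = Some true,
    forall x, (forall m, x != cell 5 (j + m)) -> T' x = T x & (n <= 5 * size u + 1)%N].
Proof.
elim: u j T => [|b' u IH] j T hT.
  have h0 : T (cell i j) = None by have := hT 0%N; rewrite addn0.
  exists T, 1%N; split=> //.
  by apply: run1; rewrite /= ?deltaE0 /= ?h0 ?eq_col ?addn0 // -h0; apply: upd_same.
have h0 : T (cell i j) = Some b' by have := hT 0%N; rewrite addn0.
pose T2 := upd T (cell 5 j) (Some true).
have [T' [n [h1 h3 h4 h5]]] : exists T' n, [/\ run n (St PopC l None 0, cell i j.+1, T2)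
                      (St BackM l None i.-1, cell i (j.+1 + size u) + 1, T'),
    forall m, (m < size u)%N -> T' (cell 5 (j.+1 + m)) = Some true,
    forall x, (forall m, x != cell 5 (j.+1 + m)) -> T' x = T2 x & (n <= 5 * size u + 1)%N].
  apply: IH => m; rewrite /T2 !updE ifF; last by apply/eqP; rewrite /cell; lia.
  by have := hT m.+1; rewrite addnS.
exists T', (1 + ((4 - i) + (1 + ((i.-1) + n))))%N; split.
- apply: run_cat; first apply: (run1 _ _ (upd_same T _)); first by rewrite /= deltaE0 /= h0 eq_col.
    by [].
  apply: run_cat; first by apply: run_walk; [lia|].
  apply: run_cat; first apply: (@run1 _ _ _ _ (cell 5 j - 1) _ MoveL T2); first by rewrite /= deltaE0 /= eq_col.
  + by rewrite /cell /=; lia.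
  + by move=> x; rewrite /T2 !updE /=; congr (if x == _ then _ else _); rewrite /cell; lia.
  apply: run_cat; first by apply: (@run_walk _ _ _ _ _ (cell i j.+1)); [lia| rewrite /cell /=; lia].
  by rewrite /= addnS -addSn.
- case=> [_|m lt_m]; last by rewrite addnS -addSn h3.
  rewrite addn0 h4; last by move=> m; rewrite /cell; lia.
  by rewrite /T2 updE eqxx.
- move=> x o2; rewrite h4; last by move=> m; have := o2 m.+1; rewrite addSnnS.
  by have := o2 0%N; rewrite addn0 /T2 !updE => /negPf->.
- by rewrite /=; lia.
Qed.

(** Invariant of the second pass: the blocks from [j] on are already shifted, those before [j] are
    not, and the entry of depth [j] is in transit. On return the symbol in transit is the popped
    top. *)
Lemma run_popback s j (T : tape) : T 0 = None ->
  (forall m, (m < j)%N -> T (cell 5 m) = Some true) ->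
  (forall m, (m < j)%N -> T (cell i m) = onth s m) ->
  (forall m, (j <= m)%N -> T (cell i m) = onth s m.+1) -> (j <= size s)%N ->
  exists T' n, [/\ run n (St BackM l (onth s j) i.-1, cell i j + 1, T)
                      (St Disp (next l (onth s 0)) None 0, 0, T'),
    forall m, T' (cell i m) = onth s m.+1,
    forall x, (forall m, x != cell i m) -> T' x = T x & (n <= 5 * j + i)%N].
Proof.
move=> T0; elim: j T T0 => [|j IH] T T0 Tm Tlo Thi le_j.
  exists T, (i.-1 + 1)%N; split=> //.
  - apply: run_cat; first by apply: (@run_walk _ _ _ _ _ 0); [lia| rewrite /cell /=; lia].
    by apply: run1; rewrite /= ?deltaE0 /= ?T0 // -T0; apply: upd_same.
  - by move=> m; apply: Thi.
  - by lia.
pose T1 := upd T (cell i j) (onth s j.+1).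
have [T' [n [h1 h2 h3 h4]]] : exists T' n, [/\ run n (St BackM l (onth s j) i.-1, cell i j + 1, T1)
                      (St Disp (next l (onth s 0)) None 0, 0, T'),
    forall m, T' (cell i m) = onth s m.+1,
    forall x, (forall m, x != cell i m) -> T' x = T1 x & (n <= 5 * j + i)%N].
  apply: IH; last by lia.
  - by rewrite /T1 updE ifF //; apply/eqP; rewrite /cell; lia.
  - move=> m lt_m; rewrite /T1 updE ifF ?Tm //; first by lia.
    by apply/eqP; rewrite /cell; lia.
  - move=> m lt_m; rewrite /T1 updE ifF ?Tlo //; first by lia.
    by apply/eqP; rewrite /cell; lia.
  - move=> m le_m; rewrite /T1 updE; case: eqP => [e|ne].
      by congr onth; move: e; rewrite /cell; lia.
    rewrite Thi //; move: ne; rewrite /cell; lia.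
exists T', (i.-1 + (1 + ((4 - i) + (1 + n))))%N; split=> //.
- apply: run_cat; first by apply: (@run_walk _ _ _ _ _ (cell 5 j)); [lia| rewrite /cell /=; lia].
  apply: run_cat; first apply: (run1 _ _ (upd_same T _)); first by rewrite /= deltaE0 /= Tm ?eq_col.
    by [].
  apply: run_cat; first by apply: (@run_walk _ _ _ _ _ (cell i j)); [lia| rewrite /cell /=; lia].
  apply: run_cat h1.
  by apply: run1; rewrite /= ?deltaE0 /= ?eq_col ?Tlo //.
- by move=> x h; rewrite h3 // /T1 updE (negPf (h j)).
- by lia.
Qed.

End LeftStack.


Lemma run_retR (T : tape) l c j : T 0 = None -> (forall m, (m < j)%N -> T (1 + m%:Z) != None) ->
  run j.+1 (St RetR l c 0, j%:Z, T) (St Disp (next l c) None 0, 0, T).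
Proof.
move=> T0; elim: j => [|j IH] h.
  by apply: run1; rewrite /= ?deltaE0 /= ?T0 // -T0; apply: upd_same.
have [a ea] : exists a, T j.+1%:Z = Some a.
  by have := h j (ltnSn _); rewrite (_ : 1 + j%:Z = j.+1%:Z) //; case: (T _) => // a; exists a.
rewrite -add1n; apply: run_cat; first apply: (run1 _ erefl (upd_same T _)).
  by rewrite deltaE0 /= ea.
rewrite (_ : j.+1%:Z + shift MoveL = j%:Z); last by rewrite /=; lia.
by apply: IH => m lt_m; apply: h; lia.
Qed.

Lemma run_right ph l c u j (T : tape) : ph = InW /\ c = None \/ ph = OutW ->
  (forall m, (m < size u)%N -> T (1 + (j + m)%N%:Z) = onth u m) ->
  run (size u) (St ph l c 0, 1 + j%:Z, T) (St ph l c 0, 1 + (j + size u)%N%:Z, T).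
Proof.
move=> hph; elim: u j => [|b u IH] j h; first by rewrite addn0; apply: run0.
rewrite /= -add1n; apply: run_cat; first apply: (run1 _ erefl (upd_same T _)).
  have := h 0%N; rewrite addn0 deltaE0 => -> //=.
  by case: hph => [[-> ->]|->].
rewrite (_ : _ + shift _ = 1 + j.+1%:Z); last by rewrite /=; lia.
by rewrite addnS -addSn; apply: IH => m lt_m; rewrite addSnnS h.
Qed.

Definition sstep (l : L) (s : store) : option (L * store) :=
  match code l with
  | Some (IPush r b l') => Some (l', set s r (b :: get s r))
  | Some (IPop r k) => Some (k (ohead (get s r)), set s r (behead (get s r)))
  | None => None
  end.

Inductive sruns : nat -> L * store -> L * store -> Prop :=
| sruns0 c : sruns 0 c c
| srunsS t l s c1 c2 : sstep l s = Some c1 -> sruns t c1 c2 -> sruns t.+1 (l, s) c2.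

Definition ssize s := (size (get s Io) + size (get s R1) + size (get s R2)
  + size (get s R3) + size (get s R4))%N.

Lemma ssize_step l s l' s' : sstep l s = Some (l', s') -> (ssize s' <= (ssize s).+1)%N.
Proof.
by rewrite /sstep; case: (code l) => [[r b k|r k]|] // [_ <-];
   case: s => *; case: r; rewrite /ssize /= ?size_behead; lia.
Qed.

(** [Io] is reversed because its bottom lies next to cell 0. The input as written by [init] is thus
    already a stack, and the output can be read off in place. *)
Definition holds_store (T : tape) (s : store) := [/\ T 0 = None,
  forall j : nat, T (1 + j%:Z) = onth (rev (get s Io)) j
  & forall r, (0 < col r)%N -> forall j, T (cell (col r) j) = onth (get s r) j].

Lemma onth_ohead (A : Type) (s : seq A) : onth s 0 = ohead s.
Proof. by case: s. Qed.

Lemma onth_behead (A : Type) (s : seq A) j : onth (behead s) j = onth s j.+1.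
Proof. by case: s => //=; rewrite onth0n. Qed.

Lemma col_le4 r : (col r <= 4)%N.
Proof. by case: r. Qed.


Lemma size_get s r : (size (get s r) <= ssize s)%N.
Proof. by rewrite /ssize; case: r => /=; lia. Qed.

Lemma io_nonblank s T m : holds_store T s -> (m < size (get s Io))%N -> T (1 + m%:Z) != None.
Proof. by move=> [_ Tio _] lt_m; rewrite Tio; move: lt_m; rewrite -size_rev -onthTE; case: onth. Qed.

Lemma sim_push_io l s b l' T : code l = Some (IPush Io b l') -> holds_store T s ->
  exists T' n, [/\ run n (St Disp l None 0, 0, T) (St Disp l' None 0, 0, T'),
    holds_store T' (set s Io (b :: get s Io)) & (n <= 10 * ssize s + 20)%N].
Proof.
move=> ec hT; have Tsome m := @io_nonblank _ _ m hT; case: hT => T0 Tio Tr.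
set v := rev (get s Io) in Tio.
have sv : size v = size (get s Io) by rewrite /v size_rev.
pose T' := upd T (1 + (size v)%:Z) (Some b).
have T'0 : T' 0 = None by rewrite /T' updE.
exists T', (1 + (size v + (1 + (size v).+1)))%N; split.
- apply: run_cat; first by apply: (run1 _ erefl (upd_same T _)); rewrite deltaE0 /= ec.
  apply: run_cat; first by apply: (@run_right _ _ _ v 0); [right|move=> m _; rewrite add0n].
  apply: run_cat; first apply: (@run1 _ _ _ (St RetR l (Some b) 0) (size v) (Some b) MoveL T') => //.
  + by rewrite deltaE0 /= add0n Tio onth_default.
  + by rewrite add0n /=; lia.
  have -> : l' = next l (Some b) by rewrite /next ec.
  apply: run_retR => // m lt_m; rewrite /T' updE; case: ifP => // _; apply: Tsome.
  by rewrite -sv.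
- split=> //.
  + move=> j; rewrite get_set /= rev_cons -/v -cats1 onth_cat /T' updE.
    case: eqP => [e|ne]; first by (have -> : j = size v by lia); rewrite ltnn subnn.
    rewrite Tio; case: ltnP => // le_j; rewrite onth_default //.
    case e: (j - size v)%N => [|k]; last by rewrite /= onth0n.
    by case: ne; congr (1 + Posz _); lia.
  + move=> r r_gt0 j; rewrite get_set ifF; last by case: r r_gt0.
    by rewrite /T' updE ifF ?Tr //; apply/eqP; rewrite /cell; lia.
- by have := size_get s Io; lia.
Qed.

Lemma sim_pop_io l s k T : code l = Some (IPop Io k) -> holds_store T s ->
  exists T' n, [/\ run n (St Disp l None 0, 0, T) (St Disp (k (ohead (get s Io))) None 0, 0, T'),
    holds_store T' (set s Io (behead (get s Io))) & (n <= 10 * ssize s + 20)%N].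
Proof.
move=> ec hT; have Tsome m := @io_nonblank _ _ m hT; case: (hT) => T0 Tio Tr.
case eio : (get s Io) => [|b w].
  exists T, 3%N; split; last by lia.
  - apply: (run_cat (n1 := 1)); first by apply: (run1 _ erefl (upd_same T _)); rewrite deltaE0 /= ec.
    have T1 : T (0 + shift MoveR) = None by have := Tio 0%N; rewrite eio.
    apply: (run_cat (n1 := 1)); first by apply: (run1 _ erefl (upd_same T _)); rewrite deltaE0 /= T1.
    rewrite (_ : 0 + _ + _ = 0) //.
    have -> : k None = next l None by rewrite /next ec.
    by apply: run1; rewrite /= ?deltaE0 /= ?T0 // -T0; apply: upd_same.
  - by split=> //; [move=> j; rewrite get_set /= Tio eio|
     move=> r r_gt0 j; rewrite get_set ifF ?Tr //; case: r r_gt0].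
set v := rev w.
have sv : (size v).+1 = size (get s Io) by rewrite /v size_rev eio.
have Tv j : T (1 + j%:Z) = onth (rcons v b) j by rewrite Tio eio rev_cons.
pose T' := upd T (1 + (size v)%:Z) None.
have T'0 : T' 0 = None by rewrite /T' updE.
have Tvb : T (1 + (size v)%:Z) = Some b by rewrite Tv -cats1 onth_cat ltnn subnn.
exists T', (1 + (size (rcons v b) + (1 + (1 + (size v).+1))))%N; split.
- apply: run_cat; first by apply: (run1 _ erefl (upd_same T _)); rewrite deltaE0 /= ec.
  apply: run_cat; first by apply: (@run_right _ _ _ (rcons v b) 0); [left|move=> m _; rewrite add0n].
  apply: run_cat; first apply: (run1 _ erefl (upd_same T _)).
    by rewrite deltaE0 /= add0n Tv onth_default.
  rewrite (_ : _ + shift _ = 1 + (size v)%:Z); last by rewrite size_rcons /=; lia.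
  apply: run_cat; first apply: (@run1 _ _ _ (St RetR l (Some b) 0) (size v) None MoveL T') => //.
  + by rewrite deltaE0 /= Tvb.
  + by rewrite /=; lia.
  have -> : k (ohead (b :: w)) = next l (Some b) by rewrite /next ec.
  apply: run_retR => // m lt_m; rewrite /T' updE ifF; last by apply/eqP; lia.
  by apply: Tsome; rewrite -sv; lia.
- split=> //.
  + move=> j; rewrite get_set /= -/v /T' updE.
    case: eqP => [e|ne]; first by rewrite onth_default //; lia.
    rewrite Tv -cats1 onth_cat; case: ltnP => // le_j; rewrite [RHS]onth_default //.
    case e: (j - size v)%N => [|m]; last by rewrite /= onth0n.
    by case: ne; congr (1 + Posz _); lia.
  + move=> r r_gt0 j; rewrite get_set ifF; last by case: r r_gt0.
    by rewrite /T' updE ifF ?Tr //; apply/eqP; rewrite /cell; lia.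
- by have := size_get s Io; rewrite size_rcons; lia.
Qed.

Lemma sim_push_left l s r b l' T : code l = Some (IPush r b l') -> (0 < col r)%N ->
  holds_store T s ->
  exists T' n, [/\ run n (St Disp l None 0, 0, T) (St Disp l' None 0, 0, T'),
    holds_store T' (set s r (b :: get s r)) & (n <= 10 * ssize s + 20)%N].
Proof.
move=> ec r_gt0 [T0 Tio Tr]; have r_le4 := col_le4 r.
have ecol : colof l = col r by rewrite /colof ec.
have hcol m : T (cell (col r) (0 + m)) = onth (get s r) m by rewrite add0n Tr.
have [T' [n [h1 h2 h3 h4 h5]]] := run_push ecol r_gt0 r_le4 b hcol.
have out0 : T' 0 = None by rewrite h4 //; split=> m; rewrite /cell; lia.
exists T', (1 + ((col r).-1 + (n + ((col r).-1 + (5 * size (get s r)).+1))))%N; split.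
- apply: run_cat; first apply: (@run1 _ _ _ (St PushC l (Some b) (col r).-1) (- 1)  None MoveL T) => //.
  + by rewrite deltaE0 /= ec ecol T0; case: (r) r_gt0.
  + by rewrite -T0; apply: upd_same.
  apply: run_cat; first by apply: (@run_walk _ _ _ _ _ (cell (col r) 0)); rewrite ?/cell /=; lia.
  apply: run_cat h1 _.
  apply: run_cat; first by apply: (@run_walk _ _ _ _ _ (cell 0 (size (get s r)))); rewrite ?/cell /=; lia.
  have -> : l' = next l None by rewrite /next ec.
  by apply: run_ret; rewrite ?ecol.
- split=> //.
  + move=> j; rewrite get_set ifF; last by apply/eqP => /=; lia.
    by rewrite h4 ?Tio //; split=> m; rewrite /cell; lia.
  + move=> r' r'_gt0 j; rewrite get_set; case: eqP => [<-|ne]; first by rewrite h2.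
    have := col_le4 r'; rewrite -Tr // => r'_le4.
    by apply: h4; split=> m; move: ne; rewrite /cell; lia.
- by have := size_get s r; lia.
Qed.

Lemma sim_pop_left l s r k T : code l = Some (IPop r k) -> (0 < col r)%N -> holds_store T s ->
  exists T' n, [/\ run n (St Disp l None 0, 0, T) (St Disp (k (ohead (get s r))) None 0, 0, T'),
    holds_store T' (set s r (behead (get s r))) & (n <= 10 * ssize s + 20)%N].
Proof.
move=> ec r_gt0 [T0 Tio Tr]; have r_le4 := col_le4 r.
have ecol : colof l = col r by rewrite /colof ec.
have hcol m : T (cell (col r) (0 + m)) = onth (get s r) m by rewrite add0n Tr.
have [T' [n [h1 h3 h4 h5]]] := run_popout ecol r_gt0 r_le4 hcol.
have hcell m : T' (cell (col r) m) = onth (get s r) m.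
  by rewrite h4 ?Tr // => m'; rewrite /cell; lia.
have out0 : T' 0 = None by rewrite h4 // => m; rewrite /cell; lia.
have [||||| T2 [n2 [g1 g2 g3 g4]]] := @run_popback _ _ ecol r_gt0 r_le4 (get s r) (size (get s r)) T'.
- by [].
- exact: h3.
- by move=> m _; apply: hcell.
- by move=> m le_m; rewrite hcell !onth_default //; lia.
- by [].
rewrite onth_default // onth_ohead in g1.
exists T2, (1 + ((col r).-1 + (n + n2)))%N; split.
- apply: run_cat; first apply: (@run1 _ _ _ (St PopC l None (col r).-1) (- 1)  None MoveL T) => //.
  + by rewrite deltaE0 /= ec ecol T0; case: (r) r_gt0.
  + by rewrite -T0; apply: upd_same.
  apply: run_cat; first by apply: (@run_walk _ _ _ _ _ (cell (col r) 0)); rewrite ?/cell /=; lia.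
  apply: run_cat h1 _.
  by have -> : k (ohead (get s r)) = next l (ohead (get s r)) by rewrite /next ec.
- split.
  + by rewrite g3 // => m; rewrite /cell; lia.
  + move=> j; rewrite get_set ifF; last by apply/eqP => /=; lia.
    rewrite g3 ?h4 ?Tio // => m; rewrite /cell; lia.
  + move=> r' r'_gt0 j; rewrite get_set; case: eqP => [<-|ne]; first by rewrite g2 onth_behead.
    have := col_le4 r'; rewrite -Tr // => r'_le4.
    by rewrite g3 ?h4 // => m; move: ne; rewrite /cell; lia.
- by have := size_get s r; lia.
Qed.

Lemma sim_step l s l' s' T : sstep l s = Some (l', s') -> holds_store T s ->
  exists T' n, [/\ run n (St Disp l None 0, 0, T) (St Disp l' None 0, 0, T'),
    holds_store T' s' & (n <= 10 * ssize s + 20)%N].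
Proof.
rewrite /sstep; case ec : (code l) => [[r b l1|r k]|] // [<- <-] hT.
  case: (posnP (col r)) => [|r_gt0]; last exact: sim_push_left.
  by case: r ec => // ec _; apply: sim_push_io.
case: (posnP (col r)) => [|r_gt0]; last exact: sim_pop_left.
by case: r ec => // ec _; apply: sim_pop_io.
Qed.

(** A step adds at most one entry, so the stacks never exceed [ssize c.2 + t] entries; each step
    costs time linear in that. *)
Lemma sim_runs t c c' T : sruns t c c' -> holds_store T c.2 ->
  exists T' n, [/\ run n (St Disp c.1 None 0, 0, T) (St Disp c'.1 None 0, 0, T'),
    holds_store T' c'.2 & (n <= t * (10 * (ssize c.2 + t) + 20))%N].
Proof.
move=> h; elim: h T => {t c c'} [[l s]|t l s [l1 s1] c2 st _ IH] T hT.
  by exists T, 0%N; split=> //; apply: run0.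
have [T1 [n1 [h1 hT1 le1]]] := sim_step st hT.
have [T2 [n2 [h2 hT2 le2]]] := IH _ hT1.
exists T2, (n1 + n2)%N; split=> //; first exact: run_cat h1 h2.
have := ssize_step st; move: le1 le2 => /=; nia.
Qed.

Theorem sim_correct t x y l s' : sruns t (start, Store (rev x) [::] [::] [::] [::]) (l, s') ->
  code l = None -> get s' Io = rev y ->
  forall N, (t * (10 * (size x + t) + 20) + 3 <= N)%N ->
  let cf := exec N (init simTM x) in
  [/\ halted cf, output cf = y & tm_accept (cf_state cf) = (ohead y == Some true)].
Proof.
move=> hrun ec eio N leN cf.
pose T0 : tape := fun p => if 1 <= p then onth x `|p - 1|%N else None.
have hT0 : holds_store T0 (Store (rev x) [::] [::] [::] [::]).
  split=> //.
  - move=> j; rewrite /T0 (_ : 1 <= 1 + j%:Z = true) /= ?revK; last by lia.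
    by congr onth; lia.
  - move=> r r_gt0 j; rewrite /T0 (_ : 1 <= cell (col r) j = false); last by rewrite /cell; lia.
    by case: r r_gt0 => //= _; rewrite onth0n.
have [T1 [n [h1 [T10 T1io _] le_n]]] := sim_runs hrun hT0.
have T1y j : T1 (1 + j%:Z) = onth y j by rewrite T1io eio revK.
(* The three additional steps move from cell 1 to the origin, return to cell 1 at the end, and read
   the first output symbol there. *)
have hr : run (1 + (n + (1 + 1))) (St Boot start None 0, 1, T0) (St Halt l (ohead y) 0, 1, T1).
  apply: run_cat; first apply: (@run1 _ _ _ (St Disp start None 0) 0 (T0 1) MoveL T0) => //.
  + by rewrite deltaE0.
  + exact: upd_same.
  apply: run_cat h1 _.
  apply: run_cat; first by apply: (run1 _ erefl (upd_same T1 _)); rewrite deltaE0 /= ec.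
  have e1 : T1 1 = ohead y by have := T1y 0%N; rewrite onth_ohead.
  by apply: (run1 _ _ (upd_same T1 _)); rewrite ?deltaE0 /= ?e1.
have [||hh hrel] := tape_rel_run hr (tape_rel_init simTM x) _ (_ : _ <= N)%N.
- by rewrite /= deltaE0.
- by move: le_n leN; rewrite /ssize /= size_rev; lia.
case: hrel => eq_st hright _; split=> //; last by rewrite /cf eq_st /= ?eqxx.
by apply: read_word_onth => j; rewrite hright T1y.
Qed.

End Simulation.

(** * Structured stack programs *)

(* [Loop r c] repeats c as long as the value that it pops from r is true. *)
Inductive cmd :=
| Skip
| Push (r : reg) (b : bool)
| Seq (c1 c2 : cmd)
| Case (r : reg) (ce c0 c1 : cmd)
| Loop (r : reg) (c : cmd).

(** The last argument is an upper bound on the number of stack operations; [EvMono] allows it to be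
    rounded up at any point. *)
Inductive eval : cmd -> store -> store -> nat -> Prop :=
| EvSkip s : eval Skip s s 0
| EvPush r b s : eval (Push r b) s (set s r (b :: get s r)) 1
| EvSeq c1 c2 s1 s2 s3 t1 t2 : eval c1 s1 s2 t1 -> eval c2 s2 s3 t2 ->
    eval (Seq c1 c2) s1 s3 (t1 + t2)
| EvCase r ce c0 c1 s s' t :
    eval (match ohead (get s r) with None => ce | Some false => c0 | Some true => c1 end)
         (set s r (behead (get s r))) s' t ->
    eval (Case r ce c0 c1) s s' t.+1
| EvLoopStop r c s : ohead (get s r) <> Some true ->
    eval (Loop r c) s (set s r (behead (get s r))) 1
| EvLoopStep r c s s1 s2 t1 t2 : ohead (get s r) = Some true ->
    eval c (set s r (behead (get s r))) s1 t1 -> eval (Loop r c) s1 s2 t2 ->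
    eval (Loop r c) s s2 (t1 + t2).+1
| EvMono c s s' t t' : eval c s s' t -> t <= t' -> eval c s s' t'.

(** A label is the position of a push or pop in the syntax tree, so finiteness comes for free.
    [Skip] has no label, hence [entry] is partial, and [None] stands for the exit. *)
Fixpoint lab (c : cmd) : finType :=
  match c with
  | Skip => void : finType
  | Push _ _ => unit : finType
  | Seq c1 c2 => (lab c1 + lab c2)%type : finType
  | Case _ ce c0 c1 => option (lab ce + (lab c0 + lab c1)) : finType
  | Loop _ c => option (lab c) : finType
  end.

Fixpoint entry (c : cmd) : option (lab c) :=
  match c with
  | Skip => None
  | Push _ _ => Some tt
  | Seq c1 c2 => if entry c1 is Some l then Some (inl l) else omap inr (entry c2)
  | Case _ _ _ _ => Some None
  | Loop _ _ => Some None
  end.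

Definition imap (L1 L2 : Type) (f : L1 -> L2) (i : instr L1) : instr L2 :=
  match i with IPush r b l => IPush r b (f l) | IPop r k => IPop r (fun a => f (k a)) end.

Fixpoint ins (c : cmd) : lab c -> instr (option (lab c)) :=
  match c with
  | Skip => fun l => match l with end
  | Push r b => fun _ => IPush r b None
  | Seq c1 c2 => fun l => match l with
    | inl l1 => imap (fun o => if o is Some l' then Some (inl l') else omap inr (entry c2)) (ins l1)
    | inr l2 => imap (omap inr) (ins l2)
    end
  | Case r ce c0 c1 => fun l => match l with
    | None => IPop r (fun a => match a with
        | None => omap (fun l => Some (inl l)) (entry ce)
        | Some false => omap (fun l => Some (inr (inl l))) (entry c0)
        | Some true => omap (fun l => Some (inr (inr l))) (entry c1)
        end)
    | Some (inl l) => imap (omap (fun l => Some (inl l))) (ins l)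
    | Some (inr (inl l)) => imap (omap (fun l => Some (inr (inl l)))) (ins l)
    | Some (inr (inr l)) => imap (omap (fun l => Some (inr (inr l)))) (ins l)
    end
  | Loop r c => fun l => match l with
    | None => IPop r (fun a => if a is Some true then
                oapp (fun l => Some (Some l)) (Some None) (entry c) else None)
    | Some l => imap (oapp (fun l => Some (Some l)) (Some None)) (ins l)
    end
  end.

(** Continuations of a pop are compared pointwise, which avoids functional extensionality. *)
Definition instr_eq (L : Type) (i j : instr L) : Prop :=
  match i, j with
  | IPush r b l, IPush r' b' l' => [/\ r = r', b = b' & l = l']
  | IPop r k, IPop r' k' => r = r' /\ k =1 k'
  | _, _ => False
  end.

(** * Compilation of structured programs to labelled instructions *)

Section Compile.
Variables (L : finType) (pg : L -> option (instr L)).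

Definition installed c (phi : lab c -> L) (e : L) := forall l,
  exists2 i, pg (phi l) = Some i & instr_eq i (imap (oapp phi e) (ins l)).

Lemma sruns_cat t1 t2 a b c : sruns pg t1 a b -> sruns pg t2 b c -> sruns pg (t1 + t2) a c.
Proof.
move=> h; elim: h c t2 => {t1 a b} [//|t l s c1 c2 st _ IH] c t2 h.
by rewrite addSn; apply: srunsS st _; apply: IH.
Qed.

Lemma instr_eq_map c c' (f : option (lab c') -> option (lab c)) (phi : lab c -> L) e phi' e' i j :
  instr_eq i (imap (oapp phi e) (imap f j)) ->
  (forall o, oapp phi e (f o) = oapp phi' e' o) ->
  instr_eq i (imap (oapp phi' e') j).
Proof.
move=> + h; case: i => [r b l|r k]; case: j => [r' b' l'|r' k'] //=.
  by rewrite h.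
by case=> -> hk; split=> // a; rewrite hk h.
Qed.

Lemma compile_correct c s s' t (phi : lab c -> L) e : eval c s s' t -> installed phi e ->
  exists2 t', t' <= t & sruns pg t' (oapp phi e (entry c), s) (e, s').
Proof.
move=> h; elim: h phi e => {c s s' t}.
- by move=> s phi e _; exists 0 => //; apply: sruns0.
- move=> r b s phi e inst; exists 1 => //; apply: srunsS (sruns0 _ _).
  by rewrite /sstep /=; case: (inst tt) => -[r' b' l|//] -> [/= <- <- ->].
- move=> c1 c2 s1 s2 s3 t1 t2 _ IH1 _ IH2 phi e inst.
  have inst2 : installed (fun l => phi (inr l)) e.
    move=> l; have [i ei hi] := inst (inr l); exists i => //.
    by apply: instr_eq_map hi _; case.
  have inst1 : installed (fun l => phi (inl l)) (oapp (fun l => phi (inr l)) e (entry c2)).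
    move=> l; have [i ei hi] := inst (inl l); exists i => //.
    by apply: instr_eq_map hi _; case=> //=; case: entry.
  have [t1' le1 h1] := IH1 _ _ inst1; have [t2' le2 h2] := IH2 _ _ inst2.
  exists (t1' + t2'); first by rewrite leq_add.
  by move: (sruns_cat h1 h2) => /=; case: (entry c1) => //=; case: (entry c2).
- move=> r ce c0 c1 s s' t _ IH phi e inst.
  have [i ei hi] := inst None.
  case: i ei hi => [//|r' k] ei [er ek]; rewrite /= in ek; subst r'.
  have [|t' le_t h] := IH (match ohead (get s r) as o return
      lab (match o with None => ce | Some false => c0 | Some true => c1 end) -> L with
      | None => fun l => phi (Some (inl l))
      | Some false => fun l => phi (Some (inr (inl l)))
      | Some true => fun l => phi (Some (inr (inr l))) end) e.
    case: (ohead _) => [[]|] l.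
    + by have [j ej hj] := inst (Some (inr (inr l))); exists j => //; apply: instr_eq_map hj _; case.
    + by have [j ej hj] := inst (Some (inr (inl l))); exists j => //; apply: instr_eq_map hj _; case.
    + by have [j ej hj] := inst (Some (inl l)); exists j => //; apply: instr_eq_map hj _; case.
  exists t'.+1; rewrite //=; apply: srunsS h; rewrite /sstep ei ek.
  by case: (ohead _) => [[]|] //=; case: entry.
- move=> r c s hs phi e inst; exists 1 => //; apply: srunsS (sruns0 _ _).
  have [i ei hi] := inst None.
  case: i ei hi => [//|r' k] ei [er ek]; rewrite /= in ek; subst r'.
  by rewrite /sstep /= ei ek; move: hs; case: ohead => // -[].
- move=> r c s s1 s2 t1 t2 hs _ IH1 _ IH2 phi e inst.
  have [i ei hi] := inst None.
  case: i ei hi => [//|r' k] ei [er ek]; rewrite /= in ek; subst r'.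
  (* The exit of the body is the head of the loop. *)
  have inst1 : installed (fun l => phi (Some l)) (phi None).
    move=> l; have [i ej hj] := inst (Some l); exists i => //.
    by apply: instr_eq_map hj _; case.
  have [t1' le1 h1] := IH1 _ _ inst1; have [t2' le2 h2] := IH2 _ _ inst.
  exists (t1' + t2').+1; first by rewrite ltnS leq_add.
  apply: srunsS (sruns_cat h1 h2); rewrite /sstep ei ek hs /=.
  by case: entry.
- move=> c s s' t t' _ IH le_t phi e inst; have [t1 le1 h1] := IH _ _ inst.
  by exists t1 => //; apply: leq_trans le1 le_t.
Qed.

End Compile.

Section CmdTM.
Variable c : cmd.

Definition cmd_code (l : option (lab c)) : option (instr (option (lab c))) :=
  omap (fun l => imap (oapp Some None) (ins l)) l.

Definition cmdTM : TM := simTM (entry c) cmd_code.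

Lemma cmdTM_correct x y s' t N :
  eval c (Store (rev x) [::] [::] [::] [::]) s' t -> get s' Io = rev y ->
  (t * (10 * (size x + t) + 20) + 3 <= N)%N ->
  let cf := exec N (init cmdTM x) in
  [/\ halted cf, output cf = y & @tm_accept cmdTM (cf_state cf) = (ohead y == Some true)].
Proof.
move=> ev eio leN.
have inst : installed cmd_code (@Some (lab c)) None.
  by move=> l; eexists; [reflexivity|case: (ins l)].
have [t' le_t] := compile_correct ev inst.
rewrite (_ : oapp _ _ _ = entry c); last by case: entry.
move=> hr; apply: (sim_correct hr erefl eio); nia.
Qed.

End CmdTM.

(** Output size is thus controlled by running time; [PT_PB] rests on this. *)
Lemma eval_ssize c s s' t : eval c s s' t -> ssize s' <= ssize s + t.
Proof.
have pop s0 r : ssize (set s0 r (behead (get s0 r))) <= ssize s0.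
  by case: s0 => *; case: r; rewrite /ssize /= ?size_behead; lia.
move=> h; elim: h => {c s s' t}.
- by move=> *; lia.
- by move=> r b s; case: s => *; case: r; rewrite /ssize /=; lia.
- by move=> *; lia.
- by move=> r ce c0 c1 s s' t _; have := pop s r; lia.
- by move=> r c s _; have := pop s r; lia.
- by move=> r c s s1 s2 t1 t2 _ _; have := pop s r; lia.
- by move=> *; lia.
Qed.

(** * Trees in prefix code *)

Inductive tree := Leaf | Node (a b : tree).

(** The code is self-delimiting: trees can lie one above the other on a stack of bits without
    separators. *)
Fixpoint code (t : tree) : seq bool :=
  if t is Node a b then true :: code a ++ code b else [:: false].

Definition tsize t := size (code t).

Lemma tsize_node a b : tsize (Node a b) = (tsize a + tsize b).+1.
Proof. by rewrite /tsize /= size_cat. Qed.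

Lemma tsize_gt0 t : 0 < tsize t.
Proof. by case: t. Qed.

Lemma evalS c1 c2 s1 s2 s3 t1 t2 t : eval c1 s1 s2 t1 -> eval c2 s2 s3 t2 -> t1 + t2 <= t ->
  eval (Seq c1 c2) s1 s3 t.
Proof. by move=> h1 h2; apply: EvMono; apply: EvSeq h1 h2. Qed.

Lemma eval_stop c io m a b : eval (Loop R4 c) (Store io m a b [::]) (Store io m a b [::]) 1.
Proof. by apply: (@EvLoopStop R4 c (Store io m a b [::])). Qed.

(* Moves the topmost tree of R1; R4 counts in unary the subtrees still to be read. *)
Definition mv (em : bool -> cmd) : cmd :=
  Seq (Push R4 true) (Loop R4 (Case R1 Skip (em false)
    (Seq (em true) (Seq (Push R4 true) (Push R4 true))))).

Lemma eval_mv em (sk : bool -> seq bool * seq bool -> seq bool * seq bool) :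
  (forall b io m ab k, eval (em b) (Store io m ab.1 ab.2 k)
                            (Store io m (sk b ab).1 (sk b ab).2 k) 1) ->
  forall t io m a b, let ab := foldl (fun x y => sk y x) (a, b) (code t) in
  eval (mv em) (Store io (code t ++ m) a b [::]) (Store io m ab.1 ab.2 [::]) (5 * tsize t + 2).
Proof.
move=> hem t io m a b ab.
(* In continuation form, for any number of trees still owed in [k], so that the two subtrees of a
   node can be chained. *)
have loop s' n k : forall t m ab, let ab' := foldl (fun x y => sk y x) ab (code t) in
    eval (Loop R4 (Case R1 Skip (em false) (Seq (em true) (Seq (Push R4 true) (Push R4 true)))))
      (Store io m ab'.1 ab'.2 k) s' n ->
    eval (Loop R4 (Case R1 Skip (em false) (Seq (em true) (Seq (Push R4 true) (Push R4 true)))))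
      (Store io (code t ++ m) ab.1 ab.2 (true :: k)) s' (n + 5 * tsize t).
  move=> t0; elim: t0 n k => [|t1 IH1 t2 IH2] n k m0 ab0 /= h.
    apply: EvMono (EvLoopStep _ _ h) _; first by [].
      by apply: EvCase => /=; apply: hem.
    by rewrite /tsize /=; lia.
  rewrite -catA; rewrite foldl_cat in h.
  apply: EvMono (EvLoopStep _ _ (IH1 _ _ _ _ (IH2 _ _ _ _ h))) _; first by [].
    apply: EvCase => /=; apply: EvSeq; first exact: hem.
    by apply: EvSeq; apply: EvPush.
  by rewrite tsize_node; lia.
apply: evalS (EvPush _ _ _) _ _; first by apply: (loop _ _ _ _ _ (a, b)); apply: EvLoopStop.
by rewrite /=; lia.
Qed.

Definition mvA := mv (fun b => Push R2 b).
Definition mvB := mv (fun b => Push R3 b).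
Definition discard := mv (fun=> Skip).

Lemma eval_mvA t io m a b : eval mvA (Store io (code t ++ m) a b [::])
  (Store io m (rev (code t) ++ a) b [::]) (5 * tsize t + 2).
Proof.
have := @eval_mv (fun b => Push R2 b) (fun c ab => (c :: ab.1, ab.2)) _ t io m a b.
rewrite (_ : foldl _ _ _ = (rev (code t) ++ a, b)); first by apply=> *; apply: EvPush.
by elim: (code t) a => //= c s IH a; rewrite IH rev_cons -cats1 -catA.
Qed.

Lemma eval_mvB t io m a b : eval mvB (Store io (code t ++ m) a b [::])
  (Store io m a (rev (code t) ++ b) [::]) (5 * tsize t + 2).
Proof.
have := @eval_mv (fun b => Push R3 b) (fun c ab => (ab.1, c :: ab.2)) _ t io m a b.
rewrite (_ : foldl _ _ _ = (a, rev (code t) ++ b)); first by apply=> *; apply: EvPush.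
by elim: (code t) b => //= c s IH b; rewrite IH rev_cons -cats1 -catA.
Qed.

Lemma eval_discard t io m a b : eval discard (Store io (code t ++ m) a b [::])
  (Store io m a b [::]) (5 * tsize t + 2).
Proof.
have := @eval_mv (fun=> Skip) (fun c ab => ab) _ t io m a b.
rewrite (_ : foldl _ _ _ = (a, b)); last by elim: (code t).
by apply=> *; apply: EvMono (EvSkip _) _.
Qed.

(* Empties a stack, R4 serving as a flag that it is not yet empty. *)
Definition dump (src : reg) (em : bool -> cmd) : cmd :=
  Seq (Push R4 true) (Loop R4 (Case src Skip (Seq (em false) (Push R4 true))
                                             (Seq (em true) (Push R4 true)))).

Definition dumpA := dump R2 (Push R1).
Definition dumpB := dump R3 (Push R1).
Definition dumpAB := dump R2 (fun b => Seq (Push R1 b) (Push R3 b)).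
Definition dumpBA := dump R3 (Push R2).

Lemma eval_dumpA io u m b :
  eval dumpA (Store io m u b [::]) (Store io (rev u ++ m) [::] b [::]) (5 * size u + 4).
Proof.
apply: evalS (EvPush _ _ _) (_ : eval _ _ _ (5 * size u + 3)) _ => /=; last by lia.
elim: u m => [|c u IH] m.
  apply: EvMono (EvLoopStep _ _ (eval_stop _ _ _ _ _)) _; [by []|by apply: EvCase; apply: EvSkip|by []].
rewrite rev_cons -cats1 -catA.
apply: EvMono (EvLoopStep _ _ (IH (c :: m))) _; first by [].
  by apply: EvCase; case: c => /=; apply: EvSeq (EvPush _ _ _) (EvPush _ _ _).
by rewrite /=; lia.
Qed.

Lemma eval_dumpB io u m a :
  eval dumpB (Store io m a u [::]) (Store io (rev u ++ m) a [::] [::]) (5 * size u + 4).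
Proof.
apply: evalS (EvPush _ _ _) (_ : eval _ _ _ (5 * size u + 3)) _ => /=; last by lia.
elim: u m => [|c u IH] m.
  apply: EvMono (EvLoopStep _ _ (eval_stop _ _ _ _ _)) _; [by []|by apply: EvCase; apply: EvSkip|by []].
rewrite rev_cons -cats1 -catA.
apply: EvMono (EvLoopStep _ _ (IH (c :: m))) _; first by [].
  by apply: EvCase; case: c => /=; apply: EvSeq (EvPush _ _ _) (EvPush _ _ _).
by rewrite /=; lia.
Qed.

Lemma eval_dumpBA io u m a :
  eval dumpBA (Store io m a u [::]) (Store io m (rev u ++ a) [::] [::]) (5 * size u + 4).
Proof.
apply: evalS (EvPush _ _ _) (_ : eval _ _ _ (5 * size u + 3)) _ => /=; last by lia.
elim: u a => [|c u IH] a.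
  apply: EvMono (EvLoopStep _ _ (eval_stop _ _ _ _ _)) _; [by []|by apply: EvCase; apply: EvSkip|by []].
rewrite rev_cons -cats1 -catA.
apply: EvMono (EvLoopStep _ _ (IH (c :: a))) _; first by [].
  by apply: EvCase; case: c => /=; apply: EvSeq (EvPush _ _ _) (EvPush _ _ _).
by rewrite /=; lia.
Qed.

Lemma eval_dumpAB io u m b : eval dumpAB (Store io m u b [::])
  (Store io (rev u ++ m) [::] (rev u ++ b) [::]) (5 * size u + 4).
Proof.
apply: evalS (EvPush _ _ _) (_ : eval _ _ _ (5 * size u + 3)) _ => /=; last by lia.
elim: u m b => [|c u IH] m b.
  apply: EvMono (EvLoopStep _ _ (eval_stop _ _ _ _ _)) _; [by []|by apply: EvCase; apply: EvSkip|by []].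
rewrite rev_cons -cats1 -!catA.
apply: EvMono (EvLoopStep _ _ (IH (c :: m) (c :: b))) _; first by [].
  by apply: EvCase; case: c => /=; apply: EvSeq (EvSeq (EvPush _ _ _) (EvPush _ _ _)) (EvPush _ _ _).
by rewrite /=; lia.
Qed.

(** After [dumpAB] the second copy lies in R3 in reading order, so moving it straight to R1 would
    reverse it; the detour through R2 supplies the missing reversal. *)
Definition dup := Seq mvA (Seq dumpAB (Seq dumpBA dumpA)).
Definition swap := Seq mvA (Seq mvB (Seq dumpA dumpB)).
Definition rot3 := Seq mvA (Seq mvB (Seq mvA (Seq dumpB dumpA))).

Definition main (io m : seq bool) := Store io m [::] [::] [::].

Lemma eval_dup t io m : eval dup (main io (code t ++ m)) (main io (code t ++ code t ++ m))
  (20 * tsize t + 20).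
Proof.
apply: evalS (eval_mvA _ _ _ _ _) _ _.
  apply: evalS (eval_dumpAB _ _ _ _) _ (leqnn _).
  apply: evalS (eval_dumpBA _ _ _ _) _ (leqnn _).
  rewrite !cats0 revK; have := eval_dumpA io (rev (code t)) (code t ++ m) [::].
  by rewrite revK; apply.
by rewrite !cats0 !size_rev /tsize; lia.
Qed.

Lemma eval_swap t u io m : eval swap (main io (code t ++ code u ++ m)) (main io (code u ++ code t ++ m))
  (10 * (tsize t + tsize u) + 20).
Proof.
apply: evalS (eval_mvA _ _ _ _ _) _ _.
  apply: evalS (eval_mvB _ _ _ _ _) _ (leqnn _).
  apply: evalS (eval_dumpA _ _ _ _) _ (leqnn _).
  rewrite !cats0 revK; have := eval_dumpB io (rev (code u)) (code t ++ m) [::].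
  by rewrite revK; apply.
by rewrite !cats0 !size_rev /tsize; lia.
Qed.

Lemma eval_rot3 t u v io m : eval rot3 (main io (code t ++ code u ++ code v ++ m))
  (main io (code t ++ code v ++ code u ++ m)) (10 * (tsize t + tsize u + tsize v) + 30).
Proof.
apply: evalS (eval_mvA _ _ _ _ _) _ _.
  apply: evalS (eval_mvB _ _ _ _ _) _ (leqnn _).
  apply: evalS (eval_mvA _ _ _ _ _) _ (leqnn _).
  apply: evalS (eval_dumpB _ _ _ _) _ (leqnn _).
  rewrite !cats0 revK; have := eval_dumpA io (rev (code v) ++ rev (code t)) (code u ++ m) [::].
  by rewrite rev_cat !revK -catA; apply.
by rewrite !cats0 !size_cat !size_rev /tsize; lia.
Qed.

(** * Polynomial-time functions *)

Class Enc (A : Type) := enc : A -> tree.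
#[global] Instance Enc_tree : Enc tree := id.
#[global] Instance Enc_unit : Enc unit := fun=> Leaf.
#[global] Instance Enc_bool : Enc bool := fun b => if b then Node Leaf Leaf else Leaf.
(** Unary, for sizes, indices and values of cells. Numbers that may be exponential in the input,
    such as numerators, are handled as lists of bits. *)
#[global] Instance Enc_nat : Enc nat := fun n => iter n (Node Leaf) Leaf.
#[global] Instance Enc_prod A B (EA : Enc A) (EB : Enc B) : Enc (A * B) :=
  fun p => Node (enc p.1) (enc p.2).
#[global] Instance Enc_seq A (EA : Enc A) : Enc (seq A) := foldr (fun a => Node (enc a)) Leaf.

Definition esz A (EA : Enc A) (a : A) := tsize (enc a).
Arguments esz {A EA} a.

Lemma enc_pair A B (EA : Enc A) (EB : Enc B) (p : A * B) : enc p = Node (enc p.1) (enc p.2).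
Proof. by []. Qed.

Lemma enc_cons A (EA : Enc A) (a : A) s : enc (a :: s) = Node (enc a) (enc s).
Proof. by []. Qed.

Lemma esz_pair A B (EA : Enc A) (EB : Enc B) (a : A) (b : B) : esz (a, b) = (esz a + esz b).+1.
Proof. exact: tsize_node. Qed.

Lemma esz_cons A (EA : Enc A) (a : A) s : esz (a :: s) = (esz a + esz s).+1.
Proof. exact: tsize_node. Qed.

Lemma esz_gt0 A (EA : Enc A) (a : A) : 0 < esz a.
Proof. exact: tsize_gt0. Qed.

Lemma esz_nat n : esz n = (2 * n).+1.
Proof.
elim: n => // n; have E : enc n.+1 = Node Leaf (enc n) by [].
rewrite /esz E tsize_node => ->.
by rewrite /tsize /=; lia.
Qed.

Lemma esz_bool (b : bool) : esz b <= 3.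
Proof. by case: b. Qed.

Lemma size_esz A (EA : Enc A) (s : seq A) : size s < esz s.
Proof. by elim: s => //= a s IH; rewrite esz_cons; have := esz_gt0 EA a; lia. Qed.

Lemma leq_exp m n k : m <= n -> m ^ k <= n ^ k.
Proof. by case: k => // k; rewrite leq_exp2r. Qed.

(** * Polynomial bounds in the size of the encoding *)

Section PolyBound.
Context {A : Type} {EA : Enc A}.

Definition PB (g : A -> nat) := exists C k, forall a, g a <= C * (esz a).+1 ^ k.

Lemma PB_le g h : PB h -> (forall a, g a <= h a) -> PB g.
Proof. by move=> [C [k hh]] gh; exists C, k => a; apply: leq_trans (gh a) (hh a). Qed.

Lemma PB_const c : PB (fun=> c).
Proof. by exists c, 0 => a; rewrite expn0 muln1. Qed.

Lemma PB_esz : PB esz.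
Proof. by exists 1, 1 => a; rewrite mul1n expn1. Qed.

Lemma PB_add g h : PB g -> PB h -> PB (fun a => g a + h a).
Proof.
move=> [C [k hg]] [D [l hh]]; exists (C + D), (k + l) => a; rewrite mulnDl.
by apply: leq_add; [apply: leq_trans (hg a) _|apply: leq_trans (hh a) _];
   rewrite leq_mul2l leq_pexp2l ?orbT //; lia.
Qed.

Lemma PB_mul g h : PB g -> PB h -> PB (fun a => g a * h a).
Proof.
move=> [C [k hg]] [D [l hh]]; exists (C * D), (k + l) => a.
by rewrite expnD mulnACA; apply: leq_mul.
Qed.

Lemma PB_exp g k : PB g -> PB (fun a => g a ^ k).
Proof.
move=> hg; elim: k => [|k IH]; first by apply: PB_le (PB_const 1) _.
by apply: PB_le (PB_mul hg IH) _ => a; rewrite expnS.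
Qed.

End PolyBound.

Lemma PB_comp A B (EA : Enc A) (EB : Enc B) (f : A -> B) g :
  PB (fun a => esz (f a)) -> PB g -> PB (fun a => g (f a)).
Proof.
move=> hf [D [l hg]]; apply: PB_le (PB_mul (PB_const D) (PB_exp l (PB_add (PB_const 1) hf))) _.
by move=> a; apply: hg.
Qed.

Ltac pb := repeat first [assumption | exact: PB_const | exact: PB_esz | apply: PB_add
  | apply: PB_mul | apply: PB_exp].

(* The rest m of the main stack is left alone, which makes programs composable. *)
Definition PT A B (EA : Enc A) (EB : Enc B) (f : A -> B) :=
  exists c T, PB T /\ forall a io m,
    eval c (main io (code (enc a) ++ m)) (main io (code (enc (f a)) ++ m)) (T a).
Arguments PT {A B EA EB} f.

(** * Closure properties of the polynomial-time functions *)

Section Closure0.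
Context {A B : Type} {EA : Enc A} {EB : Enc B}.

Lemma PT_ext (f g : A -> B) : PT f -> f =1 g -> PT g.
Proof. by move=> [c [T [hT h]]] fg; exists c, T; split=> // a; rewrite -fg. Qed.

Lemma PT_PB (f : A -> B) : PT f -> PB (fun a => esz (f a)).
Proof.
move=> [c [T [hT h]]]; apply: PB_le (PB_add PB_esz hT) _ => a.
by have := eval_ssize (h a [::] [::]); rewrite /main /ssize /= !cats0 !addn0.
Qed.

End Closure0.

Section Closure.
Context {A B C : Type} {EA : Enc A} {EB : Enc B} {EC : Enc C}.

Lemma PT_cast (f : A -> B) (g : A -> C) : PT f -> (forall a, enc (f a) = enc (g a)) -> PT g.
Proof. by move=> [c [T [hT h]]] fg; exists c, T; split=> // a; rewrite -fg. Qed.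

(** Constructors and changes of type that keep the encoding are computed by doing nothing. *)
Lemma PT_same (g : A -> B) : (forall a, enc a = enc (g a)) -> PT g.
Proof.
move=> h; exists Skip, (fun=> 0); split; first exact: PB_const.
by move=> a io m; rewrite h; apply: EvSkip.
Qed.

Lemma PT_comp (g : B -> C) (f : A -> B) : PT g -> PT f -> PT (fun a => g (f a)).
Proof.
move=> [cg [Tg [hTg hg]]] hf; have hB := PT_PB hf; case: hf => [cf [Tf [hTf hf]]].
exists (Seq cf cg), (fun a => Tf a + Tg (f a)); split.
  by apply: PB_add => //; apply: PB_comp.
by move=> a io m; apply: EvSeq.
Qed.

Fixpoint push_all (s : seq bool) : cmd :=
  if s is b :: s' then Seq (push_all s') (Push R1 b) else Skip.

Lemma eval_push_all s io m : eval (push_all s) (main io m) (main io (s ++ m)) (size s).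
Proof.
elim: s => [|b s IH] /=; first exact: EvSkip.
by rewrite -addn1; apply: EvSeq IH _; apply: EvPush.
Qed.

Lemma PT_const (b : B) : PT (fun _ : A => b).
Proof.
exists (Seq discard (push_all (code (enc b)))), (fun a => 5 * esz a + 2 + size (code (enc b))).
split; first by pb.
by move=> a io m; apply: EvSeq (eval_discard _ _ _ _ _) (eval_push_all _ _ _).
Qed.

Lemma PT_pair (f : A -> B) (g : A -> C) : PT f -> PT g -> PT (fun a => (f a, g a)).
Proof.
move=> hf hg; have hBf := PT_PB hf; have hBg := PT_PB hg.
case: hf hg => [cf [Tf [hTf hf]]] [cg [Tg [hTg hg]]].
exists (Seq dup (Seq cf (Seq swap (Seq cg (Seq swap (Push R1 true)))))),
  (fun a => 60 * (esz a + esz (f a) + esz (g a)) + 100 + Tf a + Tg a); split; first by pb.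
move=> a io m.
apply: evalS (eval_dup _ _ _) _ _; first apply: evalS (hf _ _ _) _ (leqnn _).
  apply: evalS (eval_swap _ _ _ _) _ (leqnn _); apply: evalS (hg _ _ _) _ (leqnn _).
  apply: evalS (eval_swap _ _ _ _) _ (leqnn _).
  rewrite enc_pair /= -catA; apply: EvPush.
by rewrite /esz; lia.
Qed.

Definition pop := Case R1 Skip Skip Skip.

Lemma eval_pop1 b io m : eval pop (main io (b :: m)) (main io m) 1.
Proof. by apply: EvCase; case: b; apply: EvSkip. Qed.

Lemma PT_fst (f : A -> B * C) : PT f -> PT (fun a => (f a).1).
Proof.
move=> hf; have hBf := PT_PB hf; case: hf => [cf [Tf [hTf hf]]].
exists (Seq cf (Seq pop (Seq swap discard))), (fun a => Tf a + (20 * esz (f a) + 50)); split; first by pb.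
move=> a io m; apply: evalS (hf _ _ _) _ (leqnn _).
rewrite enc_pair /= -catA; apply: evalS (eval_pop1 _ _ _) _ _.
  by apply: evalS (eval_swap _ _ _ _) (eval_discard _ _ _ _ _) (leqnn _).
by rewrite (surjective_pairing (f a)) esz_pair /esz /=; lia.
Qed.

Lemma PT_snd (f : A -> B * C) : PT f -> PT (fun a => (f a).2).
Proof.
move=> hf; have hBf := PT_PB hf; case: hf => [cf [Tf [hTf hf]]].
exists (Seq cf (Seq pop discard)), (fun a => Tf a + (20 * esz (f a) + 50)); split; first by pb.
move=> a io m; apply: evalS (hf _ _ _) _ (leqnn _).
rewrite enc_pair /= -catA.
apply: evalS (eval_pop1 _ _ _) (eval_discard _ _ _ _ _) _.
by rewrite (surjective_pairing (f a)) esz_pair /esz /=; lia.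
Qed.

Lemma PT_if (b : A -> bool) (f g : A -> B) : PT b -> PT f -> PT g ->
  PT (fun a => if b a then f a else g a).
Proof.
move=> [cb [Tb [hTb hb]]] [cf [Tf [hTf hf]]] [cg [Tg [hTg hg]]].
(* [true] has a code of three bits, of which [Case] consumes one and the two [pop] the others;
   [false] is a single bit. *)
exists (Seq dup (Seq cb (Case R1 Skip cg (Seq pop (Seq pop cf))))),
  (fun a => 20 * esz a + 40 + Tb a + Tf a + Tg a); split; first by pb.
move=> a io m; apply: evalS (eval_dup _ _ _) _ _.
  apply: evalS (hb _ _ _) _ (leqnn _).
  apply: (@EvMono _ _ _ (2 + Tf a + Tg a).+1); last exact: leqnn.
  apply: EvCase; case: (b a); last by apply: EvMono (hg _ _ _) _; lia.
  have h : eval (Seq pop (Seq pop cf)) (main io (false :: false :: code (enc a) ++ m))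
    (main io (code (enc (f a)) ++ m)) (2 + Tf a + Tg a).
    apply: evalS (eval_pop1 _ _ _) _ _.
      by apply: evalS (eval_pop1 _ _ _) (hf _ _ _) (leqnn _).
    by lia.
  exact: h.
by rewrite /esz; lia.
Qed.

(** A list cell and a pair have the same code. Once [Case] has consumed the leading [true], pushing
    it back gives the pair of head and tail, and after the swap another [true] pairs it with the
    argument. *)
Lemma PT_seq_case (l : A -> seq B) (f : A -> C) (g : A * (B * seq B) -> C) :
  PT l -> PT f -> PT g ->
  PT (fun a => if l a is x :: r then g (a, (x, r)) else f a).
Proof.
move=> hl; have hBl := PT_PB hl.
move: hl => [cb [Tb [hTb hb]]] [cf [Tf [hTf hf]]] [cg [Tg [hTg hg]]].
exists (Seq dup (Seq cb (Case R1 Skip cf (Seq (Push R1 true) (Seq swap (Seq (Push R1 true) cg)))))),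
  (fun a => 30 * esz a + 10 * esz (l a) + 60 + Tb a + Tf a +
    (if l a is x :: r then Tg (a, (x, r)) else 0)); split.
  apply: PB_add; first by pb.
 
    case: hTg => [K [k hK]].
    apply: PB_le (PB_mul (PB_const K) (PB_exp k (PB_add (PB_const 2) (PB_add PB_esz hBl)))) _.
    move=> a; case el : (l a) => [//|x r]; apply: leq_trans (hK _) _.
    by apply: leq_mul => //; apply: leq_exp; rewrite !esz_pair esz_cons /=; lia.
move=> a io m; apply: evalS (eval_dup _ _ _) _ _.
  apply: evalS (hb _ _ _) _ (leqnn _).
  apply: (@EvMono _ _ _ (10 * esz a + 10 * esz (l a) + 30 + Tf a +
     (if l a is x :: r then Tg (a, (x, r)) else 0)).+1); last exact: leqnn.
  apply: EvCase; case el: (l a) => [|x r].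
    by apply: EvMono (hf _ _ _) _; lia.
  have h : eval (Seq (Push R1 true) (Seq swap (Seq (Push R1 true) cg)))
     (main io ((code (enc x) ++ code (enc r)) ++ code (enc a) ++ m))
     (main io (code (enc (g (a, (x, r)))) ++ m))
     (10 * esz a + 10 * esz (x :: r) + 30 + Tf a + Tg (a, (x, r))).
    apply: evalS (EvPush _ _ _) _ _.
      apply: evalS (eval_swap (Node (enc x) (enc r)) (enc a) io m) _ (leqnn _).
      apply: evalS (EvPush _ _ _) _ (leqnn _).
      have := hg (a, (x, r)) io m; rewrite enc_pair /= -catA; apply.
    by rewrite tsize_node esz_cons /esz /=; lia.
  exact: h.
by rewrite /esz; lia.
Qed.

End Closure.

Section Foldl.
Context {A X S : Type} {EA : Enc A} {EX : Enc X} {ES : Enc S}.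
Variables (step : A -> S -> X -> S) (init : A -> S) (l : A -> seq X).

(* The main stack holds the list, then the pair (a, s) of the parameter and the accumulator. *)
Definition fold_body c := Seq rot3 (Seq (Push R1 true) (Seq c swap)).

(** With the leading [true] of the list consumed by [Loop], [rot3] brings the head next to the pair
    of parameter and accumulator, and a pushed [true] makes of them the argument of [c]. *)
Lemma eval_fold_loop c T a io m B :
  (forall q io m, eval c (main io (code (enc q) ++ m))
     (main io (code (enc (q.2.1, step q.2.1 q.2.2 q.1)) ++ m)) (T q)) ->
  forall K k, (forall q : X * (A * S), T q <= K * (esz q).+1 ^ k) ->
  forall w s, (forall n, esz (foldl (step a) s (take n w)) <= B) ->
  eval (Loop R1 (fold_body c)) (main io (code (enc w) ++ code (enc (a, s)) ++ m))
    (main io (code (enc (a, foldl (step a) s w)) ++ m))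
    (size w * (K * (esz w + esz a + B + 3) ^ k + 20 * (esz w + esz a + B) + 70) + 1).
Proof.
move=> hc K k hT; elim=> [|x w IH] s hB.
  have h := @EvLoopStop R1 (fold_body c) (main io (code (enc ([::] : seq X)) ++ code (enc (a, s)) ++ m)).
  by apply: h.
have hs : esz s <= B by have := hB 0; rewrite take0.
have hs1 : esz (step a s x) <= B by have := hB 1; rewrite /= take0.
have {}IH := IH (step a s x) (fun n => hB n.+1).
have hT1 := hT (x, (a, s)).
pose (W := K * (esz w + esz a + B + 3) ^ k + 20 * (esz w + esz a + B) + 70).
pose (W' := K * (esz (x :: w) + esz a + B + 3) ^ k + 20 * (esz (x :: w) + esz a + B) + 70).
have leW : W <= W'.
  rewrite /W /W' esz_cons; apply: leq_add => //; apply: leq_add; last by lia.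
  by apply: leq_mul => //; apply: leq_exp; lia.
have hbody : eval (fold_body c) (main io ((code (enc x) ++ code (enc w)) ++ code (enc (a, s)) ++ m))
   (main io (code (enc w) ++ code (enc (a, step a s x)) ++ m)) W'.-1.
  rewrite -catA; apply: evalS (eval_rot3 _ _ _ _ _) _ _.
    apply: evalS (EvPush _ _ _) _ (leqnn _).
    have h : eval c (main io (true :: code (enc x) ++ code (enc (a, s)) ++ code (enc w) ++ m))
        (main io (code (enc (a, step a s x)) ++ code (enc w) ++ m)) (T (x, (a, s))).
      by rewrite (catA (code (enc x))); apply: hc (x, (a, s)) io (code (enc w) ++ m).
    apply: evalS h (eval_swap _ _ _ _) (leqnn _).
  have hT2 : K * (esz (x, (a, s))).+1 ^ k <= K * (esz (x :: w) + esz a + B + 3) ^ k.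
    by apply: leq_mul => //; apply: leq_exp; rewrite !esz_pair esz_cons; lia.
  have := leq_trans hT1 hT2.
  rewrite -!/(esz _) !esz_pair /W' esz_cons /=; lia.
have E : code (enc (x :: w)) = true :: code (enc x) ++ code (enc w) by rewrite enc_cons.
rewrite E; have hstep := @EvLoopStep R1 (fold_body c)
  (main io ((true :: code (enc x) ++ code (enc w)) ++ code (enc (a, s)) ++ m))
  _ _ _ _ erefl hbody IH.
apply: EvMono hstep _.
have : 0 < W' by rewrite /W'; lia.
rewrite -/W -/W' [size (x :: w)]/= mulSn.
have : size w * W <= size w * W' by rewrite leq_mul2l leW orbT.
lia.
Qed.

(** A polynomial-time step may double the accumulator, and iterating that is exponential; hence the
    polynomial bound [B] on all intermediate accumulators. *)
Lemma PT_foldl (B : A -> nat) : PT l -> PT init ->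
  PT (fun q : X * (A * S) => step q.2.1 q.2.2 q.1) -> PB B ->
  (forall a n, esz (foldl (step a) (init a) (take n (l a))) <= B a) ->
  PT (fun a => foldl (step a) (init a) (l a)).
Proof.
move=> hl hi hs hB hle.
have PTid (T : Type) (ET : Enc T) : PT (fun a : T => a) by apply: PT_same.
have hsnd : PT (fun q : X * (A * S) => q.2) by apply: PT_snd (PTid _ _).
have [c [T [[K [k hT]] hc]]] := PT_pair (PT_fst hsnd) hs.
have hBl := PT_PB hl.
have [c0 [T0 [hT0 h0]]] := PT_pair hl (PT_pair (PTid _ _) hi).
exists (Seq c0 (Seq pop (Seq (Loop R1 (fold_body c)) (Seq pop discard)))),
  (fun a => T0 a + (esz (l a) * (K * (esz (l a) + esz a + B a + 3) ^ k
    + 20 * (esz (l a) + esz a + B a) + 70))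
    + 20 * esz a + 20); split; first by pb.
move=> a io m; apply: evalS (h0 _ _ _) _ _.
  rewrite (_ : code _ ++ m = true :: code (enc (l a)) ++ code (enc (a, init a)) ++ m); last first.
    by rewrite (catA (code (enc (l a)))).
  apply: evalS (eval_pop1 _ _ _) _ (leqnn _).
  apply: evalS (eval_fold_loop _ _ hc hT (hle a)) _ (leqnn _).
  rewrite enc_pair /= -catA.
  exact: evalS (eval_pop1 _ _ _) (eval_discard _ _ _ _ _) (leqnn _).
rewrite -/(esz a).
set W := (K * _ + _ + _).
have : size (l a) * W <= esz (l a) * W by rewrite leq_mul2r (ltnW (size_esz _ _)) orbT.
lia.
Qed.

End Foldl.

(** [Io] yields the last input bit first, so the list is built by prepending to the empty list
    [[:: false]]; the pushed strings are a leading [true] followed by the code of the bit. *)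
Definition load_loop := Loop R4 (Case Io Skip
   (Seq (push_all [:: true; false]) (Push R4 true))
   (Seq (push_all [:: true; true; false; false]) (Push R4 true))).
Definition load := Seq (push_all [:: false]) (Seq (Push R4 true) load_loop).

Lemma eval_load x :
  eval load (Store (rev x) [::] [::] [::] [::]) (main [::] (code (enc x))) (7 * size x + 6).
Proof.
apply: evalS (eval_push_all _ _ _) _ _.
  apply: evalS (EvPush _ _ _) (_ : eval _ _ _ (7 * size x + 3)) (leqnn _).
  have loop u v : eval load_loop (Store u (code (enc v)) [::] [::] [:: true])
    (main [::] (code (enc (catrev u v)))) (7 * size u + 3).
    elim: u v => [|b u IH] v /=.
      by apply: EvMono (EvLoopStep _ _ (eval_stop _ _ _ _ _)) _; [by []|by apply: EvCase; apply: EvSkip|by []].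
    apply: EvMono (EvLoopStep (t1 := 6) _ _ (IH (b :: v))) _; first by [].
      apply: EvCase; rewrite enc_cons; case: b.
        by apply: evalS (eval_push_all _ _ _) (EvPush _ _ _) _.
      by apply: evalS (eval_push_all _ _ _) (EvPush _ _ _) _.
    by rewrite /=; lia.
  by have := loop (rev x) [::]; rewrite size_rev catrevE revK cats0; apply.
by rewrite /=; lia.
Qed.

Definition store_loop := Loop R1 (Case R1 Skip (Push Io false) (Seq pop (Seq pop (Push Io true)))).

Lemma eval_store y io :
  eval store_loop (main io (code (enc y))) (main (catrev y io) [::]) (5 * size y + 1).
Proof.
elim: y io => [|b y IH] io.
  by apply: (@EvLoopStop R1 _ (main io [:: false])).
apply: EvMono (EvLoopStep _ _ (IH (b :: io))) _; first by [].
  apply: (EvMono (t := 4)); last exact: leqnn.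
  have h : eval (if b then Seq pop (Seq pop (Push Io true)) else Push Io false)
    (main io ((if b then [:: false; false] else [::]) ++ code (enc y)))
    (main (b :: io) (code (enc y))) 3.
    case: b; last exact: EvMono (EvPush _ _ _) _.
    by apply: EvSeq (eval_pop1 _ _ _) (EvSeq (eval_pop1 _ _ _) (EvPush _ _ _)).
  by apply: EvCase; case: b h.
by rewrite /=; lia.
Qed.

Theorem PT_ptime (f : seq bool -> seq bool) : PT f ->
  exists (M : TM) (c k : nat), forall x : seq bool,
    let cf := exec (c * (size x).+1 ^ k) (init M x) in
    [/\ halted cf, output cf = f x & tm_accept (cf_state cf) = (ohead (f x) == Some true)].
Proof.
move=> hf; have hBf := PT_PB hf; case: hf => [c [T [hT h]]].
have hev x : eval (Seq load (Seq c store_loop)) (Store (rev x) [::] [::] [::] [::])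
    (main (rev (f x)) [::]) (7 * esz x + T x + 5 * esz (f x) + 6).
  apply: evalS (eval_load x) _ _; first apply: evalS _ _ (leqnn _).
  - by have := h x [::] [::]; rewrite !cats0; apply.
  - by rewrite /rev; apply: eval_store.
  - by have := size_esz Enc_bool x; have := size_esz Enc_bool (f x); lia.
have : PB (fun x => (7 * esz x + T x + 5 * esz (f x) + 6)
   * (10 * (esz x + (7 * esz x + T x + 5 * esz (f x) + 6)) + 20) + 3) by pb.
case=> C [k hC].
(* A bit costs at most 4 in the encoding of a list, so [(esz x).+1] is at most [5 * (size x).+1]. *)
exists (cmdTM (Seq load (Seq c store_loop))), (C * 5 ^ k), k => x.
apply: (cmdTM_correct (hev x)) => //.
apply: leq_trans (_ : C * (esz x).+1 ^ k <= _); last first.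
  rewrite -mulnA -expnMn leq_mul2l leq_exp ?orbT //.
  by elim: x => // b x IH; rewrite esz_cons /=; have := esz_bool b; lia.
apply: leq_trans (hC x); have := size_esz Enc_bool x; nia.
Qed.

Theorem PT_ptime_computable (f : seq bool -> seq bool) : PT f -> ptime_computable f.
Proof. by move=> /PT_ptime[M [c [k h]]]; exists M, c, k => x; have [] := h x. Qed.

(** The machine of [PT_ptime] accepts according to the first output bit, so it is run on the one-bit
    output [[:: f x]]. *)
Theorem PT_in_P (f : seq bool -> bool) : PT f -> in_P (fun x => f x).
Proof.
move=> hf.
have /PT_ptime[M [c [k h]]] : PT (fun x => [:: f x]).
  apply: PT_cast (PT_pair hf (PT_const ([::] : seq bool))) _ => a.
  by rewrite enc_pair.
exists M, c, k => x; have [h1 _ h3] := h x; split=> //.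
by rewrite h3 /=; split=> [/eqP[->]|->].
Qed.

Lemma PT_id A (EA : Enc A) : PT (fun a : A => a).
Proof. exact: PT_same. Qed.

Lemma PT_comp2 A B C D (EA : Enc A) (EB : Enc B) (EC : Enc C) (ED : Enc D)
    (F : B -> C -> D) (f : A -> B) (g : A -> C) :
  PT (fun p => F p.1 p.2) -> PT f -> PT g -> PT (fun a => F (f a) (g a)).
Proof. by move=> hF hf hg; apply: (PT_comp (g := fun p => F p.1 p.2)) hF (PT_pair hf hg). Qed.

Lemma PT_fst1 A B (EA : Enc A) (EB : Enc B) : PT (@fst A B).
Proof. exact: PT_fst (PT_id _). Qed.
Lemma PT_snd1 A B (EA : Enc A) (EB : Enc B) : PT (@snd A B).
Proof. exact: PT_snd (PT_id _). Qed.

(* A syntax-directed tactic for polynomial time *)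
Create HintDb ptdb.
#[global] Hint Resolve PT_fst1 PT_snd1 : ptdb.

(** A hook, redefined once the list combinators have been treated; these bind a variable and so
    escape the rules for plain application. *)
Ltac pt_list := fail.
Ltac pt1 := cbv beta; match goal with
  | h : PT ?f |- PT ?f => exact h
  | |- PT (fun x => x) => apply: PT_id
  | |- PT (fun _ => ?c) => apply: PT_const
  | |- PT (fun x => (@?f x, @?g x)) => apply: (PT_pair (f := f) (g := g))
  | |- PT (fun x => fst (@?f x)) => apply: (PT_fst (f := f))
  | |- PT (fun x => snd (@?f x)) => apply: (PT_snd (f := f))
  | |- PT _ => pt_list
  | |- PT _ => solve [auto with ptdb nocore]
  | |- PT (fun x => ?F (@?f x)) => apply: (PT_comp (g := F) (f := f)); [solve [auto with ptdb nocore]|]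
  | |- PT (fun x => ?F (@?f x) (@?g x)) =>
      apply: (PT_comp2 (F := F) (f := f) (g := g)); [solve [auto with ptdb nocore]| |]
  | |- PT ?F => lazymatch F with (fun x => _) => apply: PT_if | _ => change (PT (fun x => F x)) end
  end.
Ltac pt := repeat pt1.

(** * Folds and list functions *)

Section Lists.
Context {A X Y : Type} {EA : Enc A} {EX : Enc X} {EY : Enc Y}.

(** Growth by an amount independent of the accumulator adds up to a polynomial. It is measured by
    [mu] because for bit strings the length grows additively in a way that [esz], which depends on
    the bits themselves, need not. *)
Lemma PT_foldl_measure (mu : Y -> nat) C0 (step : A -> Y -> X -> Y) init l (G : A * X -> nat) :
  PT l -> PT init -> PT (fun q : X * (A * Y) => step q.2.1 q.2.2 q.1) -> PB G ->
  (forall s, esz s <= C0 * (mu s).+1) -> (forall s, mu s <= esz s) ->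
  (forall a s x, mu (step a s x) <= mu s + G (a, x)) ->
  PT (fun a => foldl (step a) (init a) (l a)).
Proof.
move=> hl hi hs [K [k hG]] hC hmu hle; have hBl := PT_PB hl; have hBi := PT_PB hi.
apply: (PT_foldl (B := fun a => C0 * (esz (init a) + esz (l a) * (K * (esz a + esz (l a) + 2) ^ k) + 1))) => //.
  by pb.
move=> a n; apply: leq_trans (hC _) _; apply: leq_mul => //; rewrite addn1 ltnS; set H := K * _.
have : forall w, esz w <= esz (l a) -> forall s n, mu (foldl (step a) s (take n w)) <= mu s + esz w * H.
  elim=> [|x w IH] le_w s [|m] //=; try by lia.
  rewrite esz_cons in le_w *.
  have hx : G (a, x) <= H.
    apply: leq_trans (hG _) _; rewrite /H; apply: leq_mul => //; apply: leq_exp.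
    by rewrite esz_pair; lia.
  have h1 := hle a s x; have [|] := leqP (esz w) (esz (l a)); last by lia.
  move=> le_w'; apply: leq_trans (IH le_w' _ _) _.
  have := esz_gt0 EX x; nia.
by move=> h; apply: leq_trans (h _ _ _ _) _; rewrite // leq_add2r.
Qed.

Lemma PT_foldl_PB (step : A -> Y -> X -> Y) init l (G : A * X -> nat) : PT l -> PT init ->
  PT (fun q : X * (A * Y) => step q.2.1 q.2.2 q.1) -> PB G ->
  (forall a s x, esz (step a s x) <= esz s + G (a, x)) ->
  PT (fun a => foldl (step a) (init a) (l a)).
Proof.
by move=> hl hi hs hG hle; apply: (PT_foldl_measure (mu := esz) (C0 := 1) _ _ _ hG) => // s; lia.
Qed.

End Lists.

Section Lists2.
Context {X : Type} {EX : Enc X}.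

Lemma PT_cons : PT (fun p : X * seq X => p.1 :: p.2).
Proof. by apply: PT_same. Qed.

Lemma catrevE_foldl (s t : seq X) : foldl (fun acc x => x :: acc) t s = catrev s t.
Proof. by elim: s t => //=. Qed.

Lemma PT_catrev : PT (fun p : seq X * seq X => catrev p.1 p.2).
Proof.
apply: (PT_ext (f := fun p => foldl (fun acc x => x :: acc) p.2 p.1));
  last by move=> p; apply: catrevE_foldl.
apply: (PT_foldl_PB (G := fun p : (seq X * seq X) * X => (esz p.2).+1)
  (step := fun _ acc x => x :: acc) (init := fun p => p.2) (l := fun p => p.1)); try by pt.
- by apply: (PT_comp2 (F := cons)); [apply: PT_cons|pt|pt].
- have h : PB (fun p : (seq X * seq X) * X => esz p.2) by apply: PT_PB; pt.
  by apply: PB_le (PB_add h (PB_const 1)) _ => a; lia.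
- by move=> a s x; rewrite esz_cons /=; lia.
Qed.

Lemma PT_rev : PT (@rev X).
Proof. by apply: (PT_comp2 (F := @catrev X)); [exact: PT_catrev|pt|pt]. Qed.

Lemma PT_cat : PT (fun p : seq X * seq X => p.1 ++ p.2).
Proof.
apply: (PT_ext (f := fun p => catrev (rev p.1) p.2)); last by move=> p; rewrite catrevE revK.
apply: (PT_comp2 (F := @catrev X)); [exact: PT_catrev| |pt].
by apply: (PT_comp PT_rev); pt.
Qed.

End Lists2.
#[global] Hint Resolve PT_rev : ptdb.
#[global] Hint Resolve PT_cons PT_cat PT_catrev : ptdb.

Section Map.
Context {A X Y : Type} {EA : Enc A} {EX : Enc X} {EY : Enc Y}.

Lemma PT_map (f : A -> X -> Y) l : PT l -> PT (fun p : A * X => f p.1 p.2) ->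
  PT (fun a => map (f a) (l a)).
Proof.
move=> hl hf; have hB := PT_PB hf.
have mapE a (s : seq X) t : foldl (fun acc x => f a x :: acc) t s = catrev (map (f a) s) t.
  by elim: s t => //=.
apply: (PT_ext (f := fun a => rev (foldl (fun acc x => f a x :: acc) [::] (l a)))).
  apply: (PT_comp PT_rev).
  apply: (PT_foldl_PB (G := fun p : A * X => (esz (f p.1 p.2)).+1) (step := fun a acc x => f a x :: acc)) => //.
  - by pt.
  - apply: (PT_comp2 (F := cons)); [pt| |pt].
    by apply: (PT_comp2 (F := f)); [pt|pt|pt].
  - by apply: PB_le (PB_add hB (PB_const 1)) _ => a; lia.
  - by move=> a s x; rewrite esz_cons /=; lia.
by move=> a; rewrite mapE catrevE cats0 revK.
Qed.

End Map.

Section Map2.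
Context {X : Type} {EX : Enc X}.

Lemma PT_behead : PT (@behead X).
Proof.
apply: PT_ext (PT_seq_case (PT_id _) (PT_const [::]) (_ : PT (fun p : seq X * (X * seq X) => p.2.2))) _.
  by pt.
by case.
Qed.

Lemma PT_nilp : PT (@nilp X).
Proof.
apply: PT_ext (PT_seq_case (PT_id _) (PT_const true) (PT_const false)) _.
by case.
Qed.

Lemma PT_head : PT (fun p : X * seq X => head p.1 p.2).
Proof.
apply: PT_ext (PT_seq_case (l := snd) (f := fst) (g := fun p : (X * seq X) * (X * seq X) => p.2.1) _ _ _) _.
- by pt. 
- by pt.
- by pt.
by case=> x [].
Qed.

Lemma PT_flatten : PT (@flatten X).
Proof.
have flE (s : seq (seq X)) t : foldl (fun acc x => acc ++ x) t s = t ++ flatten s.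
  by elim: s t => [|x s IH] t /=; rewrite ?cats0 // IH catA.
apply: (PT_ext (f := fun s => foldl (fun acc x => acc ++ x) [::] s)); last by move=> s; rewrite flE.
have hcat (s t : seq X) : esz (s ++ t) <= esz s + esz t.
  by elim: s => [|x s IH] /=; rewrite ?esz_cons; [apply: leq_addl|lia].
apply: (PT_foldl_PB (G := fun p : seq (seq X) * seq X => esz p.2) (step := fun _ acc x => acc ++ x)
  (init := fun=> [::]) (l := id)) => //; try by pt.
by apply: PT_PB; pt.
Qed.

End Map2.

Section Map3.
Context {A X : Type} {EA : Enc A} {EX : Enc X}.

Lemma PT_has (f : A -> X -> bool) l : PT l -> PT (fun p : A * X => f p.1 p.2) ->
  PT (fun a => has (f a) (l a)).
Proof.
move=> hl hf.
have hasE a (s : seq X) b : foldl (fun acc x => if f a x then true else acc) b s = has (f a) s || b.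
  by elim: s b => //= x s IH b; rewrite IH; case: (f a x); rewrite ?orbT.
apply: (PT_ext (f := fun a => foldl (fun acc x => if f a x then true else acc) false (l a)));
  last by move=> a; rewrite hasE orbF.
apply: (PT_foldl_PB (G := fun=> 3) (step := fun a acc x => if f a x then true else acc)) => //.
- by pt.
- apply: PT_if; [|pt|pt].
  by apply: (PT_comp2 (F := f)); [pt|pt|pt].
- exact: PB_const.
- by move=> a s x; case: ifP => _; [have := esz_bool true|]; lia.
Qed.

End Map3.

Lemma PT_negb : PT negb.
Proof. by apply: (PT_ext (f := fun b => if b then false else true)); [pt|case]. Qed.
Lemma PT_andb : PT (fun p => p.1 && p.2).
Proof. by pt. Qed.
Lemma PT_orb : PT (fun p => p.1 || p.2).
Proof. by pt. Qed.

Lemma PT_filter A X (EA : Enc A) (EX : Enc X) (f : A -> X -> bool) l :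
  PT l -> PT (fun p : A * X => f p.1 p.2) ->
  PT (fun a => filter (f a) (l a)).
Proof.
move=> hl hf.
apply: (PT_ext (f := fun a => flatten (map (fun x => if f a x then [:: x] else [::]) (l a)))).
  apply: (PT_comp PT_flatten); apply: PT_map => //; apply: PT_if => //; last by pt.
  by apply: (PT_comp2 (F := cons)); [exact: PT_cons|pt|pt].
by move=> a; elim: (l a) => //= x s ->; case: ifP.
Qed.

#[global] Hint Resolve PT_behead PT_nilp PT_head PT_flatten PT_negb PT_andb PT_orb : ptdb.

Lemma PT_all A X (EA : Enc A) (EX : Enc X) (f : A -> X -> bool) l :
  PT l -> PT (fun p : A * X => f p.1 p.2) ->
  PT (fun a => all (f a) (l a)).
Proof.
move=> hl hf.
apply: (PT_ext (f := fun a => ~~ has (fun x => ~~ f a x) (l a))).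
  by apply: (PT_comp PT_negb); apply: PT_has => //; apply: (PT_comp PT_negb).
by move=> a; rewrite -all_predC; apply: eq_all => x /=; rewrite negbK.
Qed.

Ltac pt_list ::= match goal with
  | |- PT (fun x => map (@?f x) (@?l x)) => apply: (PT_map (f := f) (l := l))
  | |- PT (fun x => filter (@?f x) (@?l x)) => apply: (PT_filter (f := f) (l := l))
  | |- PT (fun x => has (@?f x) (@?l x)) => apply: (PT_has (f := f) (l := l))
  | |- PT (fun x => all (@?f x) (@?l x)) => apply: (PT_all (f := f) (l := l))
  end.

(* A natural number is encoded as the list of that many units. *)
Lemma enc_nseq n : enc (nseq n tt) = enc n.
Proof. by elim: n => // n IH; rewrite [nseq _ _]/= enc_cons IH. Qed.

Lemma PT_to_units : PT (fun n => nseq n tt).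
Proof. by apply: PT_same => n; rewrite enc_nseq. Qed.

Lemma PT_of_units : PT (fun s : seq unit => size s).
Proof. by apply: PT_same => s; rewrite -enc_nseq; congr enc; elim: s => //= -[] s <-. Qed.

Lemma PT_size X (EX : Enc X) : PT (@size X).
Proof.
apply: (PT_ext (f := fun s => size (map (fun=> tt) s))); last by move=> s; rewrite size_map.
by apply: (PT_comp PT_of_units); pt.
Qed.

Lemma PT_succ : PT S.
Proof.
apply: (PT_ext (f := fun n => size (tt :: nseq n tt))); last by move=> n /=; rewrite size_nseq.
by apply: (PT_comp PT_of_units); apply: (PT_comp2 (F := cons)); [pt|pt|exact: PT_to_units].
Qed.

Lemma PT_pred : PT predn.
Proof.
apply: (PT_ext (f := fun n => size (behead (nseq n tt)))).
  by apply: (PT_comp PT_of_units); apply: (PT_comp PT_behead); apply: PT_to_units.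
by case=> //= n; rewrite size_nseq.
Qed.

Lemma PT_add : PT (fun p => p.1 + p.2).
Proof.
apply: (PT_ext (f := fun p => size (nseq p.1 tt ++ nseq p.2 tt)));
  last by move=> p; rewrite size_cat !size_nseq.
apply: (PT_comp PT_of_units); apply: (PT_comp2 (F := cat)); first by pt.
  by apply: (PT_comp PT_to_units); pt.
by apply: (PT_comp PT_to_units); pt.
Qed.
#[global] Hint Resolve PT_size PT_succ PT_pred PT_add : ptdb.

Lemma PT_mul : PT (fun p => p.1 * p.2).
Proof.
apply: (PT_ext (f := fun p => size (flatten (map (fun=> nseq p.2 tt) (nseq p.1 tt))))).
  apply: (PT_comp PT_of_units); apply: (PT_comp PT_flatten); pt.
    by apply: (PT_comp PT_to_units); pt.
  by apply: (PT_comp PT_to_units); pt.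
by move=> [m n]; elim: m => //= m IH; rewrite size_cat IH size_nseq mulSn.
Qed.
#[global] Hint Resolve PT_mul : ptdb.

Lemma PT_expn A (EA : Enc A) (f : A -> nat) k : PT f -> PT (fun a => f a ^ k).
Proof.
move=> hf; elim: k => [|k IH]; first exact: PT_const.
by apply: (PT_ext (f := fun a => f a * f a ^ k)) => [|a]; [pt|rewrite expnS].
Qed.

Section Iter.
Context {A X : Type} {EA : Enc A} {EX : Enc X}.

Lemma iter_foldl (f : X -> X) n s : foldl (fun s (_ : unit) => f s) s (nseq n tt) = iter n f s.
Proof. by elim: n s => //= n IH s; rewrite IH -iterSr. Qed.

Lemma PT_iter (B : A -> nat) (f : A -> X -> X) (n : A -> nat) (s : A -> X) :
  PT (fun p : A * X => f p.1 p.2) -> PT n -> PT s -> PB B ->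
  (forall a j, j <= n a -> esz (iter j (f a) (s a)) <= B a) -> PT (fun a => iter (n a) (f a) (s a)).
Proof.
move=> hf hn hs hB h.
apply: (PT_ext (f := fun a => foldl (fun s (_ : unit) => f a s) (s a) (nseq (n a) tt)));
  last by move=> a; apply: iter_foldl.
apply: (PT_foldl (B := B) (step := fun a s (_ : unit) => f a s)) => //.
- by apply: (PT_comp PT_to_units).
- by apply: (PT_comp2 (F := f)); pt.
- move=> a j; have -> : take j (nseq (n a) tt) = nseq (minn j (n a)) tt.
    by elim: (n a) j => [|m IH] [|j] //=; rewrite IH minnSS.
  by rewrite iter_foldl; apply: h; apply: geq_minr.
Qed.

(** The number of rounds is unary, hence polynomial, and each adds at most [G a]. *)
Lemma PT_iter_grow (G : A -> nat) (f : A -> X -> X) (n : A -> nat) (s : A -> X) :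
  PT (fun p : A * X => f p.1 p.2) -> PT n -> PT s -> PB G ->
  (forall a x, esz (f a x) <= esz x + G a) -> PT (fun a => iter (n a) (f a) (s a)).
Proof.
move=> hf hn hs hG h; have hBs := PT_PB hs; have hBn := PT_PB hn.
apply: (PT_iter (B := fun a => esz (s a) + esz (n a) * G a)) => //; first by pb.
move=> a j; rewrite esz_nat => le_j.
apply: (leq_trans (n := esz (s a) + j * G a)); last by nia.
elim: j {le_j} => [|j IH] //=; first by lia.
by apply: leq_trans (h _ _) _; rewrite mulSn; lia.
Qed.

End Iter.

Lemma PT_subn : PT (fun p => p.1 - p.2).
Proof.
apply: (PT_ext (f := fun p => iter p.2 predn p.1)).
  apply: (PT_iter_grow (G := fun=> 0) (f := fun _ => predn)); try by pt.
    exact: PB_const.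
  by move=> _ x; rewrite !esz_nat; lia.
by move=> [m n] /=; elim: n => [|n IH] /=; rewrite ?subn0 // IH; lia.
Qed.
#[global] Hint Resolve PT_subn : ptdb.

Lemma PT_leq : PT (fun p => p.1 <= p.2).
Proof.
apply: (PT_ext (f := fun p => nilp (nseq (p.1 - p.2) tt))).
  by apply: (PT_comp PT_nilp); apply: (PT_comp PT_to_units); pt.
by move=> [m n] /=; rewrite /nilp size_nseq.
Qed.
#[global] Hint Resolve PT_leq : ptdb.

Lemma PT_eqn : PT (fun p : nat * nat => p.1 == p.2).
Proof. by apply: (PT_ext (f := fun p => (p.1 <= p.2) && (p.2 <= p.1))) => [|p]; [pt|rewrite eqn_leq]. Qed.
Lemma PT_eqb : PT (fun p : bool * bool => p.1 == p.2).
Proof. by apply: (PT_ext (f := fun p => if p.1 then p.2 else ~~ p.2)); [pt|case=> [[] []]]. Qed.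

Lemma PT_iota0 : PT (iota 0).
Proof.
have E j : iter j (fun s => 0 :: map S s) [::] = iota 0 j.
  elim: j => //= j ->; congr (_ :: _); rewrite -[1]/(1 + 0) iotaDl.
  by apply: eq_map.
apply: (PT_ext (f := fun j => iter j (fun s => 0 :: map S s) [::])); last exact: E.
apply: (PT_iter (f := fun _ s => 0 :: map S s) (n := id) (s := fun=> [::])
  (B := fun n : nat => esz n * (2 * esz n + 5) + 1)); try by pt.
  by pb.
move=> n j; rewrite E => le_j.
have esz_iota m : forall i, esz (iota i m) <= m * (2 * (i + m) + 2) + 1.
  by elim: m => //= m IH i; rewrite esz_cons esz_nat; have := IH i.+1; lia.
by apply: leq_trans (esz_iota _ _) _; rewrite esz_nat; nia.
Qed.
#[global] Hint Resolve PT_iota0 PT_eqn PT_eqb : ptdb.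

Lemma PT_iota : PT (fun p => iota p.1 p.2).
Proof.
apply: (PT_ext (f := fun p => map (addn p.1) (iota 0 p.2))).
  apply: (PT_map (f := fun p => addn p.1)); first by pt.
  by apply: (PT_comp2 (F := addn)); pt.
by move=> [m n] /=; rewrite -iotaDl addn0.
Qed.

Lemma PT_nseq X (EX : Enc X) : PT (fun p : nat * X => nseq p.1 p.2).
Proof.
apply: (PT_ext (f := fun p : nat * X => map (fun=> p.2) (nseq p.1 tt))).
  by apply: PT_map; [apply: (PT_comp PT_to_units)|]; pt.
by move=> [n x] /=; elim: n => //= n ->.
Qed.

#[global] Hint Resolve PT_iota PT_nseq : ptdb.

Lemma PT_zip X Y (EX : Enc X) (EY : Enc Y) : PT (fun p : seq X * seq Y => zip p.1 p.2).
Proof.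
pose step (q : seq (X * Y) * seq Y) (x : X) :=
  if q.2 is y :: r then ((x, y) :: q.1, r) else (q.1, [::]).
have zipE (s : seq X) (t : seq Y) acc : rev (foldl step (acc, t) s).1 = rev acc ++ zip s t.
  elim: s t acc => [|x s IH] [|y t] acc; rewrite /= ?cats0 //.
    by rewrite [LHS]IH /=; case: (s); rewrite cats0.
  by rewrite [LHS]IH /= rev_cons cat_rcons.
apply: (PT_ext (f := fun p : seq X * seq Y => rev (foldl step ([::], p.2) p.1).1));
  last by move=> p; rewrite zipE.
apply: (PT_comp PT_rev); apply: PT_fst.
apply: (PT_foldl_PB (A := (seq X * seq Y)%type) (step := fun=> step)
  (G := fun p : (seq X * seq Y) * X => esz p.2 + 2)); try by pt.
- apply: (PT_seq_case (l := fun q : X * ((seq X * seq Y) * (seq (X * Y) * seq Y)) => q.2.2.2)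
   (f := fun q : X * ((seq X * seq Y) * (seq (X * Y) * seq Y)) => (q.2.2.1, [::]))
   (g := fun q : (X * ((seq X * seq Y) * (seq (X * Y) * seq Y))) * (Y * seq Y) =>
      ((q.1.1, q.2.1) :: q.1.2.2.1, q.2.2))); by pt.
- by apply: PB_add; [apply: PT_PB; pt|apply: PB_const].
- by move=> p [acc [|y t]] x; rewrite /step !esz_pair /= ?esz_cons ?esz_pair; lia.
Qed.
#[global] Hint Resolve PT_zip : ptdb.

Lemma PT_eqseq (X : eqType) (EX : Enc X) : PT (fun p : X * X => p.1 == p.2) ->
  PT (fun p : seq X * seq X => p.1 == p.2).
Proof.
move=> h; apply: (PT_ext (f := fun p : seq X * seq X => (size p.1 == size p.2) &&
   all (fun q => q.1 == q.2) (zip p.1 p.2))).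
  apply: (PT_comp2 (F := andb)); [pt| |].
    by apply: (PT_comp2 (F := eq_op : rel nat)); pt.
  by apply: PT_all; [pt|apply: (PT_comp2 (F := eq_op : rel X)); pt].
move=> [s t] /=; elim: s t => [|x s IH] [|y t] //=.
by rewrite eqseq_cons -IH eqSS andbCA.
Qed.

Lemma PT_eqpair (X Y : eqType) (EX : Enc X) (EY : Enc Y) :
  PT (fun p : X * X => p.1 == p.2) -> PT (fun p : Y * Y => p.1 == p.2) ->
  PT (fun p : (X * Y) * (X * Y) => p.1 == p.2).
Proof.
move=> hX hY; apply: (PT_ext (f := fun p : (X * Y) * (X * Y) =>
   (p.1.1 == p.2.1) && (p.1.2 == p.2.2))); last by move=> [[? ?] [? ?]].
apply: (PT_comp2 (F := andb)); first by pt.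
  by apply: (PT_comp2 (F := eq_op : rel X)); pt.
by apply: (PT_comp2 (F := eq_op : rel Y)); pt.
Qed.

(** Membership in the shape to which [PT_has] applies. *)
Definition memb (X : eqType) (x : X) (s : seq X) := has (fun y => x == y) s.

Lemma membE (X : eqType) (x : X) s : memb x s = (x \in s).
Proof. by elim: s => //= y s; rewrite in_cons => <-. Qed.

Lemma PT_memb (X : eqType) (EX : Enc X) : PT (fun p : X * X => p.1 == p.2) ->
  PT (fun p : X * seq X => memb p.1 p.2).
Proof. by move=> h; apply: PT_has; [pt|apply: (PT_comp2 (F := eq_op : rel X)); pt]. Qed.
#[global] Hint Resolve PT_memb : ptdb.
#[global] Hint Extern 1 (PT (fun p => @eq_op _ (fst p) (snd p))) =>
  first [apply: PT_eqseq | apply: PT_eqpair] : ptdb.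

Lemma PT_foldr A X Y (EA : Enc A) (EX : Enc X) (EY : Enc Y)
    (mu : Y -> nat) C0 (step : A -> X -> Y -> Y) init l (G : A * X -> nat) :
  PT l -> PT init -> PT (fun q : X * (A * Y) => step q.2.1 q.1 q.2.2) -> PB G ->
  (forall s, esz s <= C0 * (mu s).+1) -> (forall s, mu s <= esz s) ->
  (forall a s x, mu (step a x s) <= mu s + G (a, x)) ->
  PT (fun a => foldr (step a) (init a) (l a)).
Proof.
move=> hl hi hs hG h1 h2 h3.
apply: (PT_ext (f := fun a => foldl (fun y x => step a x y) (init a) (rev (l a)))).
  by apply: (PT_foldl_measure (mu := mu) (C0 := C0) (step := fun a y x => step a x y) (G := G)) => //; pt.
by move=> a; rewrite foldl_rev.
Qed.

(** * Binary arithmetic *)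

Notation bits := (seq bool).

Section Binary.

(* Binary numbers are written with the least significant bit first. *)
Definition bval (b : bits) : nat := foldr (fun (x : bool) n => x + n.*2) 0 b.
Definition trim (b : bits) : bits :=
  foldr (fun x (acc : bits) => if ~~ x && nilp acc then [::] else x :: acc) [::] b.
(** The most significant bit is [true]; the default makes the empty list, which stands for zero,
    canonical. These are exactly the values of [bin]. *)
Definition canon (b : bits) := last true b.

Lemma bval_trim b : bval (trim b) = bval b.
Proof. by elim: b => //= -[] b IH /=; rewrite -?IH //; case: (trim b). Qed.

Lemma canon_cons x b : canon (x :: b) = if nilp b then x else canon b.
Proof. by case: b. Qed.

Lemma canon_trim b : canon (trim b).
Proof.
elim: b => //= x b IH; case: ifP => // h; rewrite canon_cons.
by move: h IH; case: (trim b); case: x.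
Qed.

Lemma bval_bound b : bval b < 2 ^ size b.
Proof. by elim: b => //= -[] b IH; rewrite expnS; lia. Qed.

Lemma canon_bound b : canon b -> b != [::] -> 2 ^ (size b).-1 <= bval b.
Proof.
elim: b => // x b IH; rewrite canon_cons; case: b IH => [|y b] IH; first by case: x.
by move=> h _; have := IH h isT; rewrite /= expnS; lia.
Qed.

Lemma canon_size b k : canon b -> bval b < 2 ^ k -> size b <= k.
Proof.
move=> hc hb; case: b hc hb => // x b hc hb.
have := leq_ltn_trans (canon_bound hc isT) hb.
by rewrite ltn_exp2l.
Qed.

Lemma bval_inj a b : canon a -> canon b -> bval a = bval b -> a = b.
Proof.
elim: a b => [|x a IH] [|y b] // ca cb.
- by have := canon_bound cb isT; rewrite /= => h e; move: h; rewrite -e; have := expn_gt0 2 (size b); lia.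
- by have := canon_bound ca isT; rewrite /= => h e; move: h; rewrite e; have := expn_gt0 2 (size a); lia.
rewrite /= => e; have exy : x = y by case: x y e {ca cb} => [] []; lia.
rewrite exy (IH b) //; last by subst y; lia.
  by move: ca; rewrite canon_cons; case: a {IH e}.
by move: cb; rewrite canon_cons; case: b {e}.
Qed.

Lemma bin_auxE f n : n <= f -> canon (bin_aux f n) /\ bval (bin_aux f n) = n.
Proof.
elim: f n => [|f IH] [|n] le_n //.
have [|h1 h2] := IH n.+1./2; first by lia.
have -> : bin_aux f.+1 n.+1 = odd n.+1 :: bin_aux f n.+1./2 by []. split.
  rewrite canon_cons; case: ifP => // /nilP h; move: h2; rewrite h /=; lia.
by rewrite /= h2 /=; lia.
Qed.

Lemma canon_bin n : canon (bin n). Proof. by have [] := bin_auxE (leqnn n). Qed.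
Lemma bval_bin n : bval (bin n) = n. Proof. by have [] := bin_auxE (leqnn n). Qed.
Lemma bin_bval b : canon b -> bin (bval b) = b.
Proof. by move=> h; apply: bval_inj; rewrite ?canon_bin ?bval_bin. Qed.

(** Padding to the sum of the lengths makes them equal without computing a maximum. *)
Definition pad (a b : bits) : seq (bool * bool) :=
  zip (a ++ nseq (size b) false) (b ++ nseq (size a) false).

Definition addstep (q : bool * bits) (xy : bool * bool) : bool * bits :=
  (if xy.1 then xy.2 || q.1 else xy.2 && q.1, (xy.1 (+) xy.2 (+) q.1) :: q.2).

Definition badd (a b : bits) : bits :=
  let q := foldl addstep (false, [::]) (pad a b) in trim (rev (q.1 :: q.2)).

(** The least significant bits come first, so a later difference overrules the verdict so far. *)
Definition lestep (r : bool) (xy : bool * bool) := if xy.1 == xy.2 then r else xy.2.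
Definition ble (a b : bits) : bool := foldl lestep true (pad a b).

Definition bmul (a b : bits) : bits :=
  foldr (fun x acc => badd (false :: acc) (if x then b else [::])) [::] a.

Lemma bval_cat a b : bval (a ++ b) = bval a + 2 ^ size a * bval b.
Proof. by elim: a => [|x a IH] /=; rewrite ?mul1n // IH expnS; lia. Qed.

Lemma bval_zeros n : bval (nseq n false) = 0.
Proof. by elim: n => //= n ->. Qed.

Lemma pad_unzip a b : [/\ bval (unzip1 (pad a b)) = bval a, bval (unzip2 (pad a b)) = bval b
  & size (pad a b) = size a + size b].
Proof.
rewrite /pad unzip1_zip ?unzip2_zip ?size_zip ?size_cat ?size_nseq ?bval_cat ?bval_zeros ?muln0 ?addn0;
  try by rewrite addnC.
by split=> //; lia.
Qed.

(** Invariant of the schoolbook addition: the finished digits are in [acc], reversed, and the carry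
    has weight [2 ^ size acc]. *)
Lemma foldl_add z c acc : let q := foldl addstep (c, acc) z in
  bval (rev (q.1 :: q.2)) = bval (rev acc) + 2 ^ size acc * (c + bval (unzip1 z) + bval (unzip2 z))
  /\ size q.2 = size acc + size z.
Proof.
elim: z c acc => [|[x y] z IH] c acc /=.
  by split; [rewrite rev_cons -cats1 bval_cat size_rev /=|]; lia.
have [e1 e2] := IH (if x then y || c else y && c) ((x (+) y (+) c) :: acc).
split; last by rewrite e2 /= addSnnS.
rewrite e1 rev_cons -cats1 bval_cat size_rev /= expnS.
by clear e1 e2; case: x; case: y; case: c => /=; lia.
Qed.

Lemma bval_badd a b : bval (badd a b) = bval a + bval b.
Proof.
rewrite /badd bval_trim; have [-> _] := foldl_add (pad a b) false [::].
by have [-> -> _] := pad_unzip a b; rewrite mul1n.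
Qed.

Lemma canon_badd a b : canon (badd a b). Proof. exact: canon_trim. Qed.

(** Length is bounded through the value: a canonical string of value below [2 ^ k] has at most [k]
    bits. *)
Lemma size_badd a b : size (badd a b) <= (maxn (size a) (size b)).+1.
Proof.
apply: canon_size (canon_badd _ _) _; rewrite bval_badd expnS.
have h := bval_bound; have := h a; have := h b.
have := leq_pexp2l (isT : 0 < 2) (leq_maxl (size a) (size b)).
have := leq_pexp2l (isT : 0 < 2) (leq_maxr (size a) (size b)).
lia.
Qed.

Lemma bval_bmul a b : bval (bmul a b) = bval a * bval b.
Proof. by elim: a => //= x a IH; rewrite bval_badd /= IH; case: x => /=; nia. Qed.

Lemma canon_bmul a b : canon (bmul a b).
Proof. by case: a => //= *; apply: canon_badd. Qed.

Lemma size_bmul a b : size (bmul a b) <= size a + size b.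
Proof.
apply: canon_size (canon_bmul _ _) _; rewrite bval_bmul expnD.
by have := bval_bound a; have := bval_bound b; nia.
Qed.

(** A negative verdict on the lower bits acts as a borrow of one, which is the summand [~~ r]. *)
Lemma ble_foldl z r : foldl lestep r z =
  (bval (unzip1 z) + ~~ r <= bval (unzip2 z)) :> bool.
Proof.
elim: z r => [|[x y] z IH] r /=; first by case: r.
by rewrite IH /lestep /=; case: x; case: y; case: r => /=; lia.
Qed.

Lemma bleE a b : ble a b = (bval a <= bval b).
Proof. by rewrite /ble ble_foldl addn0; have [-> ->] := pad_unzip a b. Qed.

Lemma size_bits_esz (b : bits) : size b <= esz b.
Proof. exact: ltnW (size_esz _ _). Qed.

Lemma esz_bits (b : bits) : esz b <= 4 * (size b).+1.
Proof. by elim: b => // x b IH; rewrite esz_cons /=; have := esz_bool x; lia. Qed.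

Lemma PT_addb : PT (fun p => p.1 (+) p.2).
Proof. by apply: (PT_ext (f := fun p => if p.1 then ~~ p.2 else p.2)); [pt|case=> [[] []]]. Qed.
Local Hint Resolve PT_addb : ptdb.

Lemma PT_trim : PT trim.
Proof.
apply: (PT_foldr (A := bits) (mu := size) (C0 := 4)
  (step := fun _ x (acc : bits) => if ~~ x && nilp acc then [::] else x :: acc) (G := fun=> 1)); try by pt.
- exact: PB_const.
- exact: esz_bits.
- exact: size_bits_esz.
- by move=> a s x; case: ifP => _ /=; lia.
Qed.
Local Hint Resolve PT_trim : ptdb.

Lemma PT_pad : PT (fun p : bits * bits => pad p.1 p.2).
Proof. by rewrite /pad; pt. Qed.
Local Hint Resolve PT_pad : ptdb.

Lemma PT_badd : PT (fun p => badd p.1 p.2).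
Proof.
rewrite /badd; apply: (PT_comp PT_trim); apply: (PT_comp PT_rev).
have h : PT (fun p : bits * bits => foldl addstep (false, [::]) (pad p.1 p.2)).
  apply: (PT_foldl_PB (A := (bits * bits)%type) (step := fun=> addstep) (G := fun=> 10)); try by pt.
  - by rewrite /addstep; pt.
  - exact: PB_const.
  - move=> p [c acc] [x y]; rewrite /addstep /= !esz_pair esz_cons.
    have := esz_bool (x (+) y (+) c); have := esz_bool (if x then y || c else y && c).
    by have := esz_gt0 Enc_bool c; lia.
by apply: (PT_comp2 (F := cons)); pt.
Qed.
Local Hint Resolve PT_badd : ptdb.

Lemma PT_ble : PT (fun p => ble p.1 p.2).
Proof.
apply: (PT_foldl_PB (A := (bits * bits)%type) (step := fun=> lestep) (G := fun=> 10)); try by pt.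
- rewrite /lestep; pt.
- exact: PB_const.
- by move=> p r [x y]; have := esz_bool (lestep r (x, y)); lia.
Qed.

Lemma PT_bmul : PT (fun p => bmul p.1 p.2).
Proof.
apply: (PT_foldr (A := (bits * bits)%type) (mu := size) (C0 := 4)
  (step := fun p x acc => badd (false :: acc) (if x then p.2 else [::]))
  (init := fun=> [::]) (G := fun p : (bits * bits) * bool => esz p.1 + 3)); try by pt.
- by apply: PB_add; [apply: PT_PB; pt|apply: PB_const].
- exact: esz_bits.
- exact: size_bits_esz.
- move=> [a b] s x; apply: leq_trans (size_badd _ _) _; rewrite esz_pair.
  by have := size_bits_esz b; case: x => /=; lia.
Qed.

Definition inc (b : bits) := badd b [:: true].
(** The argument is unary, so counting up to it with binary increments takes polynomial time. *)
Lemma PT_bin : PT bin.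
Proof.
have E n : iter n inc [::] = bin n.
  elim: n => //= n ->; apply: bval_inj; rewrite ?canon_bin ?canon_badd //.
  by rewrite bval_badd !bval_bin /=; lia.
apply: (PT_ext (f := fun n => iter n inc [::])); last exact: E.
apply: (PT_iter (A := nat) (f := fun=> inc) (n := id) (s := fun=> [::]) (B := fun n : nat => 4 * (esz n + 1))).
- by rewrite /inc; pt.
- by pt.
- by pt.
- by pb.
move=> n j le_j; apply: leq_trans (esz_bits _) _; rewrite leq_mul2l addn1 ltnS /= E.
apply: canon_size (canon_bin _) _; rewrite bval_bin esz_nat.
have : j < 2 ^ j by apply: ltn_expl.
by have := leq_pexp2l (isT : 0 < 2) (_ : j <= (2 * n).+1); lia.
Qed.

End Binary.
#[global] Hint Resolve PT_addb PT_trim PT_badd PT_ble PT_bmul PT_bin : ptdb.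

(** * Separating an input from its certificate *)

Section Unpair.

(* The state is (separator seen, pending first copy of a bit, reversed x, reversed w). *)
Definition upstep (q : bool * (bits * (bits * bits))) (b : bool) : bool * (bits * (bits * bits)) :=
  if q.1 then (true, (q.2.1, (q.2.2.1, b :: q.2.2.2)))
  else if nilp q.2.1 then (false, ([:: b], q.2.2))
  else if head false q.2.1 == b then (false, ([::], (b :: q.2.2.1, q.2.2.2)))
  else (true, ([::], q.2.2)).

Definition unpair (z : bits) : bits * bits :=
  let q := foldl upstep (false, ([::], ([::], [::]))) z in (rev q.2.2.1, rev q.2.2.2).

Lemma unpairK x w : unpair (pair_enc x w) = (x, w).
Proof.
rewrite /unpair /pair_enc foldl_cat.
have -> acc : foldl upstep (false, ([::], (acc, [::]))) (flatten [seq [:: b; b] | b <- x]) =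
    (false, ([::], (catrev x acc, [::]))).
  by elim: x acc => //= b x IH acc; rewrite -IH; case: b.
rewrite catrevE cats0.
have tail acc : foldl upstep (true, ([::], (rev x, acc))) w = (true, ([::], (rev x, catrev w acc))).
  by elim: w acc => //= b w IH acc; rewrite IH.
by rewrite /= tail /= !revK.
Qed.

Lemma PT_unpair : PT unpair.
Proof.
have h : PT (fun z : bits => foldl upstep (false, ([::], ([::], [::]))) z).
  apply: (PT_foldl_PB (A := bits) (Y := (bool * (bits * (bits * bits)))%type)
    (step := fun=> upstep) (l := id) (init := fun=> (false, ([::], ([::], [::]))))
    (G := fun=> 30)).
  - by pt.
  - by pt.
  - by rewrite /upstep; pt.
  - exact: PB_const.
  - move=> a [d [p [xs ws]]] b; rewrite /upstep !esz_pair /=.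
    have := esz_bool b; have := esz_gt0 Enc_bool d; have := esz_bool true; have := esz_bool false.
    have := esz_gt0 _ (p : bits).
    by case: d; last case: (nilp p); last case: eqP => _; rewrite !esz_pair ?esz_cons -?[esz [::]]/1; lia.
by rewrite /unpair; pt.
Qed.

End Unpair.

(** * Parsing and decoding of trees *)

Section Trees.

Lemma PT_Node : PT (fun p : tree * tree => Node p.1 p.2).
Proof. exact: PT_same. Qed.

(** A tree and the list of trees along its right spine have the same encoding, so taking trees apart
    reduces to list operations. *)
Fixpoint as_seq (t : tree) : seq tree := if t is Node a b then a :: as_seq b else [::].
Definition of_seq (s : seq tree) : tree := enc s.

Lemma PT_as_seq : PT as_seq.
Proof. by apply: PT_same; elim=> // a _ b IH; rewrite [RHS]enc_cons -IH. Qed.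
Lemma PT_of_seq : PT of_seq.
Proof. exact: PT_same. Qed.
Lemma of_seqK t : of_seq (as_seq t) = t.
Proof. by elim: t => // a _ b IH; rewrite [LHS]enc_cons -/(of_seq _) IH. Qed.
Local Hint Resolve PT_Node PT_as_seq PT_of_seq : ptdb.

Definition tfst t := head Leaf (as_seq t).
Definition tsnd t := of_seq (behead (as_seq t)).

(* Read from right to left, prefix code is postfix notation. *)
Definition parse_step (b : bool) (s : seq tree) : seq tree :=
  if b then Node (head Leaf s) (head Leaf (behead s)) :: behead (behead s) else Leaf :: s.
Definition parse (w : bits) : tree := head Leaf (foldr parse_step [::] w).

Lemma foldr_parse t m s : foldr parse_step s (code t ++ m) = t :: foldr parse_step s m.
Proof. by elim: t m => // a IHa b IHb m; rewrite /= -catA IHa IHb. Qed.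

Lemma parseK t : parse (code t) = t.
Proof. by rewrite /parse -[code t]cats0 foldr_parse. Qed.

Lemma PT_parse : PT parse.
Proof.
rewrite /parse.
have h : PT (fun w : bits => foldr parse_step [::] w).
  apply: (PT_foldr (A := bits) (X := bool) (Y := seq tree) (mu := esz) (C0 := 1)
    (step := fun=> parse_step) (l := id) (init := fun=> [::]) (G := fun=> 10)).
  - by pt.
  - by pt.
  - by rewrite /parse_step; pt.
  - exact: PB_const.
  - by move=> s; lia.
  - by [].
  - have e1 : esz Leaf = 1 by []. have e2 : esz ([::] : seq tree) = 1 by [].
    have eN a b : esz (Node a b) = (esz a + esz b).+1 by apply: tsize_node.
    move=> w0 [|t [|u s]] []; rewrite /parse_step /= !esz_cons ?eN; lia.
by pt.
Qed.

(** The decoders are total: a malformed certificate decodes to some witness, and only that witness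
    is then checked. *)
Definition dbool (t : tree) : bool := ~~ nilp (as_seq t).
Definition dbits (t : tree) : bits := map dbool (as_seq t).

Lemma dboolK b : dbool (enc b) = b. Proof. by case: b. Qed.
Lemma dseqK A (EA : Enc A) (d : tree -> A) (s : seq A) : cancel enc d -> map d (as_seq (enc s)) = s.
Proof. by move=> h; elim: s => //= a s {2}<-; rewrite h. Qed.
Lemma dbitsK (b : bits) : dbits (enc b) = b.
Proof. exact: dseqK dboolK. Qed.
Lemma tfstK A B (EA : Enc A) (EB : Enc B) (p : A * B) : tfst (enc p) = enc p.1.
Proof. by []. Qed.
Lemma tsndK A B (EA : Enc A) (EB : Enc B) (p : A * B) : tsnd (enc p) = enc p.2.
Proof. exact: of_seqK. Qed.

Lemma PT_tfst : PT tfst. Proof. by rewrite /tfst; pt. Qed.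
Lemma PT_tsnd : PT tsnd. Proof. by rewrite /tsnd; pt. Qed.
Lemma PT_dbits : PT dbits. Proof. by rewrite /dbits /dbool; pt. Qed.

End Trees.
#[global] Hint Resolve PT_Node PT_as_seq PT_of_seq PT_tfst PT_tsnd PT_dbits PT_parse PT_unpair : ptdb.

(** * Printing instances from bit strings *)

Section Printing.

Definition tk (t : token) : bits := token_bits t.
Definition eBits (b : bits) : bits := flatten (map (fun x : bool => if x then tk Tk1 else tk Tk0) b).
Definition eNat (b : bits) : bits := tk TkOpen ++ eBits b ++ tk TkClose.
(** Only nonnegative integers are printed, whence the fixed sign bit [Tk0]. *)
Definition eInt (b : bits) : bits := tk TkOpen ++ tk Tk0 ++ tk TkComma ++ eNat b ++ tk TkClose.
Definition eRat (q : bits * bits) : bits :=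
  tk TkOpen ++ eInt q.1 ++ tk TkComma ++ eInt q.2 ++ tk TkClose.
Definition eList (A : Type) (f : A -> bits) (s : seq A) : bits :=
  tk TkOpen ++ flatten (map (fun x => f x ++ tk TkComma) s) ++ tk TkClose.

Definition eInst (d : seq bits * (seq (bits * bits) * (seq bits * (seq (seq bits) * (bits * bits))))) : bits :=
  tk TkOpen ++ eList eNat d.1 ++ eList eRat d.2.1 ++ eList eNat d.2.2.1
    ++ eList (eList eNat) d.2.2.2.1 ++ eRat d.2.2.2.2 ++ tk TkClose.

Lemma PT_eList A (EA : Enc A) (f : A -> bits) : PT f -> PT (eList f).
Proof. by move=> h; rewrite /eList; pt. Qed.
Local Hint Resolve PT_eList : ptdb.
Lemma PT_eBits : PT eBits. Proof. by rewrite /eBits; pt. Qed.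
Local Hint Resolve PT_eBits : ptdb.
Lemma PT_eNat : PT eNat. Proof. by rewrite /eNat; pt. Qed.
Local Hint Resolve PT_eNat : ptdb.
Lemma PT_eInt : PT eInt. Proof. by rewrite /eInt; pt. Qed.
Local Hint Resolve PT_eInt : ptdb.
Lemma PT_eRat : PT eRat. Proof. by rewrite /eRat; pt. Qed.
Local Hint Resolve PT_eRat : ptdb.
Lemma PT_eInst : PT eInst. Proof. by rewrite /eInst; pt. Qed.

Definition ratbits (q : rat) : bits * bits := (bin `|numq q|, bin `|denq q|).

Let bt (s : seq token) : bits := flatten (map token_bits s).

Let btcat s t : bt (s ++ t) = bt s ++ bt t.
Proof. by rewrite /bt map_cat flatten_cat. Qed.

Let btcons a s : bt (a :: s) = tk a ++ bt s. Proof. by []. Qed.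

Lemma btBits b : bt (enc_bits b) = eBits b.
Proof. by rewrite /bt /enc_bits -map_comp; congr flatten; apply: eq_map => -[]. Qed.

Lemma btNat n : bt (enc_nat n) = eNat (bin n).
Proof. by rewrite /enc_nat btcons btcat btBits. Qed.

Lemma btInt z : (0 <= z)%R -> bt (enc_int z) = eInt (bin `|z|).
Proof.
move=> h; rewrite /enc_int btcons btcat btcons btcat btNat.
by have -> : (z < 0)%R = false by lia.
Qed.

Lemma btRat q : (0 <= q)%R -> bt (enc_rat q) = eRat (ratbits q).
Proof.
move=> h; rewrite /enc_rat btcons btcat btcons btcat !btInt ?denq_ge0 ?numq_ge0 //.
Qed.

Lemma btList (A B : Type) (f : A -> seq token) (g : A -> B) (h : B -> bits) s :
  (forall x, bt (f x) = h (g x)) -> bt (enc_list f s) = eList h (map g s).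
Proof.
move=> fgh; rewrite /enc_list btcons btcat /eList; congr (_ ++ (_ ++ _)).
by elim: s => //= x s IH; rewrite btcat btcat fgh IH.
Qed.

Lemma btList_in (A : eqType) (B : Type) (f : A -> seq token) (g : A -> B) (h : B -> bits) s :
  {in s, forall x, bt (f x) = h (g x)} -> bt (enc_list f s) = eList h (map g s).
Proof.
move=> fgh; rewrite /enc_list btcons btcat /eList; congr (_ ++ (_ ++ _)).
elim: s fgh => //= x s IH fgh; rewrite btcat btcat fgh ?mem_head // IH // => y ys.
by apply: fgh; rewrite in_cons ys orbT.
Qed.

Lemma encode_instanceE I : all (fun q => 0 <= q)%R (ip_pi I) -> (0 <= ip_p I)%R ->
  encode_instance I = eInst (map bin (iota 0 (size (ip_pi I))), (map ratbits (ip_pi I),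
    (map bin (ip_E I), (map (map bin) (ip_F I), ratbits (ip_p I))))).
Proof.
move=> /allP hpi hp; rewrite /encode_instance -/(bt _) /enc_instance btcons !btcat.
rewrite (btList _ btNat) (btList _ btNat) btRat //.
rewrite (btList_in (g := ratbits) (h := eRat)); last by move=> q /hpi; apply: btRat.
by rewrite (btList (g := map bin) (h := eList eNat)) // => F; apply: btList; apply: btNat.
Qed.

End Printing.
#[global] Hint Resolve PT_eList PT_eBits PT_eNat PT_eInt PT_eRat PT_eInst : ptdb.

(** * The verifier *)

Notation frac := (bits * bits)%type.

(** Denominators are multiplied and nothing is cancelled, so no gcd is computed; lengths then grow
    only additively along the sum. *)
Definition fstep (ab nd : frac) : frac :=
  (badd (bmul ab.1 nd.2) (bmul nd.1 ab.2), bmul ab.2 nd.2).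
Definition fsum (s : seq frac) : frac := foldl fstep ([::], [:: true]) s.

Definition fval (q : frac) : rat := (bval q.1)%:Q / (bval q.2)%:Q.

Lemma fsum_foldl s ab : all (fun q => bval q.2 != 0) s -> bval ab.2 != 0 ->
  bval (foldl fstep ab s).2 != 0 /\
  fval (foldl fstep ab s) = (fval ab + \sum_(q <- s) fval q)%R.
Proof.
elim: s ab => [|q s IH] ab /=; first by rewrite big_nil addr0.
move=> /andP[hq hs] hab.
have hab' : bval (fstep ab q).2 != 0 by rewrite /= bval_bmul muln_eq0 negb_or hab.
have [h1 h2] := IH _ hs hab'; split=> //; rewrite h2 big_cons addrA; congr (_ + _)%R.
rewrite /fval /= bval_badd !bval_bmul !PoszD !PoszM !rmorphD !rmorphM /=.
by field; rewrite !pnatr_eq0 hq hab.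
Qed.

Lemma fsumE s : all (fun q => bval q.2 != 0) s ->
  bval (fsum s).2 != 0 /\ fval (fsum s) = (\sum_(q <- s) fval q)%R.
Proof.
move=> h; have [|h1 h2] := fsum_foldl (ab := ([::], [:: true])) h; first by [].
by split=> //; rewrite h2 /fval /= mul0r add0r.
Qed.

Lemma canon_fsum s : canon (fsum s).1 /\ canon (fsum s).2.
Proof.
rewrite /fsum; have : canon ([::] : bits) /\ canon [:: true] by [].
elim: s ([::] : bits) [:: true] => //= q s IH a b _.
by apply: IH; rewrite canon_badd canon_bmul.
Qed.

Lemma PT_fsum : PT fsum.
Proof.
apply: (PT_foldl_measure (A := seq frac) (X := frac) (Y := frac)
  (mu := fun q : frac => maxn (size q.1) (size q.2)) (C0 := 9)
  (step := fun=> fstep) (G := fun p : seq frac * frac => esz p.2 + 1)).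
- by pt.
- by pt.
- by rewrite /fstep; pt.
- by apply: PB_add; [apply: PT_PB; pt|apply: PB_const].
- by move=> [a b]; rewrite esz_pair; have := esz_bits a; have := esz_bits b; rewrite /=; lia.
- by move=> [a b]; rewrite esz_pair; have := size_bits_esz a; have := size_bits_esz b; rewrite /=; lia.
- move=> w [a b] [n d]; rewrite /= esz_pair.
  have := size_bits_esz n; have := size_bits_esz d.
  have := size_badd (bmul a d) (bmul n b).
  by have := size_bmul a d; have := size_bmul n b; have := size_bmul b d; lia.
Qed.
#[global] Hint Resolve PT_fsum : ptdb.

Lemma PT_mask X (EX : Enc X) : PT (fun p : bits * seq X => mask p.1 p.2).
Proof.
apply: (PT_ext (f := fun p : bits * seq X => map snd (filter fst (zip p.1 p.2)))); first by pt.
move=> [m s] /=; elim: m s => [|b m IH] [|x s] //=; rewrite ?mask0 //.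
by case: b; rewrite /= IH.
Qed.
#[global] Hint Resolve PT_mask : ptdb.

(* A certified fraction ((n, d), (u, v)) comes with d * v = n * u + 1, so that n and d are coprime. *)
Notation cfrac := (frac * frac)%type.

Definition okfrac (q : cfrac) : bool :=
  [&& canon q.1.1, canon q.1.2 & bmul q.1.2 q.2.2 == badd (bmul q.1.1 q.2.1) [:: true]].

(* Point probabilities, E, the facts, and the threshold with the mask of the reported facts. *)
Notation witness := (seq cfrac * (seq bits * (seq (seq bits) * (cfrac * bits))))%type.

Definition wpoints (W : witness) : seq bits := map bin (iota 0 (size W.1)).
Definition wdata (W : witness) :=
  (wpoints W, (map fst W.1, (W.2.1, (W.2.2.1, W.2.2.2.1.1)))).
(** [fsum] returns canonical bit strings, so the total is 1 exactly if numerator and denominator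
    coincide as strings. Membership in [wpoints] also forces the points in E and in the facts to be
    written canonically. *)
Definition wvalid (W : witness) : bool :=
  [&& all okfrac W.1, okfrac W.2.2.2.1,
      (fsum (map fst W.1)).1 == (fsum (map fst W.1)).2,
      all (fun b => memb b (wpoints W)) W.2.1,
      all (fun F => all (fun b => memb b (wpoints W)) F) W.2.2.1,
      ~~ nilp W.2.2.2.1.1.1 & ble W.2.2.2.1.1.1 W.2.2.2.1.1.2].
Definition winter (W : witness) : seq (bits * frac) :=
  filter (fun wq => all (fun F => memb wq.1 F) (mask W.2.2.2.2 W.2.2.1))
    (zip (wpoints W) (map fst W.1)).
(** The inequality between fractions with all denominators cleared. As [P.1] is canonical, it is
    nonempty exactly if the probability is positive. *)
Definition wanswer (W : witness) : bool :=
  let P := fsum (map snd (winter W)) in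
  let PE := fsum (map snd (filter (fun wq => memb wq.1 W.2.1) (winter W))) in
  ~~ nilp P.1 && ble (bmul W.2.2.2.1.1.1 (bmul P.1 PE.2)) (bmul W.2.2.2.1.1.2 (bmul PE.1 P.2)).

Definition dpair A B (d1 : tree -> A) (d2 : tree -> B) t := (d1 (tfst t), d2 (tsnd t)).
Definition dseq A (d : tree -> A) t := map d (as_seq t).
Definition dcfrac := dpair (dpair dbits dbits) (dpair dbits dbits).
Definition dwitness : tree -> witness :=
  dpair (dseq dcfrac) (dpair (dseq dbits) (dpair (dseq (dseq dbits)) (dpair dcfrac dbits))).

Lemma dpairK A B (EA : Enc A) (EB : Enc B) (d1 : tree -> A) (d2 : tree -> B) :
  cancel enc d1 -> cancel enc d2 -> cancel enc (dpair d1 d2).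
Proof. by move=> h1 h2 [a b]; rewrite /dpair tfstK tsndK h1 h2. Qed.

Lemma dwitnessK : cancel enc dwitness.
Proof.
have hb : cancel (enc : bits -> tree) dbits := dbitsK.
have hf : cancel (enc : frac -> tree) (dpair dbits dbits) by apply: dpairK.
have hc : cancel (enc : cfrac -> tree) dcfrac by apply: dpairK.
have hs A (EA : Enc A) (d : tree -> A) : cancel enc d -> cancel enc (dseq d) by move=> h s; apply: dseqK.
apply: dpairK; first exact: hs hc.
apply: dpairK; first exact: hs hb.
apply: dpairK; first exact: hs (hs _ _ _ hb).
exact: dpairK.
Qed.

Lemma PT_dpair A B (EA : Enc A) (EB : Enc B) (d1 : tree -> A) (d2 : tree -> B) :
  PT d1 -> PT d2 -> PT (dpair d1 d2).
Proof. by move=> h1 h2; rewrite /dpair; pt. Qed.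
Lemma PT_dseq A (EA : Enc A) (d : tree -> A) : PT d -> PT (dseq d).
Proof. by move=> h; rewrite /dseq; pt. Qed.

Lemma PT_dwitness : PT dwitness.
Proof.
have h := PT_dbits; have hc : PT dcfrac by do ?[apply: PT_dpair].
by apply: PT_dpair; [apply: PT_dseq|apply: PT_dpair; [apply: PT_dseq|apply: PT_dpair;
  [do 2!apply: PT_dseq|apply: PT_dpair]]].
Qed.
#[global] Hint Resolve PT_dwitness : ptdb.

Definition verify (z : bits) : bool :=
  let W := dwitness (parse (unpair z).2) in
  [&& wvalid W, wanswer W & eInst (wdata W) == (unpair z).1].

Lemma PT_wpoints : PT wpoints. Proof. by rewrite /wpoints; pt. Qed.
#[local] Hint Resolve PT_wpoints : ptdb.
Lemma PT_okfrac : PT okfrac.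
Proof.
have hc : PT canon.
  apply: (PT_ext (f := fun b : bits => head true (rev b))); first by pt.
  by move=> b; rewrite /canon; case/lastP: b => // b x; rewrite rev_rcons last_rcons.
by rewrite /okfrac; pt.
Qed.
#[local] Hint Resolve PT_okfrac : ptdb.
Lemma PT_wvalid : PT wvalid. Proof. by rewrite /wvalid; pt. Qed.
Lemma PT_wdata : PT wdata. Proof. by rewrite /wdata; pt. Qed.
Lemma PT_winter : PT winter. Proof. by rewrite /winter; pt. Qed.
#[local] Hint Resolve PT_wvalid PT_wdata PT_winter : ptdb.
Lemma PT_wanswer : PT wanswer. Proof. by rewrite /wanswer; pt. Qed.
#[local] Hint Resolve PT_wanswer : ptdb.
Lemma PT_verify : PT verify.
Proof. by rewrite /verify; pt. Qed.

Definition winst (W : witness) : ip_instance :=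
  IPInstance (map fval (map fst W.1)) (map bval W.2.1) (map (map bval) W.2.2.1) (fval W.2.2.2.1.1).

Lemma fval_ge0 q : (0 <= fval q)%R.
Proof. by rewrite /fval divr_ge0 // ler0z. Qed.

Lemma okfrac_den q : okfrac q -> bval q.1.2 != 0.
Proof.
case/and3P=> _ _ /eqP/(congr1 bval); rewrite bval_badd !bval_bmul /=.
by case: (bval q.1.2) => //=; lia.
Qed.

Lemma okfrac_coprime q : okfrac q -> coprime (bval q.1.1) (bval q.1.2).
Proof.
move=> h; have d0 := okfrac_den h; case/and3P: h => _ _ /eqP/(congr1 bval).
rewrite bval_badd !bval_bmul /= => e.
rewrite coprime_sym; apply/coprimeP; first by lia.
by exists (bval q.2.2, bval q.2.1); rewrite /= mulnC e; lia.
Qed.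

Lemma ratbits_fval q : okfrac q -> ratbits (fval q.1) = q.1.
Proof.
move=> h; have d0 := okfrac_den h; have cp := okfrac_coprime h.
case/and3P: h => c1 c2 _.
rewrite /ratbits /fval coprimeq_num // coprimeq_den // eqz_nat (negPf d0) /=.
rewrite gtr0_sg; last by lia.
by rewrite mul1r /= !bin_bval // -surjective_pairing.
Qed.

Section Instance.
Variable W : witness.
Hypothesis W_ok : wvalid W.

Let fr := map fst W.1.

Lemma wpointsP b : memb b (wpoints W) -> canon b /\ bval b < size W.1.
Proof.
by rewrite membE => /mapP[i]; rewrite mem_iota => i_lt ->; rewrite canon_bin bval_bin; lia.
Qed.

Lemma wpoints_canon s : all (fun b => memb b (wpoints W)) s -> map bin (map bval s) = s.
Proof.
by move/allP=> h; rewrite -map_comp -[RHS]map_id; apply/eq_in_map => b /h/wpointsP[c _]; apply: bin_bval.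
Qed.

Lemma wpoints_lt s : all (fun b => memb b (wpoints W)) s -> all (fun w => w < size W.1) (map bval s).
Proof. by move/allP=> h; rewrite all_map; apply/allP => b /h/wpointsP[]. Qed.

Lemma fr_den s : {subset s <= fr} -> all (fun q : frac => bval q.2 != 0) s.
Proof.
move=> hs; apply/allP => q /hs/mapP[c cW ->]; apply: okfrac_den.
by case/and5P: W_ok => /allP h _ _ _ _; apply: h.
Qed.

Lemma winst_encode : all (fun q => 0 <= q)%R (ip_pi (winst W)) ->
  encode_instance (winst W) = eInst (wdata W).
Proof.
move=> h0; rewrite encode_instanceE //; last exact: fval_ge0.
case/and5P: W_ok => /allP h1 h2 _ h3 /and3P[/allP h4 _ _]; congr eInst.
rewrite /wdata /wpoints /= !size_map wpoints_canon // ratbits_fval //; congr (_, (_, (_, (_, _)))).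
  rewrite -map_comp -map_comp; apply/eq_in_map => q qW /=; apply: ratbits_fval; exact: h1.
by rewrite -map_comp -[RHS]map_id; apply/eq_in_map => F /h4; apply: wpoints_canon.
Qed.

Lemma winst_valid : ip_valid (winst W).
Proof.
case/and5P: (W_ok) => h1 h2 /eqP h3 h4 /and3P[/allP h5 h6 h7]; split=> /=.
- by rewrite all_map; apply/allP => q _; apply: fval_ge0.
- rewrite big_map; have [d0 <-] := fsumE (fr_den (fun q h => h)).
  by rewrite /fval h3 divff // intr_eq0.
- by rewrite !size_map; apply: wpoints_lt.
- by rewrite !size_map all_map; apply/allP => F /h5; apply: wpoints_lt.
- have d0 := okfrac_den h2; rewrite bleE in h7.
  have n0 : bval W.2.2.2.1.1.1 != 0.
    case/and3P: h2 => c _ _; move: c h6; case e : W.2.2.2.1.1.1 => [//|x b] c _.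
    by have := canon_bound c isT; have := expn_gt0 2 (size (x :: b)).-1; lia.
  rewrite /fval divr_gt0 ?ltr0z ?ltz_nat ?lt0n //=.
  by rewrite ler_pdivrMr ?mul1r ?ltr0z ?ltz_nat ?lt0n // ler_int.
Qed.

(** Translates sums over the filtered list of numbered probabilities, as the verifier forms them,
    into sums over sample points. *)
Lemma sum_filter (A : pred nat) (B : bits * frac -> bool) :
  (forall w q, w < size fr -> B (bin w, q) = A w) ->
  (\sum_(q <- map snd (filter B (zip (wpoints W) fr))) fval q = ip_prob (winst W) A)%R.
Proof.
move=> hB; rewrite big_map big_filter /ip_prob /=.
have sz : size (wpoints W) = size fr by rewrite /wpoints !size_map size_iota.
rewrite (big_nth ([::], ([::], [::]))) size_zip sz minnn big_mkord size_map.
apply: eq_big => i; have lt_i : i < size fr by case: i => i; rewrite /= size_map.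
  have lt_i' : i < size W.1 by apply: leq_trans lt_i _; rewrite size_map.
  by rewrite nth_zip // (nth_map 0) ?size_iota // nth_iota // hB.
by rewrite nth_zip //= (nth_map ([::], [::])).
Qed.

Lemma wanswerE : let I := winst W in let R := mask W.2.2.2.2 (ip_F I) in
  wanswer W = (0 < ip_prob I (ip_inter R))%R &&
   (ip_p I <= ip_prob I (fun w => (w \in ip_E I) && ip_inter R w) / ip_prob I (ip_inter R))%R.
Proof.
move=> I R; case/and5P: (W_ok) => h1 h2 _ h4 /and3P[/allP h5 _ _].
have memE w F : w < size fr -> all (fun b => memb b (wpoints W)) F ->
    memb (bin w) F = (w \in map bval F).
  move=> _ hF; rewrite membE; apply/idP/mapP => [h|[b bF ->]];
    first by exists (bin w); rewrite ?bval_bin.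
  by rewrite bin_bval //; have /wpointsP[] := allP hF b bF.
have interE w : w < size fr -> all (fun F => memb (bin w) F) (mask W.2.2.2.2 W.2.2.1) = ip_inter R w.
  move=> lt_w; rewrite /ip_inter /R /= -map_mask all_map; apply: eq_in_all => F /mem_mask FW /=.
  by apply: memE => //; apply: h5.
have P_E := sum_filter (B := fun wq => all (fun F => memb wq.1 F) (mask W.2.2.2.2 W.2.2.1))
  (fun w q => @interE w).
have PE_E : (\sum_(q <- map snd (filter (fun wq => memb wq.1 W.2.1) (winter W))) fval q =
   ip_prob I (fun w => (w \in ip_E I) && ip_inter R w))%R.
  rewrite /winter -filter_predI; apply: sum_filter => w q lt_w /=.
  by rewrite memE // interE.
have den (B : bits * frac -> bool) :
    all (fun q : frac => bval q.2 != 0) (map snd (filter B (zip (wpoints W) fr))).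
  apply: fr_den => q /mapP[[b c]]; rewrite mem_filter => /andP[_ h] ->.
  have sz : size (wpoints W) = size fr by rewrite /wpoints !size_map size_iota.
  by rewrite -[fr](unzip2_zip (s := wpoints W)) ?sz //; apply: map_f.
have [dP eP] := fsumE (den (fun wq => all (fun F => memb wq.1 F) (mask W.2.2.2.2 W.2.2.1))).
rewrite -/fr -/(winter W) in dP eP.
have [dPE ePE] : bval (fsum (map snd (filter (fun wq => memb wq.1 W.2.1) (winter W)))).2 != 0 /\
   fval (fsum (map snd (filter (fun wq => memb wq.1 W.2.1) (winter W)))) =
   ip_prob I (fun w => (w \in ip_E I) && ip_inter R w).
  by rewrite -PE_E; apply: fsumE; rewrite /winter -filter_predI; apply: den.
rewrite -ePE -P_E -[zip _ _]/(zip (wpoints W) fr) -/(winter W) -eP /wanswer.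
have [c1 _] := canon_fsum (map snd (winter W)).
set P := fsum _ in dP dPE ePE c1 *; set PE := fsum _ in dP dPE ePE *.
have nilE : nilp P.1 = (bval P.1 == 0).
  move: c1; case: P.1 => [//|x b] c; have := canon_bound c isT.
  by have := expn_gt0 2 (size (x :: b)).-1; case: (bval _) => //; lia.
have d0 := okfrac_den h2.
rewrite nilE bleE !bval_bmul; case: (posnP (bval P.1)) => [e0|n0].
  by rewrite /fval e0 rmorph0 mul0r ltxx.
rewrite /=.
have P0 : (0 < fval P)%R by rewrite /fval divr_gt0 // ltr0z ltz_nat ?lt0n // -lt0n.
rewrite P0 /= ler_pdivlMr // /fval mulrACA.
rewrite -invfM ler_pdivrMr ?mulr_gt0 ?ltr0z ?ltz_nat ?lt0n //.
rewrite mulrAC ler_pdivlMr ?ltr0z ?ltz_nat ?lt0n //.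
rewrite -!intrM ler_int -!PoszM lez_nat mulnA.
by congr (_ <= _); apply: mulnCA.
Qed.

End Instance.

Theorem verify_sound z : verify z -> InformationalPersuasion (unpair z).1.
Proof.
rewrite /verify; set W := dwitness _ => /and3P[h1 h2 /eqP h3].
have hv := winst_valid h1; exists (winst W); split=> //; split.
  by rewrite winst_encode //; case: hv.
exists W.2.2.2.2; move: h2; rewrite wanswerE //.
by case/andP.
Qed.

(** * Certificates of instances and their size *)

Definition certify (q : rat) : cfrac :=
  (ratbits q, (bin (egcdn `|denq q| `|numq q|).2, bin (egcdn `|denq q| `|numq q|).1)).

Lemma fval_ratbits q : (0 <= q)%R -> fval (ratbits q) = q.
Proof.
move=> h; rewrite /fval /ratbits /= !bval_bin -[RHS]divq_num_den.
by rewrite !gez0_abs ?numq_ge0 ?denq_ge0.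
Qed.

(** The denominator is the first argument of [egcdn]: it is positive, as [egcdnP] requires, and the
    Bezout identity then has the sign that [okfrac] tests, even for numerator 0. *)
Lemma okfrac_certify q : okfrac (certify q).
Proof.
rewrite /okfrac /= !canon_bin /=; apply/eqP/bval_inj; rewrite ?canon_badd ?canon_bmul //.
rewrite bval_badd !bval_bmul !bval_bin.
have d0 : 0 < `|denq q| by rewrite absz_gt0 denq_neq0.
have cp := coprime_num_den q.
case: egcdnP => // km kn e _ /=; rewrite mulnC e; congr (_ + _); first exact: mulnC.
by apply/eqP; rewrite -/(coprime _ _) coprime_sym.
Qed.

(** The mask in [ip_yes] may be arbitrarily long; it is cut to the number of facts to bound the
    certificate. *)
Definition wit_of (I : ip_instance) (m : bits) : witness :=
  (map certify (ip_pi I), (map bin (ip_E I), (map (map bin) (ip_F I),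
    (certify (ip_p I), take (size (ip_F I)) m)))).

Lemma winst_wit_of I m : all (fun q => 0 <= q)%R (ip_pi I) -> (0 <= ip_p I)%R ->
  winst (wit_of I m) = I.
Proof.
case: I => pi E F p /= /allP hpi hp; rewrite /winst /wit_of /=; congr IPInstance.
- rewrite -!map_comp -[RHS]map_id; apply/eq_in_map => q /hpi h /=; exact: fval_ratbits.
- by rewrite -map_comp -[RHS]map_id; apply: eq_map => n /=; rewrite bval_bin.
- rewrite -map_comp -[RHS]map_id; apply: eq_map => s /=.
  by rewrite -map_comp -[RHS]map_id; apply: eq_map => n /=; rewrite bval_bin.
- exact: fval_ratbits.
Qed.

Lemma wvalid_wit_of I m : ip_valid I -> wvalid (wit_of I m).
Proof.
move=> [h1 h2 h3 h4 /andP[h5 h6]].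
have hall : all okfrac (wit_of I m).1 by rewrite /= all_map; apply/allP => q _; apply: okfrac_certify.
have ptsE s : all (fun w => w < size (ip_pi I)) s ->
    all (fun b => memb b (wpoints (wit_of I m))) (map bin s).
  move/allP=> h; rewrite all_map; apply/allP => w /h lt_w /=.
  by rewrite membE map_f // mem_iota size_map.
apply/and5P; split=> //.
- exact: okfrac_certify.
- have den : all (fun q : frac => bval q.2 != 0) (map fst (wit_of I m).1).
    rewrite all_map; apply/allP => q qW; apply: okfrac_den; exact: (allP hall).
  have [d0 e] := fsumE den; have [c1 c2] := canon_fsum (map fst (wit_of I m).1).
  apply/eqP/bval_inj => //.
  have : fval (fsum (map fst (wit_of I m).1)) = 1%R.
    by rewrite e -[RHS]h2 -[in RHS](winst_wit_of m h1 (ltW h5)) /= !big_map.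
  move/(congr1 (fun r => r * (bval (fsum (map fst (wit_of I m).1)).2)%:Q)%R).
  rewrite /fval divfK ?intr_eq0 // mul1r => /eqP; rewrite eqr_int => /eqP; by case.
- exact: ptsE.
- apply/and3P; split.
  + by rewrite /= all_map; apply/allP => s /(allP h4); apply: ptsE.
  + rewrite /= /nilp; case e : (bin _) => //; have := congr1 bval e; rewrite bval_bin /= => /eqP.
    by rewrite absz_eq0 numq_eq0 gt_eqF.
  + rewrite bleE /= !bval_bin.
    rewrite -[ip_p I]divq_num_den ler_pdivrMr ?ltr0z ?denq_gt0 // mul1r ler_int in h6.
    have := numq_ge0 (ip_p I); rewrite (ltW h5); have := denq_ge0 (ip_p I); lia.
Qed.

Lemma verify_complete I m : ip_valid I ->
  (let R := mask m (ip_F I) in (0 < ip_prob I (ip_inter R))%R /\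
    (ip_p I <= ip_prob I (fun w => (w \in ip_E I) && ip_inter R w) / ip_prob I (ip_inter R))%R) ->
  verify (pair_enc (encode_instance I) (code (enc (wit_of I m)))).
Proof.
move=> hv hy; have hw := wvalid_wit_of m hv.
case: (hv) => h1 _ _ _ /andP[/ltW h5 _].
rewrite /verify unpairK parseK dwitnessK hw wanswerE // winst_wit_of //=.
have -> : mask (take (size (ip_F I)) m) (ip_F I) = mask m (ip_F I).
  by elim: (ip_F I) m {hy hw} => [|F s IH] [|b m] //=; rewrite ?mask0 // IH.
case: hy => -> -> /=; rewrite -winst_encode // winst_wit_of //.
Qed.

Lemma size_eBits b : size (eBits b) = 3 * size b.
Proof. by elim: b => //= x b IH; rewrite /eBits /= size_cat -/(eBits b) IH; case: x => /=; lia. Qed.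

Lemma size_eNat b : size (eNat b) = 3 * size b + 6.
Proof. by rewrite /eNat !size_cat size_eBits /=; lia. Qed.

Lemma size_eRat q : size (eRat q) = 3 * (size q.1 + size q.2) + 45.
Proof. by rewrite /eRat /eInt /eNat !size_cat !size_eBits /=; lia. Qed.

Lemma esz_eNat b : esz b <= 4 * size (eNat b).
Proof. by have := esz_bits b; rewrite size_eNat; lia. Qed.

(** The Bezout numbers are small: [u] is less than the denominator d, and [v * d = u * n + 1] then
    bounds [v] by [n + 1]. So they are about as long as the fraction itself. *)
Lemma esz_certify q : esz (certify q) <= 4 * size (eRat (ratbits q)).
Proof.
rewrite size_eRat /certify /ratbits !esz_pair /=.
set n := `|numq q|; set d := `|denq q|.
have d0 : 0 < d by rewrite absz_gt0 denq_neq0.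
have cp : gcdn d n = 1 by apply/eqP; rewrite -/(coprime _ _) coprime_sym; exact: coprime_num_den.
case: egcdnP => // v u; rewrite cp muln1 => e lt_u /=.
have hd := bval_bound (bin d); have hn := bval_bound (bin n); rewrite !bval_bin in hd hn.
have hu : size (bin u) <= size (bin d).
  by apply: canon_size (canon_bin _) _; rewrite bval_bin; lia.
have hv : size (bin v) <= (size (bin n)).+1.
  apply: canon_size (canon_bin _) _; rewrite bval_bin expnS.
  have : v <= n.+1 by nia.
  lia.
have := esz_bits (bin n); have := esz_bits (bin d).
have := esz_bits (bin u); have := esz_bits (bin v); lia.
Qed.

Lemma esz_eList (A : eqType) B (C : Type) (EB : Enc B) (g : A -> B) (h : C -> bits) (f : A -> C) s :
  {in s, forall x, esz (g x) <= 4 * size (h (f x))} -> esz (map g s) <= 4 * size (eList h (map f s)).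
Proof.
rewrite /eList !size_cat; elim: s => //= x s IH hs; rewrite esz_cons !size_cat /=.
have h1 := hs x (mem_head _ _).
have := IH (fun y ys => hs y (mem_behead (s := x :: s) ys)); rewrite /=; lia.
Qed.

Lemma size_eInst d : size (eInst d) = size (eList eNat d.1) + size (eList eRat d.2.1)
  + size (eList eNat d.2.2.1) + size (eList (eList eNat) d.2.2.2.1) + size (eRat d.2.2.2.2) + 6.
Proof.
have sc (a b c e f g h : bits) : size (a ++ b ++ c ++ e ++ f ++ g ++ h) =
    size b + size c + size e + size f + size g + (size a + size h) by rewrite !size_cat; lia.
exact: sc.
Qed.

(** Each listed component is charged to its own printed form; the mask, which is not printed, is
    charged to the list of facts. *)
Lemma size_wit_of I m : ip_valid I -> esz (wit_of I m) <= 20 * (size (encode_instance I)).+1.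
Proof.
move=> [h1 _ _ _ /andP[/ltW h5 _]]; rewrite encode_instanceE //.
have hN (s : seq nat) : esz (map bin s) <= 4 * size (eList eNat (map bin s)).
  by apply: esz_eList => n _; apply: esz_eNat.
have H1 : esz (map certify (ip_pi I)) <= 4 * size (eList eRat (map ratbits (ip_pi I))).
  by apply: esz_eList => q _; apply: esz_certify.
have H2 := hN (ip_E I).
have H3 : esz (map (map bin) (ip_F I)) <= 4 * size (eList (eList eNat) (map (map bin) (ip_F I))).
  by apply: esz_eList => s _; apply: hN.
have H4 := esz_certify (ip_p I).
have H5 : esz (take (size (ip_F I)) m) <= 4 * (size (ip_F I)).+1.
  by apply: leq_trans (esz_bits _) _; rewrite leq_mul2l ltnS size_take_min geq_minl.
have H6 : size (ip_F I) <= size (eList (eList eNat) (map (map bin) (ip_F I))).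
  rewrite /eList !size_cat; elim: (ip_F I) => //= s F IH; rewrite !size_cat /=; lia.
rewrite /wit_of 4!esz_pair size_eInst; cbn [fst snd]; lia.
Qed.

Theorem IP_in_NP : in_NP InformationalPersuasion.
Proof.
exists (fun z => verify z); split; first exact: PT_in_P PT_verify.
exists 20, 1 => x; split=> [[I [hv [-> [m hy]]]]|[w [_ hw]]].
  exists (code (enc (wit_of I m))); split; last exact: verify_complete.
  by rewrite expn1; apply: size_wit_of.
by have := verify_sound hw; rewrite unpairK.
Qed.

(** * From constraint satisfaction to persuasion *)

Section Reduction.
Variable C : eqType.
Implicit Type l : (C * nat)%type.
Variables (cells : seq C) (s : nat) (cons : seq (seq (C * nat))).

Definition csp_lits : seq (C * nat) := flatten [seq [seq (c, a) | a <- iota 0 s] | c <- cells].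
Definition csp_clauses : seq (seq (C * nat)) :=
  [seq [seq (c, a) | a <- iota 0 s] | c <- cells] ++ cons.
(* The sample points, each given by the list of the facts that it is missing from. *)
Definition csp_killers : seq (seq (C * nat)) :=
  [seq [:: l] | l <- csp_lits] ++ [::] :: csp_clauses ++ csp_clauses.
Definition csp_fact l : seq nat :=
  [seq wK.1 | wK <- zip (iota 0 (size csp_killers)) csp_killers & ~~ memb l wK.2].
(** The number of points of E that survive when exactly one fact per cell is reported. *)
Definition csp_goal := size cells * s.-1.
Definition csp_instance : ip_instance :=
  IPInstance (nseq (size csp_killers) (1 / (size csp_killers)%:Q)%R) (iota 0 (size csp_lits))
    (map csp_fact csp_lits) (csp_goal%:Q / csp_goal.+1%:Q)%R.

Definition csp_sat := exists v : C -> nat, {in cells, forall c, v c < s} /\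
  {in cons, forall cl, has (fun l => v l.1 == l.2) cl}.

Let N := size csp_killers.

Lemma N_gt0 : 0 < N.
Proof. by rewrite /N /csp_killers size_cat /= addnS. Qed.

Lemma size_lits : size csp_lits = size cells * s.
Proof. by rewrite size_flatten /shape -map_comp; elim: cells => //= c cs ->; rewrite size_map size_iota. Qed.

Lemma mem_lits l : (l \in csp_lits) = (l.1 \in cells) && (l.2 < s).
Proof.
case: l => c a /=; apply/flattenP/andP => [[_ /mapP[c' c'_in ->] /mapP[a' + [-> ->]]]|[c_in a_lt]].
  by rewrite mem_iota.
exists [seq (c, a) | a <- iota 0 s]; first exact: map_f.
by apply: map_f; rewrite mem_iota.
Qed.

Lemma uniq_lits : uniq cells -> uniq csp_lits.
Proof.
rewrite /csp_lits; elim: cells => //= c cs IH /andP[c_notin /IH u]; rewrite cat_uniq u.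
rewrite map_inj_uniq ?iota_uniq ?andbT /=; last by move=> a b [].
apply/hasPn => -[c' a'] /flattenP[_ /mapP[c'' c''_in ->] /mapP[a'' _ [-> _]]].
by apply/mapP => -[a _ [e _]]; rewrite -e c''_in in c_notin.
Qed.

Lemma mem_fact l w : w < N -> (w \in csp_fact l) = ~~ memb l (nth [::] csp_killers w).
Proof.
move=> lt_w; have sz : size (iota 0 N) = size csp_killers by rewrite size_iota.
apply/mapP/idP => [[[w' K]]|h].
  rewrite mem_filter => /andP[/= hK /(nthP (0, [::]))[j]].
  rewrite size_zip sz minnn => lt_j; rewrite nth_zip // nth_iota // => -[e1 e2] e3.
  by rewrite e3 -e1 e2.
exists (w, nth [::] csp_killers w) => //; rewrite mem_filter h /=.
have -> : (w, nth [::] csp_killers w) = nth (0, [::]) (zip (iota 0 N) csp_killers) w.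
  by rewrite nth_zip // nth_iota.
by rewrite mem_nth // size_zip sz minnn.
Qed.

(** The report [S] leaves alive the point that is missing from the facts in [K]. *)
Definition missed (S : seq (C * nat)) (K : seq (C * nat)) := ~~ has (mem S) K.

Lemma inter_killers m w : w < N ->
  ip_inter (mask m (ip_F csp_instance)) w = missed (mask m csp_lits) (nth [::] csp_killers w).
Proof.
move=> lt_w; rewrite /ip_inter /= -map_mask all_map /missed -all_predC.
have -> : all (preim csp_fact (fun F => w \in F)) (mask m csp_lits) =
    all (fun l => l \notin nth [::] csp_killers w) (mask m csp_lits).
  by apply: eq_all => l /=; rewrite mem_fact // membE.
by apply/allP/allP => h x x_in; apply/negP => y_in; have := h _ y_in; rewrite /= x_in.
Qed.

Lemma prob_count A : ip_prob csp_instance A = ((count A (iota 0 N))%:Q / N%:Q)%R.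
Proof.
rewrite /ip_prob /= size_nseq -/N.
rewrite (eq_bigr (fun=> (1 / N%:Q)%R)); last by move=> i _; rewrite nth_nseq ltn_ord.
rewrite -(big_mkord A (fun=> (1 / N%:Q)%R)) big_const_seq iter_addr addr0 /index_iota subn0.
by rewrite -mulr_natl mulrA mulr1.
Qed.

Lemma count_iota_nth (T : Type) (x0 : T) (P : pred T) t :
  count (fun w => P (nth x0 t w)) (iota 0 (size t)) = count P t.
Proof. by rewrite -{3}(mkseq_nth x0 t) count_map. Qed.

Lemma missed_goods S :
  count (missed S) [seq [:: l] | l <- csp_lits] = count (fun l => l \notin S) csp_lits.
Proof. by rewrite count_map; apply: eq_count => l; rewrite /missed /= orbF. Qed.

Lemma count_inter m : let S := mask m csp_lits in
  count (ip_inter (mask m (ip_F csp_instance))) (iota 0 N) =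
  count (fun l => l \notin S) csp_lits + (count (missed S) csp_clauses).*2.+1.
Proof.
move=> S; rewrite -missed_goods.
rewrite (eq_in_count (a2 := fun w => missed S (nth [::] csp_killers w))); last first.
  by move=> w; rewrite mem_iota => /inter_killers->.
by rewrite count_iota_nth /csp_killers count_cat /= count_cat addnn.
Qed.

Lemma count_interE m : let S := mask m csp_lits in
  count (fun w => (w \in ip_E csp_instance) && ip_inter (mask m (ip_F csp_instance)) w) (iota 0 N) =
  count (fun l => l \notin S) csp_lits.
Proof.
move=> S; rewrite -missed_goods.
have eN : N = size csp_lits + (size (csp_clauses ++ csp_clauses)).+1.
  by rewrite /N /csp_killers size_cat size_map.
rewrite eN iotaD count_cat [X in _ + X](eq_in_count (a2 := pred0)) ?count_pred0 ?addn0; last first.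
  by move=> w; rewrite !mem_iota /= => /andP[h _]; rewrite ltnNge h.
rewrite -[in RHS](count_iota_nth [::]) size_map; apply: eq_in_count => w.
rewrite mem_iota /= add0n => lt_w; rewrite lt_w /= inter_killers; last by rewrite eN; lia.
by rewrite /csp_killers nth_cat size_map lt_w.
Qed.

(** With g points left inside E and b outside, G / (G + 1) <= g / (g + b) amounts to G b <= g. The
    probability of the report is positive because b is at least 1. *)
Lemma csp_yesE : 0 < csp_goal -> ip_yes csp_instance <-> exists m,
  let S := mask m csp_lits in
  csp_goal * (count (missed S) csp_clauses).*2.+1 <= count (fun l => l \notin S) csp_lits.
Proof.
move=> G0; have N0 := N_gt0.
split=> -[m h]; exists m; move: h; cbv zeta; rewrite !prob_count count_inter count_interE.
all: set g := count _ csp_lits; set b := (count _ csp_clauses).*2.+1.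
all: have P0 : (0 < ((g + b)%N%:Q / N%:Q))%R by rewrite divr_gt0 // ltr0z ltz_nat; rewrite /b; lia.
  move=> [_]; rewrite /=.
all: have -> : ((g%:Q / N%:Q) / ((g + b)%N%:Q / N%:Q) = g%:Q / (g + b)%N%:Q)%R
  by rewrite invf_div mulrA divfK // intr_eq0; lia.
all: rewrite ?ler_pdivrMr ?ltr0z // mulrAC ler_pdivlMr ?ltr0z ?ltz_nat; try by (rewrite /b; lia).
all: rewrite -!intrM ler_int -!PoszM lez_nat.
  by nia.
by move=> h; split=> //; nia.
Qed.

Lemma csp_reduction : uniq cells -> cells != [::] -> 1 < s -> all (all (fun l => l \in csp_lits)) cons ->
  ip_yes csp_instance <-> csp_sat.
Proof.
move=> uc c0 s1 hcons.
have sc : 0 < size cells by rewrite lt0n size_eq0.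
have G0 : 0 < csp_goal by rewrite /csp_goal muln_gt0 sc; lia.
rewrite (csp_yesE G0); split=> [[m]|[v [hv1 hv2]]].
- cbv zeta; set S := mask m csp_lits; move=> h.
  have good_le : count (fun l => l \notin S) csp_lits <= size cells * s.
    by rewrite -size_lits count_size.
  have bad0 : count (missed S) csp_clauses = 0.
    (* A surviving pair and the permanent point give [csp_goal * 3 <= size cells * s], contradicting
       [3 * s.-1 > s]. *)
    apply/eqP; rewrite -leqn0 leqNgt; apply/negP => b_gt0.
    have : csp_goal * 3 <= size cells * s.
      by apply: leq_trans (leq_trans h good_le); rewrite leq_mul2l; lia.
    rewrite /csp_goal; case: (s) s1 => [|[|s']] // _; rewrite -mulnA leq_pmul2l //=; lia.
  have hit cl : cl \in csp_clauses -> has (mem S) cl.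
    move=> cl_in; move/eqP: bad0; rewrite eqn0Ngt -has_count => /hasPn/(_ _ cl_in).
    by rewrite negbK.
  have eS : S = filter (mem S) csp_lits by apply/subseq_uniqP; [apply: uniq_lits|apply: mask_subseq].
  (* With no clause missed, the threshold says that at least [csp_goal] facts are unreported. *)
  have size_S : size S <= size cells.
    have := count_predC (mem S) csp_lits; rewrite -size_filter -eS size_lits.
    rewrite -[count (predC _) _]/(count (fun l => l \notin S) csp_lits).
    move: h; rewrite bad0 muln1 /csp_goal; move: (count _ csp_lits) => k.
    by rewrite -{2}(ltn_predK s1) mulnS /=; lia.
  have sub : {subset cells <= map fst S}.
    move=> c c_in; have [|l] := hasP (hit [seq (c, a) | a <- iota 0 s] _).
      by rewrite mem_cat; apply/orP; left; apply: (map_f (fun c => [seq (c, a) | a <- iota 0 s])).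
    by move=> /mapP[a _ ->] h'; apply/mapP; exists (c, a).
  (* Pigeonhole: at most as many facts as cells are reported and they cover every cell, so no cell
     is reported twice and [v] can be read off. *)
  have uS : uniq (map fst S) by apply: leq_size_uniq uc sub _; rewrite size_map.
  pose v c := nth 0 (map snd S) (index c (map fst S)).
  have vS l : l \in S -> v l.1 = l.2.
    move=> l_in; have lt_l : index l S < size S by rewrite index_mem.
    have el : l.1 = nth l.1 (map fst S) (index l S) by rewrite (nth_map l) // nth_index.
    by rewrite /v {1}el index_uniq ?size_map // (nth_map l) // nth_index.
  exists v; split=> [c /sub/mapP[l l_in ->]|cl cl_in].
    by have := mem_mask l_in; rewrite mem_lits vS // => /andP[].
  have /hasP[l l_in lS] : has (mem S) cl by apply: hit; rewrite mem_cat cl_in orbT.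
  by apply/hasP; exists l => //; rewrite vS.
pose p l := v l.1 == l.2.
(* Exactly the facts that hold under [v] are reported. *)
exists (map p csp_lits); rewrite -filter_mask /=.
have hit cl : cl \in csp_clauses -> has (mem (filter p csp_lits)) cl.
  rewrite mem_cat => /orP[/mapP[c c_in ->]|cl_in].
    apply/hasP; exists (c, v c); first by apply: map_f; rewrite mem_iota hv1.
    by rewrite /= mem_filter /p /= eqxx mem_lits c_in hv1.
  have /hasP[l l_in lv] := hv2 _ cl_in; apply/hasP; exists l => //=.
  by rewrite mem_filter /p lv (allP (allP hcons _ cl_in)).
have -> : count (missed (filter p csp_lits)) csp_clauses = 0.
  by apply/eqP; rewrite eqn0Ngt -has_count; apply/hasPn => cl /hit; rewrite /missed negbK.
have -> : count (fun l => l \notin filter p csp_lits) csp_lits = count (predC p) csp_lits.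
  by apply: eq_in_count => l l_in; rewrite mem_filter l_in andbT.
have count_p : count p csp_lits = size cells.
  rewrite /csp_lits; elim: (cells) (hv1) => //= c cs IH hv; rewrite count_cat IH; last first.
    by move=> c' c'_in; apply: hv; rewrite in_cons c'_in orbT.
  rewrite count_map (eq_count (a2 := pred1 (v c))); last by move=> a; rewrite /p /= eq_sym.
  by rewrite count_uniq_mem ?iota_uniq // mem_iota hv ?mem_head.
have := count_predC p csp_lits; rewrite count_p size_lits muln1 /csp_goal.
by move: (count (predC p) csp_lits) => k; rewrite -{1}(ltn_predK s1) mulnS /=; lia.
Qed.

End Reduction.

(** * Tableaux of computations *)

Section Tableau.
Variable M : TM.
Notation cfg := (fcfg M).

(** Halted configurations are fixed points, as for [exec], so the tableau has a row for every
    time. *)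
Definition fnext (c : cfg) : cfg :=
  let: (q, p, T) := c in
  if tm_delta q (T p) is Some (q', w, mv) then (q', (p + shift mv)%R, upd T p w) else c.

Lemma tape_rel_exec t (cf : config M) c : tape_rel cf c -> tape_rel (exec t cf) (iter t fnext c).
Proof.
elim: t cf c => // t IH cf c rel; rewrite iterSr /=.
case: c rel => [[q p] T] rel.
have [eq_q hr _] := rel; have e0 : cf_cur cf = T p by have /= := hr 0; rewrite addr0.
case e : (tm_delta q (T p)) => [[[q' w] mv]|].
  have [cf' -> rel'] := tape_rel_step rel e (fun x => erefl).
  by rewrite /fnext e; apply: IH.
have -> : step cf = None by rewrite /step eq_q e0 e.
have ef : fnext (q, p, T) = (q, p, T) by rewrite /fnext e.
by rewrite ef; elim: t {IH} => //= t IH; rewrite -iterS iterSr ef.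
Qed.

Definition sigma : finType := (option bool * option (tm_state M))%type.

Definition arrive (s : sigma) (right : bool) : option (tm_state M) :=
  if s.2 is Some q then
    match tm_delta q s.1 with
    | Some (q', _, MoveR) => if right then Some q' else None
    | Some (q', _, MoveL) => if right then None else Some q'
    | _ => None
    end
  else None.

Definition loc (a b c : sigma) : sigma :=
  if b.2 is Some q then
    match tm_delta q b.1 with
    | Some (q', w, mv) => (w, if mv is Stay then Some q' else None)
    | None => b
    end
  else (b.1, if arrive a true is Some q then Some q else arrive c false).

Variable off : nat.

Definition tab (c : cfg) (i : nat) : sigma :=
  let: (q, p, T) := c in (T (i%:Z - off%:Z)%R, if p == (i%:Z - off%:Z)%R then Some q else None).

(** The head moves by at most one cell, so three neighbours determine the next content. The cases
    are the head on the middle cell, on either neighbour, or elsewhere. *)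
Lemma tab_next c i : tab (fnext c) i.+1 = loc (tab c i) (tab c i.+1) (tab c i.+2).
Proof.
case: c => [[q p] T]; rewrite /tab.
set x := (i.+1%:Z - off%:Z)%R.
have -> : (i%:Z - off%:Z = x - 1)%R by rewrite /x; lia.
have -> : (i.+2%:Z - off%:Z = x + 1)%R by rewrite /x; lia.
rewrite /fnext /loc /arrive /=.
case: (eqVneq p x) => [ex|nx] /=.
  rewrite ex; case: (tm_delta q (T x)) => [[[q' w] mv]|] /=; last by rewrite eqxx.
  rewrite /upd eqxx; congr (_, _); case: mv => /=.
  - by rewrite ifF //; apply/eqP; lia.
  - by rewrite ifF //; apply/eqP; lia.
  - by rewrite addr0 eqxx.
have nx' : x != p by rewrite eq_sym.
case: (eqVneq p (x - 1)%R) => [el|nl] /=.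
  have nr : ((p == x + 1) = false)%R by apply/eqP; lia.
  rewrite nr /= -el; case e : (tm_delta q (T p)) => [[[q' w] mv]|] /=; last by rewrite (negPf nx).
  rewrite /upd (negPf nx'); congr (_, _); case: mv {e} => /=.
  - by rewrite ifF //; apply/eqP; lia.
  - by rewrite ifT //; apply/eqP; lia.
  - by rewrite addr0 (negPf nx).
case: (eqVneq p (x + 1)%R) => [er|nr] /=.
  rewrite -er; case e : (tm_delta q (T p)) => [[[q' w] mv]|] /=; last by rewrite (negPf nx).
  rewrite /upd (negPf nx'); congr (_, _); case: mv {e} => /=.
  - by rewrite ifT //; apply/eqP; lia.
  - by rewrite ifF //; apply/eqP; lia.
  - by rewrite addr0 (negPf nx).
case e : (tm_delta q (T p)) => [[[q' w] mv]|] /=; last by rewrite (negPf nx).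
rewrite /upd (negPf nx') ifF //; apply/eqP; move: nx nl nr; case: mv {e} => /=; lia.
Qed.

Definition start_tape (z : seq bool) : tape := fun p => (if 1 <= p then onth z `|p - 1|%N else None)%R.
Definition start_cfg (z : seq bool) : cfg := (tm_start M, 1%R, start_tape z).
Definition conf z t := iter t fnext (start_cfg z).

(** What happens in [t] steps stays within distance [t] of the start; this is why the edge columns
    of the tableau can be fixed as blank. *)
Lemma conf_bounds z t : let: (q, p, T) := conf z t in
  [/\ (1 - t%:Z <= p)%R, (p <= 1 + t%:Z)%R,
      forall x, (x < 1 - t%:Z)%R -> T x = None & forall x, (1 + (size z + t)%N%:Z <= x)%R -> T x = None].
Proof.
elim: t => [|t]; rewrite /conf /=.
  split=> // x hx; rewrite /start_tape; first by rewrite ifF //; apply/negbTE; lia.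
  by case: ifP => // h; rewrite onth_default //; lia.
rewrite -/(conf z t); case: (conf z t) => [[q p] T] [h1 h2 h3 h4].
rewrite /fnext; case: (tm_delta q (T p)) => [[[q' w] mv]|].
  split.
  - by case: mv => /=; lia.
  - by case: mv => /=; lia.
  - by move=> x hx; rewrite /upd ifF; [apply: h3; lia|apply/eqP; lia].
  - move=> x hx; rewrite /upd ifF; [apply: h4; lia|apply/eqP; lia].
by split=> [||x hx|x hx]; [lia|lia|apply: h3; lia|apply: h4; lia].
Qed.

End Tableau.

(** * The clauses of the tableau *)

Section Clauses.
Variable M : TM.
Variables (y : seq bool) (B T : nat).
Notation sig := (sigma M).

Definition rk (a : sig) : nat := enum_rank a.
Definition rblank := rk (None, None).
Definition rsym (b : bool) := rk (Some b, None).
Definition rhead (b : bool) := rk (Some b, Some (tm_start M)).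

(* The clause that [a], [b], [c] in row t force [loc a b c] below b, the negation of a being expressed by the
   positive literals for the other values; an entry is ((row offset, column offset), value). *)
Definition win_pats : seq (seq ((nat * nat) * nat)) :=
  [seq [seq ((0, 0), rk a') | a' <- enum sig & a' != abc.1] ++
       [seq ((0, 1), rk a') | a' <- enum sig & a' != abc.2.1] ++
       [seq ((0, 2), rk a') | a' <- enum sig & a' != abc.2.2] ++
       [:: ((1, 1), rk (loc abc.1 abc.2.1 abc.2.2))]
    | abc <- enum {: sig * (sig * sig)}].

Definition acc_vals : seq nat :=
  [seq rk a | a <- enum sig & if a.2 is Some q then @tm_accept M q else false].

(** Row 0 has [T.+1] blank columns, then the known word, [B] free columns and again [T.+1] blanks.
    The head starts in column [T.+1] and in [T] steps reaches neither edge column. *)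
Definition width := T + T + size y + B + 2.
Definition tcells : seq (nat * nat) := flatten [seq [seq (t, i) | i <- iota 0 width] | t <- iota 0 T.+1].

(* The values allowed in row 0, whose column i is the tape cell i - T. *)
Definition rowspec : seq (seq nat) :=
  nseq T.+1 [:: rblank] ++ [:: rhead (head false y)] :: [seq [:: rsym b] | b <- behead y]
  ++ nseq B [:: rblank; rsym false; rsym true] ++ nseq T.+1 [:: rblank].

Definition win_at (t i : nat) : seq (seq ((nat * nat) * nat)) :=
  [seq [seq ((t + r.1.1, i + r.1.2), r.2) | r <- pat] | pat <- win_pats].
Definition win_row (t : nat) := flatten [seq win_at t i | i <- iota 0 (T + T + size y + B)].
Definition win_clauses := flatten [seq win_row t | t <- iota 0 T].
Definition bound_clauses : seq (seq ((nat * nat) * nat)) :=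
  [seq [:: ((t, 0), rblank)] | t <- iota 0 T.+1] ++
  [seq [:: ((t, width.-1), rblank)] | t <- iota 0 T.+1].
Definition init_clauses : seq (seq ((nat * nat) * nat)) :=
  [seq [seq ((0, ia.1), a) | a <- ia.2] | ia <- zip (iota 0 width) rowspec].
(* Forbids symbols to the right of a blank, so that the free cells spell a word of length at most B. *)
Definition mono_clauses : seq (seq ((nat * nat) * nat)) :=
  [seq [:: ((0, i), rsym false); ((0, i), rsym true); ((0, i.+1), rblank)]
    | i <- iota (T.+1 + size y) B].
Definition acc_clause : seq ((nat * nat) * nat) :=
  flatten [seq [seq ((T, i), a) | a <- acc_vals] | i <- iota 0 width].
Definition tclauses := acc_clause :: win_clauses ++ bound_clauses ++ init_clauses ++ mono_clauses.

Hypothesis y_nil : y != [::].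

Lemma size_rowspec : size rowspec = width.
Proof.
rewrite /rowspec size_cat /= !size_cat size_map size_behead !size_nseq /width.
by case: y y_nil => //= b s _; rewrite size_nseq; lia.
Qed.

Lemma mem_tcells t i : ((t, i) \in tcells) = (t <= T) && (i < width).
Proof.
apply/flattenP/andP => [[_ /mapP[t' + ->] /mapP[i' + [-> ->]]]|[ht hi]].
  by rewrite !mem_iota => /andP[_ h] /andP[_ h']; lia.
exists [seq (t, i) | i <- iota 0 width]; last by apply: map_f; rewrite mem_iota.
by apply: (map_f (fun t => [seq (t, i) | i <- iota 0 width])); rewrite mem_iota.
Qed.

Lemma uniq_tcells : uniq tcells.
Proof.
have -> : tcells = csp_lits (iota 0 T.+1) width by [].
by apply: uniq_lits; apply: iota_uniq.
Qed.

Lemma rk_lt a : rk a < #|sig|. Proof. exact: ltn_ord. Qed.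
Lemma rk_inj : injective rk. Proof. by move=> a b /ord_inj/enum_rank_inj. Qed.

Definition sat_clause (v : nat * nat -> nat) (cl : seq ((nat * nat) * nat)) :=
  has (fun l => v l.1 == l.2) cl.

Lemma mem_tclauses cl : (cl \in tclauses) = [|| cl == acc_clause, cl \in win_clauses,
  cl \in bound_clauses, cl \in init_clauses | cl \in mono_clauses].
Proof.
have g (a b c d : seq (seq ((nat * nat) * nat))) :
  (cl \in a ++ b ++ c ++ d) = [|| cl \in a, cl \in b, cl \in c | cl \in d] by rewrite !mem_cat.
by rewrite in_cons g.
Qed.

(** Unfolds the list of clauses into its five kinds: acceptance, windows, edges, row 0, and no
    symbol after a blank. *)
Lemma tcsp_satE v : {in tclauses, forall cl, sat_clause v cl} <->
  [/\ exists2 i, i < width & v (T, i) \in acc_vals,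
      forall t i pat, t < T -> i < T + T + size y + B -> pat \in win_pats ->
        has (fun r => v (t + r.1.1, i + r.1.2) == r.2) pat,
      forall t, t <= T -> v (t, 0) = rblank /\ v (t, width.-1) = rblank,
      forall i, i < width -> v (0, i) \in nth [::] rowspec i
    & forall i, T.+1 + size y <= i < T.+1 + size y + B ->
        [|| v (0, i) == rsym false, v (0, i) == rsym true | v (0, i.+1) == rblank]].
Proof.
have sz : size (iota 0 width) = size rowspec by rewrite size_iota size_rowspec.
split=> [h|[h1 h2 h3 h4 h5] cl].
  split.
  - have /hasP[l /flattenP[cl /mapP[i hi ->] /mapP[a a_in ->]] /= /eqP e] := h acc_clause (mem_head _ _).
    exists i; first by rewrite mem_iota in hi; lia.
    by rewrite e.
  - move=> t i pat ht hi hp.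
    suff /h : [seq ((t + r.1.1, i + r.1.2), r.2) | r <- pat] \in tclauses by rewrite /sat_clause has_map.
    rewrite mem_tclauses; apply/orP; right; apply/orP; left.
    apply/flattenP; exists (win_row t); first by apply: map_f; rewrite mem_iota.
    apply/flattenP; exists (win_at t i); first by apply: map_f; rewrite mem_iota.
    exact: (map_f (fun pat => [seq ((t + r.1.1, i + r.1.2), r.2) | r <- pat])).
  - have bound cl : cl \in bound_clauses -> sat_clause v cl.
      by move=> hc; apply: h; rewrite mem_tclauses hc !orbT.
    move=> t ht; have ht' : t \in iota 0 T.+1 by rewrite mem_iota.
    have := bound [:: ((t, 0), rblank)]; have := bound [:: ((t, width.-1), rblank)].
    rewrite /sat_clause /= !orbF => b1 b2; split; apply/eqP.
      by apply: b2; rewrite mem_cat; apply/orP; left; apply: (map_f (fun t => [:: ((t, 0), rblank)])).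
    by apply: b1; rewrite mem_cat; apply/orP; right; apply: (map_f (fun t => [:: ((t, width.-1), rblank)])).
  - move=> i hi.
    have : [seq ((0, i), a) | a <- nth [::] rowspec i] \in init_clauses.
      apply/mapP; exists (i, nth [::] rowspec i) => //.
      have -> : (i, nth [::] rowspec i) = nth (0, [::]) (zip (iota 0 width) rowspec) i.
        by rewrite nth_zip // nth_iota.
      by rewrite mem_nth // size_zip sz minnn size_rowspec.
    move=> hc; have /h : [seq ((0, i), a) | a <- nth [::] rowspec i] \in tclauses.
      by rewrite mem_tclauses hc !orbT.
    by rewrite /sat_clause has_map => /hasP[a a_in /eqP /= ->].
  - move=> i hi.
    have /h : [:: ((0, i), rsym false); ((0, i), rsym true); ((0, i.+1), rblank)] \in tclauses.
      rewrite mem_tclauses; do 4!(apply/orP; right).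
      apply: (map_f (fun i => [:: ((0, i), rsym false); ((0, i), rsym true); ((0, i.+1), rblank)])).
      by rewrite mem_iota.
    by rewrite /sat_clause /= orbF.
rewrite mem_tclauses => /or4P[/eqP->| | |/orP[]].
- have [i hi ha] := h1; apply/hasP; exists ((T, i), v (T, i)) => //=.
  apply/flattenP; exists [seq ((T, i), a) | a <- acc_vals]; last exact: map_f.
  by apply: (map_f (fun i => [seq ((T, i), a) | a <- acc_vals])); rewrite mem_iota.
- move=> /flattenP[_ /mapP[t ht ->]] /flattenP[_ /mapP[i hi ->]] /mapP[pat hp ->].
  rewrite !mem_iota in ht hi.
  by rewrite /sat_clause has_map; apply: h2 => //; lia.
- rewrite mem_cat => /orP[] /mapP[t]; rewrite mem_iota => ht ->; rewrite /sat_clause /=;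
  by (have [|e1 e2] := h3 t; first by lia); rewrite ?e1 ?e2 eqxx.
- move=> /mapP[ia /(nthP (0, [::]))[j]]; rewrite size_zip sz minnn size_rowspec => hj.
  rewrite nth_zip // nth_iota // => <- ->; rewrite /sat_clause has_map.
  by apply/hasP; exists (v (0, j)); [apply: h4|rewrite /=].
- move=> /mapP[i]; rewrite mem_iota => hi ->; rewrite /sat_clause /= orbF.
  exact: h5.
Qed.


Definition free_vals := [:: rblank; rsym false; rsym true].

Lemma nth_rowspec i : i < width -> nth [::] rowspec i =
  if i <= T then [:: rblank] else if i == T.+1 then [:: rhead (head false y)]
  else if i < T.+1 + size y then [:: rsym (nth false y (i - T.+1))]
  else if i < T.+1 + size y + B then free_vals else [:: rblank].
Proof.
rewrite /rowspec nth_cat size_nseq ltnS => hi.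
case: (leqP i T) => [le_i|lt_i]; first by rewrite nth_nseq ltnS le_i.
have sy : 0 < size y by rewrite lt0n size_eq0.
case: eqP => [->|ne]; first by rewrite subnn.
have -> : i - T.+1 = (i - T.+2).+1 by lia.
rewrite /= nth_cat size_map size_behead.
have -> : (i - T.+2 < (size y).-1) = (i < T.+1 + size y) by lia.
case: ifP => h1; first by rewrite (nth_map false) ?size_behead ?nth_behead //; lia.
rewrite nth_cat size_nseq nth_nseq.
have -> : (i - T.+2 - (size y).-1 < B) = (i < T.+1 + size y + B) by lia.
case: ifP => h2; first by rewrite h2.
rewrite -[_ :: nseq T _]/(nseq T.+1 [:: rblank]) nth_nseq ifT //.
by move: hi; rewrite /width; lia.
Qed.

#[local] Arguments tab : simpl never.

Notation tabc z t i := (tab T (conf M z t) i).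

Lemma tab_edges w t : size w <= B -> t <= T ->
  tabc (y ++ w) t 0 = (None, None) /\ tabc (y ++ w) t width.-1 = (None, None).
Proof.
move=> le_w le_t; have := conf_bounds M (y ++ w) t; case: (conf _ _ _) => [[q p] Tp] [h1 h2 h3 h4].
have sy : 0 < size y by rewrite lt0n size_eq0.
have ew : width.-1 = T + T + size y + B + 1 by rewrite /width; lia.
rewrite size_cat in h4; rewrite ew /tab h3 ?h4; try lia.
by split; rewrite ifF //; apply/eqP; lia.
Qed.

Lemma tab_start z i : tabc z 0 i = (if T < i then onth z (i - T.+1) else None,
   if i == T.+1 then Some (tm_start M) else None).
Proof.
rewrite /conf /tab /= /start_tape; congr (_, _).
  case: ltnP => h.
    by rewrite (_ : (1 <= i%:Z - T%:Z)%R = true); [congr onth; lia|lia].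
  by rewrite (_ : (1 <= i%:Z - T%:Z)%R = false) //; lia.
by rewrite (_ : (1 == i%:Z - T%:Z)%R = (i == T.+1)) //; apply/eqP/eqP; lia.
Qed.

Lemma row0_spec w i : size w <= B -> i < width -> rk (tabc (y ++ w) 0 i) \in nth [::] rowspec i.
Proof.
move=> le_w hi; rewrite nth_rowspec // tab_start.
have sy : 0 < size y by rewrite lt0n size_eq0.
case: (leqP i T) => [le_i|lt_i]; first by rewrite (_ : (i == T.+1) = false) ?mem_head //; apply/eqP; lia.
case: eqP => [->|ne].
  by rewrite subnn onth_cat sy; case: (y) sy => //= b s _; rewrite mem_head.
rewrite onth_cat; have -> : (i - T.+1 < size y) = (i < T.+1 + size y) by lia.
case: ifP => h1; first by rewrite onthE (nth_map false) ?mem_head //; lia.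
case: ifP => h2; last by rewrite onth_default ?mem_head //; lia.
by case: (onth _ _) => [[]|]; rewrite /free_vals !in_cons /rsym /rblank eqxx ?orbT.
Qed.

Lemma read_word_mono s : (forall j, nth None s j = None -> nth None s j.+1 = None) ->
  forall j, nth None s j = onth (read_word s) j.
Proof.
elim: s => [|[b|] s IH] h j /=; first by rewrite nth_nil onth0n.
  by case: j => //= j; apply: IH => j'; apply: (h j'.+1).
rewrite onth0n; elim: j => [|j IHj] //=.
by apply: (h j).
Qed.

Lemma size_read_word s : size (read_word s) <= size s.
Proof. by elim: s => [|[b|] s IH]. Qed.

Theorem tableau_correct : csp_sat tcells #|sig| tclauses <->
  exists w, size w <= B /\ @tm_accept M (conf M (y ++ w) T).1.1.
Proof.
have sy : 0 < size y by rewrite lt0n size_eq0.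
split=> [[v [_ /tcsp_satE[h1 h2 h3 h4 h5]]]|[w [le_w acc]]]; last first.
  (* From a witness: each cell gets the value that it has in the actual run. *)
  exists (fun c => rk (tabc (y ++ w) c.1 c.2)); split; first by move=> c _; apply: rk_lt.
  apply: (proj2 (tcsp_satE (fun c => rk (tabc (y ++ w) c.1 c.2)))); split=> /=.
  - have := conf_bounds M (y ++ w) T; move: acc.
    case e : (conf _ _ _) => [[q p] Tp] acc [b1 b2 _ _]; rewrite /= in acc.
    have [i ei] : exists i : nat, (i%:Z - T%:Z)%R = p by exists (absz (p + T%:Z)%R); lia.
    exists i; first by rewrite /width; lia.
    rewrite /tab ei eqxx; apply: map_f; rewrite mem_filter /= acc; exact: mem_enum.
  - have inf (x a : sig) : x != a -> x \in [seq a' <- enum sig | a' != a].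
      by rewrite mem_filter mem_enum => ->.
    move=> t i pat ht hi /mapP[[a [b c]] _ ->] /=; rewrite !has_cat !has_map.
    case: (eqVneq (tabc (y ++ w) t i) a) => [ea|na]; last first.
      apply/orP; left; apply/hasP; exists (tabc (y ++ w) t i); first exact: inf.
      by rewrite /= !addn0 eqxx.
    case: (eqVneq (tabc (y ++ w) t i.+1) b) => [eb|nb]; last first.
      apply/orP; right; apply/orP; left; apply/hasP; exists (tabc (y ++ w) t i.+1); first exact: inf.
      by rewrite /= addn0 addn1 eqxx.
    case: (eqVneq (tabc (y ++ w) t i.+2) c) => [ec|nc]; last first.
      apply/orP; right; apply/orP; right; apply/orP; left; apply/hasP;
        exists (tabc (y ++ w) t i.+2); first exact: inf.
      by rewrite /= addn0 addn2 eqxx.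
    do 3!(apply/orP; right); rewrite /= orbF !addn1 -ea -eb -ec -tab_next; exact: eqxx.
  - by move=> t ht; have [-> ->] := tab_edges le_w ht.
  - by move=> i hi; apply: row0_spec.
  - move=> i hi; rewrite !tab_start.
    have -> : T < i by lia. have -> : T < i.+1 by lia.
    have -> : (i == T.+1) = false by apply/eqP; lia.
    have -> : (i.+1 == T.+1) = false by apply/eqP; lia.
    rewrite subSS !onth_cat !ifF; try by apply/negbTE; lia.
    have -> : i - T - size y = (i - T.+1 - size y).+1 by lia.
    case e : (onth w (i - T.+1 - size y)) => [b|]; first by case: b {e}; rewrite /rsym eqxx ?orbT.
    have le_sz : size w <= i - T.+1 - size y by rewrite -onthNE e.
    by rewrite onth_default; [rewrite eqxx !orbT|lia].
(* From an assignment: the witness is read off the free columns of row 0, up to the first blank. *)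
pose sym j := if v (0, T.+1 + size y + j) == rsym false then Some false
  else if v (0, T.+1 + size y + j) == rsym true then Some true else None.
pose syms := mkseq sym B.
have mono j : nth None syms j = None -> nth None syms j.+1 = None.
  case: (ltnP j.+1 B) => hj; last by rewrite [in X in _ -> X]nth_default // size_mkseq.
  rewrite !nth_mkseq //; last by lia.
  have := h5 (T.+1 + size y + j); rewrite /sym addnS => /(_ ltac:(lia)).
  case: eqP => //= _; case: eqP => //= _ /eqP-> _.
  rewrite ifF; last by apply/eqP => /rk_inj.
  by rewrite ifF //; apply/eqP => /rk_inj.
pose w := read_word syms.
have le_w : size w <= B by rewrite /w; apply: leq_trans (size_read_word _) _; rewrite size_mkseq.
have row0 i : i < width -> v (0, i) = rk (tabc (y ++ w) 0 i).
  move=> hi; have := h4 _ hi; have := row0_spec le_w hi; rewrite nth_rowspec //.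
  case: ifP => h6; first by rewrite !inE => /eqP-> /eqP->.
  case: ifP => h7; first by rewrite !inE => /eqP-> /eqP->.
  case: ifP => h8; first by rewrite !inE => /eqP-> /eqP->.
  case: ifP => h9; last by rewrite !inE => /eqP-> /eqP->.
  have [j [ej hj]] : exists j, i = T.+1 + size y + j /\ j < B by exists (i - (T.+1 + size y)); lia.
  move=> _; have := read_word_mono mono j; rewrite nth_mkseq // -/w /sym -ej => ew.
  have -> : tabc (y ++ w) 0 i = (onth w j, None).
    rewrite tab_start h7 (_ : T < i); last by lia.
    rewrite onth_cat ifF; last by apply/negbTE; lia.
    by congr (onth w _, _); lia.
  rewrite -ew /free_vals !inE => /or3P[] /eqP->; rewrite ?eqxx //.
    rewrite ifF; last by apply/eqP => /rk_inj.
    by rewrite ifF //; apply/eqP => /rk_inj.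
  by rewrite ifF //; apply/eqP => /rk_inj.
(* By induction on [t]; the edge columns have their own clauses and the others are forced by
   windows. *)
have rows t i : t <= T -> i < width -> v (t, i) = rk (tabc (y ++ w) t i).
  elim: t i => [|t IH] i ht hi; first exact: row0.
  have [e1 e2] := tab_edges le_w ht; have [e3 e4] := h3 _ ht.
  case: i hi => [|i] hi; first by rewrite e1 e3.
  case: (eqVneq i.+1 width.-1) => [->|ni]; first by rewrite e2 e4.
  have hi2 : i < T + T + size y + B by move: hi ni; rewrite /width; lia.
  set a := tabc (y ++ w) t i; set b := tabc (y ++ w) t i.+1; set c := tabc (y ++ w) t i.+2.
  (* The window clause for the actual triple: its literals in row [t] all name other values and
     fail, so the single literal in row [t.+1] holds. *)
  have := h2 t i _ ht hi2 (map_f _ (mem_enum _ (a, (b, c)))).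
  have ha : v (t, i) = rk a by apply: IH; lia.
  have hb : v (t, i.+1) = rk b by apply: IH; lia.
  have hc : v (t, i.+2) = rk c by apply: IH; move: hi2; rewrite /width; lia.
  have no (x a' : sig) : a' \in [seq a' <- enum sig | a' != x] -> rk x == rk a' -> False.
    by rewrite mem_filter => /andP[ne _] /eqP/rk_inj ea; rewrite ea eqxx in ne.
  case/hasP=> r; rewrite !mem_cat => /or4P[/mapP[a' a'_in ->]|/mapP[a' a'_in ->]|/mapP[a' a'_in ->]|].
  - by rewrite /= !addn0 ha => /(no _ _ a'_in).
  - by rewrite /= addn0 addn1 hb => /(no _ _ a'_in).
  - by rewrite /= addn0 addn2 hc => /(no _ _ a'_in).
  rewrite mem_seq1 => /eqP-> /=; rewrite !addn1 => /eqP->.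
  by rewrite tab_next.
exists w; split=> //; have [i hi] := h1.
rewrite rows // => /mapP[a]; rewrite mem_filter => /andP[+ _] /rk_inj ea.
rewrite -ea; case: (conf _ _ _) => [[q p] Tp] /=.
by case: ifP.
Qed.

End Clauses.

(** * The reduction *)

Section Injectivity.

(** Injectivity with arbitrary remainders, the form that composes under concatenation. *)
Definition prefix_inj (A B : Type) (e : A -> seq B) :=
  forall a b u v, e a ++ u = e b ++ v -> a = b /\ u = v.

Lemma tokens_inj s t : flatten (map token_bits s) = flatten (map token_bits t) -> s = t.
Proof.
elim: s t => [|a s IH] [|b t] //=; [by case: b|by case: a|].
by case: a; case: b => //= -[] /IH->.
Qed.

Lemma enc_bits_inj b c u v : enc_bits b ++ TkClose :: u = enc_bits c ++ TkClose :: v -> b = c /\ u = v.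
Proof.
elim: b c => [|x b IH] [|y c] //=; [by case|by case: y|by case: x|].
by case: x; case: y => //= -[] /IH[-> ->].
Qed.

Lemma enc_nat_inj : prefix_inj enc_nat.
Proof.
move=> m n u v; rewrite /enc_nat /= -!catA => -[] /enc_bits_inj[e ->].
by rewrite -(bval_bin m) e bval_bin.
Qed.

Lemma eq_cons (A : Type) (a b : A) s t : a :: s = b :: t -> a = b /\ s = t.
Proof. by case. Qed.

Lemma enc_int_inj : prefix_inj enc_int.
Proof.
have E z w : enc_int z ++ w =
    TkOpen :: (if (z < 0)%R then Tk1 else Tk0) :: TkComma :: (enc_nat `|z| ++ TkClose :: w).
  by rewrite /enc_int -[TkClose :: w]cat1s catA.
move=> m n u v; rewrite !E => e; have [_ {}e] := eq_cons e; have [e1 {}e] := eq_cons e.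
have [_ {}e] := eq_cons e; have [e2 {}e] := enc_nat_inj e.
have [_ ->] := eq_cons e; split=> //.
have : (m < 0)%R = (n < 0)%R by move: e1; case: (m < 0)%R; case: (n < 0)%R.
lia.
Qed.

Lemma enc_rat_inj : prefix_inj enc_rat.
Proof.
have E q w : enc_rat q ++ w =
    TkOpen :: (enc_int (numq q) ++ TkComma :: (enc_int (denq q) ++ TkClose :: w)).
  by rewrite /enc_rat cat_cons -catA cat_cons -catA.
move=> p q u v; rewrite !E => e; have [_ {}e] := eq_cons e; have [e1 {}e] := enc_int_inj e.
have [_ {}e] := eq_cons e; have [e2 {}e] := enc_int_inj e; have [_ ->] := eq_cons e.
by rewrite -(divq_num_den p) e1 e2 divq_num_den.
Qed.

(** An entry begins with [TkOpen] and the end of the list is [TkClose], so one token tells whether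
    another entry follows. *)
Lemma enc_list_inj (A : Type) (f : A -> seq token) : (forall a, ohead (f a) = Some TkOpen) ->
  prefix_inj f -> prefix_inj (enc_list f).
Proof.
move=> hf inj s t u v.
have E s' w : enc_list f s' ++ w =
    TkOpen :: (flatten [seq f x ++ [:: TkComma] | x <- s'] ++ TkClose :: w).
  by rewrite /enc_list cat_cons -catA.
rewrite !E => -[]; elim: s t => [|a s IH] [|b t] /=.
- by case.
- by have := hf b; case: (f b) => // _ w [->].
- by have := hf a; case: (f a) => // _ w [->].
by rewrite -!catA => /inj[-> [/IH[-> ->]]].
Qed.

Lemma encode_instance_inj I J : encode_instance I = encode_instance J -> I = J.
Proof.
move=> /tokens_inj e; have [_] := eq_cons e.
have hN : prefix_inj (enc_list enc_nat) by apply: enc_list_inj enc_nat_inj.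
move=> /hN[_] /(enc_list_inj _ enc_rat_inj)[//|e1] /hN[e2] /(enc_list_inj _ hN)[//|e3] /enc_rat_inj[e4 _].
by case: I J {e} e1 e2 e3 e4 => ? ? ? ? [? ? ? ?] /= -> -> -> ->.
Qed.

End Injectivity.

Lemma ratbits_coprime m n : 0 < n -> coprime m n -> ratbits (m%:Q / n%:Q)%R = (bin m, bin n).
Proof.
move=> n0 cp; rewrite /ratbits coprimeq_num // coprimeq_den // eqz_nat gtn_eqF //=.
by rewrite gtr0_sg ?mul1r //; lia.
Qed.

(** * The constructed instance as the output of a program *)

Section CspProgram.
Variable s : nat.

(** The fractions 1 / N and G / (G + 1) are in lowest terms as they stand, so their parts are
    written down directly, without a gcd. *)
Definition csp_data (p : seq (nat * nat) * seq (seq ((nat * nat) * nat))) :=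
  (map bin (iota 0 (size (csp_killers p.1 s p.2))),
  (nseq (size (csp_killers p.1 s p.2)) ([:: true], bin (size (csp_killers p.1 s p.2))),
  (map bin (iota 0 (size (csp_lits p.1 s))),
  (map (fun l => map bin (csp_fact p.1 s p.2 l)) (csp_lits p.1 s),
  (bin (csp_goal p.1 s), bin (csp_goal p.1 s).+1))))).

Lemma PT_csp_data : PT csp_data.
Proof.
rewrite /csp_data /csp_fact /csp_goal /csp_killers /csp_clauses /csp_lits; pt.
Qed.

Lemma csp_valid (C : eqType) (cells : seq C) cons :
  0 < csp_goal cells s -> ip_valid (csp_instance cells s cons).
Proof.
move=> G0; have N0 := N_gt0 cells s cons; split.
- by rewrite all_nseq divr_ge0 ?orbT ?ler0z.
- rewrite /= big_nseq iter_addr addr0 -mulr_natl mulrA mulr1 divff //.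
  by rewrite pnatr_eq0; lia.
- by apply/allP => w; rewrite mem_iota /= size_nseq /csp_killers size_cat size_map; lia.
- rewrite all_map; apply/allP => l _; apply/allP => w /mapP[[w' K]] /=.
  rewrite mem_filter => /andP[_ /(map_f fst)]; rewrite -/unzip1 unzip1_zip ?size_iota // mem_iota => h ->.
  by rewrite /= in h *; rewrite size_nseq; lia.
- by rewrite /= divr_gt0 ?ltr0z ?ltz_nat //= ler_pdivrMr ?ltr0z // mul1r ler_int lez_nat.
Qed.

Lemma csp_encode cells cons : 0 < csp_goal cells s ->
  encode_instance (csp_instance cells s cons) = eInst (csp_data (cells, cons)).
Proof.
move=> G0; have [h0 _ _ _ /andP[/ltW h1 _]] := csp_valid cons G0.
rewrite encode_instanceE // /csp_data; congr eInst; cbn [fst snd csp_instance ip_pi ip_E ip_F ip_p].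
have e n : 0 < n -> ratbits (1 / n%:Q)%R = ([:: true], bin n).
  by move=> n0; apply: (ratbits_coprime (m := 1)) => //; apply: coprime1n.
by rewrite size_nseq map_nseq e ?N_gt0 // ratbits_coprime ?coprimenS // -map_comp.
Qed.

End CspProgram.

Lemma PT_bool_fun A (EA : Enc A) (f : bool -> A) : PT f.
Proof. by apply: (PT_ext (f := fun b => if b then f true else f false)); [pt|case]. Qed.

Section Tableau.
Variable M : TM.

(** For a fixed machine [win_pats] and [acc_vals] are constants; only their placement depends on the
    input. *)
Lemma PT_tclauses : PT (fun p : bits * (nat * nat) => tclauses M p.1 p.2.1 p.2.2).
Proof.
have h1 : PT (@rsym M) by apply: PT_bool_fun.
have h2 : PT (@rhead M) by apply: PT_bool_fun.
rewrite /tclauses /acc_clause /win_clauses /win_row /win_at /bound_clauses /init_clauses /mono_clauses.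
rewrite /rowspec /width; pt.
Qed.

End Tableau.

Lemma exec_halted (M : TM) t t' (c : config M) : halted (exec t c) -> t <= t' -> exec t' c = exec t c.
Proof.
elim: t t' c => [|t IH] t' c /= h le_t; first by case: t' {le_t} => //= t'; rewrite h.
case: t' le_t => // t' le_t /=; case e : (step c) h => [c'|] // h; exact: IH.
Qed.

(** The part of [pair_enc x w] that is known before [w]; the separator makes it nonempty. *)
Definition doubled (x : bits) : bits := flatten [seq [:: b; b] | b <- x] ++ [:: false; true].

Section Hardness.
Variables (M : TM) (c k c' k' : nat).

Definition wit_bound (x : bits) := c' * (size x).+1 ^ k'.
(** Computed for the longest admissible witness, so that one height of the tableau serves all of
    them. *)
Definition time_bound (x : bits) := c * (size (doubled x) + wit_bound x).+1 ^ k.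

Definition reduction (x : bits) : bits :=
  eInst (csp_data #|sigma M| (tcells (doubled x) (wit_bound x) (time_bound x),
    tclauses M (doubled x) (wit_bound x) (time_bound x))).

Lemma PT_reduction : PT reduction.
Proof.
have hd : PT doubled by rewrite /doubled; pt.
have hw : PT wit_bound.
  by apply: (PT_comp2 (F := muln)); [pt|pt|apply: PT_expn; pt].
have ht : PT time_bound.
  by apply: (PT_comp2 (F := muln)); [pt|pt|apply: PT_expn; pt].
have hc := PT_csp_data #|sigma M|.
have hcl := PT_comp (PT_tclauses M) (PT_pair hd (PT_pair hw ht)).
have hce : PT (fun x => tcells (doubled x) (wit_bound x) (time_bound x)).
  by rewrite /tcells /width; pt.
apply: (PT_comp PT_eInst); apply: (PT_comp hc); exact: PT_pair hce hcl.
Qed.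

Lemma tclauses_in (y : bits) B T : y != [::] ->
  all (all (fun l => l \in csp_lits (tcells y B T) #|sigma M|)) (tclauses M y B T).
Proof.
move=> y0; have rkP := @rk_lt M.
have cellP t i a : t <= T -> i < width y B T -> a < #|sigma M| ->
    ((t, i), a) \in csp_lits (tcells y B T) #|sigma M|.
  by move=> ht hi ha; rewrite mem_lits mem_tcells // ht hi.
apply/allP => cl; rewrite mem_tclauses => /or4P[/eqP->| | |/orP[]].
- apply/allP => l /flattenP[_ /mapP[i + ->] /mapP[a /mapP[s _ ->] ->]].
  by rewrite mem_iota => hi; apply: cellP => //; apply: rkP.
- move=> /flattenP[_ /mapP[t + ->]] /flattenP[_ /mapP[i + ->]] /mapP[pat + ->].
  rewrite !mem_iota => ht hi hp; apply/allP => l /mapP[r r_in ->].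
  have [r1 [r2 r3]] : r.1.1 <= 1 /\ r.1.2 <= 2 /\ r.2 < #|sigma M|.
    move: hp r_in => /mapP[abc _ ->]; rewrite !mem_cat.
    case/or4P=> [/mapP[a _ ->]|/mapP[a _ ->]|/mapP[a _ ->]|]; try by split=> //; split=> //; apply: rkP.
    by rewrite mem_seq1 => /eqP->; split=> //; split=> //; apply: rkP.
  have le1 (a b : nat) : a < T -> b <= 1 -> a + b <= T by lia.
  have le2 (a b : nat) : a < T + T + size y + B -> b <= 2 -> a + b < width y B T by rewrite /width; lia.
  by apply: cellP => //; [apply: le1|apply: le2].
- rewrite mem_cat => /orP[] /mapP[t]; rewrite mem_iota => ht ->; rewrite /= andbT; apply: cellP;
    rewrite ?rkP ///width; lia.
- move=> /mapP[ia hia ->]; apply/allP => l /mapP[a a_in ->].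
  have sz : size (iota 0 (width y B T)) = size (rowspec M y B T) by rewrite size_iota size_rowspec.
  have i_lt : ia.1 < width y B T.
    have := map_f fst hia; rewrite -/unzip1 unzip1_zip ?sz // mem_iota; lia.
  have a_spec : ia.2 \in rowspec M y B T by have := map_f snd hia; rewrite -/unzip2 unzip2_zip ?sz.
  apply: cellP => //.
  move: a_spec a_in; rewrite mem_cat => /orP[/nseqP[-> _]|]; first by rewrite inE => /eqP->; exact: rkP.
  rewrite in_cons => /orP[/eqP->|]; first by rewrite inE => /eqP->; exact: rkP.
  rewrite mem_cat => /orP[/mapP[b _ ->]|]; first by rewrite inE => /eqP->; exact: rkP.
  rewrite mem_cat => /orP[/nseqP[-> _]|/nseqP[-> _]]; last by rewrite inE => /eqP->; exact: rkP.
  by rewrite !inE => /or3P[] /eqP->; exact: rkP.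
- move=> /mapP[i]; rewrite mem_iota => hi ->.
  by rewrite /= andbT; apply/and3P; split; apply: cellP; rewrite ?rkP // /width; lia.
Qed.

Lemma reduction_correct (V : language) x :
  (forall z, let cf := exec (c * (size z).+1 ^ k) (init M z) in
     halted cf /\ (@tm_accept M (cf_state cf) <-> V z)) ->
  (exists w, size w <= wit_bound x /\ V (pair_enc x w)) <-> InformationalPersuasion (reduction x).
Proof.
move=> hV; set y := doubled x; set B := wit_bound x; set T := time_bound x.
have y0 : y != [::] by rewrite /y /doubled; case: (flatten _).
have s1 : 1 < #|sigma M| by rewrite card_prod !card_option card_bool; lia.
have cells0 : tcells y B T != [::].
  suff : (0, 0) \in tcells y B T by case: tcells.
  by rewrite mem_tcells // /width; lia.
have acceptE w : size w <= B -> @tm_accept M (conf M (y ++ w) T).1.1 <-> V (pair_enc x w).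
  move=> le_w; have ez : pair_enc x w = y ++ w by rewrite /pair_enc /y /doubled -catA.
  have [h1 h2] := hV (y ++ w).
  (* The verifier may halt before [T], and its configuration is then the same at time [T]. *)
  rewrite ez -h2 -(exec_halted (t' := T) h1); last first.
    by rewrite /T /time_bound; apply: leq_mul => //; apply: leq_exp; rewrite size_cat ltnS leq_add2l.
  have := tape_rel_exec T (tape_rel_init M (y ++ w)).
  rewrite -/(start_tape (y ++ w)) -/(start_cfg M (y ++ w)) -/(conf M (y ++ w) T).
  by case: (conf _ _ _) => [[q p] Tp] [-> _ _].
have redE : reduction x = encode_instance (csp_instance (tcells y B T) #|sigma M| (tclauses M y B T)).
  by rewrite csp_encode // /csp_goal muln_gt0 lt0n size_eq0 cells0; lia.
have yesE := csp_reduction (uniq_tcells y B T) cells0 s1 (tclauses_in B T y0).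
split=> [[w [le_w /(acceptE w le_w) acc]]|].
  exists (csp_instance (tcells y B T) #|sigma M| (tclauses M y B T)); split; last split=> //.
    by apply: csp_valid; rewrite /csp_goal muln_gt0 lt0n size_eq0 cells0; lia.
  by apply/yesE/tableau_correct => //; exists w.
(* Membership gives only some instance with the same code; by injectivity it is the constructed
   one. *)
case=> I [_ []]; rewrite redE => /encode_instance_inj <- /yesE /tableau_correct[//|w [le_w acc]].
by exists w; split=> //; apply/acceptE.
Qed.

End Hardness.

Theorem IP_NP_hard : NP_hard InformationalPersuasion.
Proof.
move=> L [V [[M [c [k hV]]] [c' [k' hL]]]].
exists (reduction M c k c' k'); split; first exact/PT_ptime_computable/PT_reduction.
by move=> x; rewrite hL; apply: (reduction_correct c' k' x hV).
Qed.

Theorem theorem1 : NP_complete InformationalPersuasion.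
Proof. exact: conj IP_in_NP IP_NP_hard. Qed.
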